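(* Let $\gamma\in(0,1)$ and let $\varepsilon>0$, $C_\gamma>0$ be such that every suitable weak solution $w$ of the surface growth model on $Q$ with $\int_{Q_1}|w_x|^3\le\varepsilon$ satisfies $$|w_x(x,t)-w_x(y,s)|\le C_\gamma\,\varepsilon^{1/3}\left(|x-y|+|t-s|^{1/4}\right)^\gamma\quad\text{for all }(x,t),(y,s)\in Q_{1/2}.$$ If $v$ is a suitable weak solution of the surface growth model $v_t+v_{xxxx}=-\partial_{xx}(v_x)^2$ on $Q$ with $\int_{Q_1}|v_x|^3\le\varepsilon$, then $v\in C^\infty(Q_{1/8})$.
   Context: The space dimension is one and $v=v(x,t)$ is scalar. For $z=(x,t)\in\mathbb R^2$ and $r>0$, the biparabolic cylinder is $Q_r(z)=(x-r,x+r)\times(t-r^4,t]$. Write $Q_r=Q_r(0,0)$ and $Q=Q_1(0,0)$. Define $L_{p,q}(Q_r(z))=L_q(t-r^4,t;L_p(x-r,x+r))$. A function $v$ is a suitable weak solution of the surface growth model $v_t+v_{xxxx}=-\partial_{xx}(v_x)^2$ on $Q$ if: (a) $v\in L_{2,\infty}(Q)$ and $v_{xx}\in L_{2,2}(Q)$; (b) the equation holds in the sense of distributions, i.e. $\int\int\left(v(\phi_t-\phi_{xxxx})-v_x^2\phi_{xx}\right)=0$ for every $\phi\in C_0^\infty((-1,1)\times(-1,0))$; (c) (local energy inequality) for every nonnegative $\phi\in C_0^\infty(Q)$ and almost every $t\in(-1,0)$, $$\frac12\int_{-1}^1v^2(t)\phi(t)+\int_{-1}^t\int_{-1}^1|v_{xx}|^2\phi\le\int_{-1}^t\int_{-1}^1\left(\tfrac12(\phi_t-\phi_{xxxx})v^2+2|v_x|^2\phi_{xx}-\tfrac53v_x^3\phi_x-|v_x|^2v\,\phi_{xx}\right).$$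 Since $Q=(-1,1)\times(-1,0]$, a test function $\phi\in C_0^\infty(Q)$ need not vanish at $t=0$; it vanishes only in a neighbourhood of the parabolic boundary. Pointwise and smoothness statements about $v$, $v_x$ are understood after modification on a set of measure zero. *)

(* Defs.v *)
From HB Require Import structures.
From mathcomp Require Import all_boot all_order all_algebra.
From mathcomp Require Import all_classical all_reals all_analysis.

Set Implicit Arguments.
Unset Strict Implicit.
Unset Printing Implicit Defensive.

Import Order.TTheory GRing.Theory Num.Theory.
Import numFieldNormedType.Exports.

Local Open Scope classical_set_scope.
Local Open Scope ring_scope.

(* Points of space-time are pairs z = (x, t) : R * R. *)

Section SurfaceGrowth.
Context {R : realType}.

Local Notation RR := (measurableTypeR R * measurableTypeR R)%type.
Local Notation mu := (@lebesgue_measure R).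

Definition leb2 : {measure set RR -> \bar R} := (mu \x mu)%E.

Definition cyl (z : R * R) (r : R) : set (R * R) :=
  `]z.1 - r, z.1 + r[ `*` `]z.2 - r ^+ 4, z.2].

Definition Q (r : R) : set (R * R) := cyl (0, 0) r.

Definition Q1_open : set (R * R) := `]-1, 1[ `*` `]-1, 0[.

Definition Q1_before (t : R) : set (R * R) := `]-1, 1[ `*` `]-1, t[.

(* Mixed norm of L_{p,q}(Q_r(z)) = L_q(t - r^4, t; L_p(x - r, x + r)):
   exponent p in space (inner norm), exponent q in time (outer norm).
   [f \_ D] is f extended by 0 outside D. *)
Definition Lpq_norm (p q : \bar R) (z : R * R) (r : R) (f : R * R -> R) :
    \bar R :=
  Lnorm mu q ((fun t : R =>
     Lnorm mu p ((fun x : R => (f (x, t))%:E) \_ `]z.1 - r, z.1 + r[))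
     \_ `]z.2 - r ^+ 4, z.2[).

Definition in_Lpq (p q : \bar R) (z : R * R) (r : R) (f : R * R -> R) : Prop :=
  measurable_fun (cyl z r : set RR) (f : RR -> measurableTypeR R) /\
  (Lpq_norm p q z r f < +oo)%E.

(* Classical partial derivatives relative to a set A that is a product of two
   nondegenerate intervals: the increment stays in A, so that the derivative is
   one-sided at an endpoint belonging to A (the t-derivative at the top t = 0 of
   Q_r is a left derivative) and two-sided at interior points. *)
Definition quot_x (f : R * R -> R) (z : R * R) (y : R) : R :=
  (f (y, z.2) - f z) / (y - z.1).

Definition quot_t (f : R * R -> R) (z : R * R) (s : R) : R :=
  (f (z.1, s) - f z) / (s - z.2).

Definition near_x (A : set (R * R)) (z : R * R) : set_system R :=
  within [set y | A (y, z.2)] (z.1)^'.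

Definition near_t (A : set (R * R)) (z : R * R) : set_system R :=
  within [set s | A (z.1, s)] (z.2)^'.

Definition dx (A : set (R * R)) (f : R * R -> R) (z : R * R) : R :=
  lim (quot_x f z @ near_x A z).

Definition dt (A : set (R * R)) (f : R * R -> R) (z : R * R) : R :=
  lim (quot_t f z @ near_t A z).

Fixpoint Ck (A : set (R * R)) (n : nat) (f : R * R -> R) : Prop :=
  {within A, continuous f} /\
  if n is n'.+1 then
    [/\ forall z, A z -> cvg (quot_x f z @ near_x A z),
        forall z, A z -> cvg (quot_t f z @ near_t A z),
        Ck A n' (dx A f) & Ck A n' (dt A f)]
  else True.

Definition Cinfty (A : set (R * R)) (f : R * R -> R) : Prop :=
  forall n, Ck A n f.

(* C_0^infty(A). For A = Q 1 the compact set K may meet the top t = 0, so that f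
   vanishes only near the parabolic boundary. *)
Definition Cinfty0 (A : set (R * R)) (f : R * R -> R) : Prop :=
  Cinfty A f /\
  exists K, [/\ compact K, K `<=` A & forall z, A z -> ~ K z -> f z = 0].

Definition L1loc (U : set (R * R)) (f : R * R -> R) : Prop :=
  forall K : set (R * R), compact K -> K `<=` U ->
    leb2.-integrable (K : set RR) (fun z => (f z)%:E).

(* g is the k-th weak x-derivative of v on Q_1. *)
Definition weak_dx (k : nat) (v g : R * R -> R) : Prop :=
  [/\ L1loc Q1_open v, L1loc Q1_open g,
      measurable_fun (Q 1 : set RR) (g : RR -> measurableTypeR R) &
      forall phi, Cinfty0 Q1_open phi ->
        (\int[leb2]_(z in (Q1_open : set RR))
            (v z * iter k (dx Q1_open) phi z)%:E =
         \int[leb2]_(z in (Q1_open : set RR)) ((-1) ^+ k * (g z * phi z))%:E)%E].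

(* v is a suitable weak solution of v_t + v_xxxx = - (v_x ^ 2)_xx on Q_1, where
   vx and vxx are its weak derivatives v_x and v_xx (determined by v up to a
   null set). *)
Record suitable_weak_solution (v vx vxx : R * R -> R) : Prop := {
  sws_vx : weak_dx 1 v vx;
  sws_vxx : weak_dx 2 v vxx;
  sws_v_L2oo : in_Lpq 2%:E +oo (0, 0) 1 v;
  sws_vxx_L22 : in_Lpq 2%:E 2%:E (0, 0) 1 vxx;
  sws_equation : forall phi, Cinfty0 Q1_open phi ->
    (\int[leb2]_(z in (Q1_open : set RR))
       (v z * (dt Q1_open phi z - iter 4 (dx Q1_open) phi z)
        - vx z ^+ 2 * iter 2 (dx Q1_open) phi z)%:E = 0)%E;
  sws_local_energy : forall phi, Cinfty0 (Q 1) phi ->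
    (forall z, Q 1 z -> 0 <= phi z) ->
    {ae mu, forall t : measurableTypeR R, t \in `]-1, 0[ ->
      (2^-1%:E * \int[mu]_(x in (`](-1)%R, 1%R[%classic : set (measurableTypeR R))) (v (x, t) ^+ 2 * phi (x, t))%:E
       + \int[leb2]_(z in (Q1_before t : set RR))
           (`|vxx z| ^+ 2 * phi z)%:E
       <= \int[leb2]_(z in (Q1_before t : set RR))
           (2^-1 * (dt (Q 1) phi z - iter 4 (dx (Q 1)) phi z) * v z ^+ 2
            + 2 * `|vx z| ^+ 2 * iter 2 (dx (Q 1)) phi z
            - 5 / 3 * vx z ^+ 3 * dx (Q 1) phi z
            - `|vx z| ^+ 2 * v z * iter 2 (dx (Q 1)) phi z)%:E)%E}
}.

Definition ae_eq_on (A : set (R * R)) (f g : R * R -> R) : Prop :=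
  {ae leb2, forall z : RR, A z -> f z = g z}.

(* The parabolic Hoelder estimate |g(x,t) - g(y,s)| <= c (|x-y| + |t-s|^(1/4))^gamma
   on A. *)
Definition holder_on (A : set (R * R)) (c gamma : R) (g : R * R -> R) : Prop :=
  forall x t y s : R, A (x, t) -> A (y, s) ->
    `|g (x, t) - g (y, s)| <= c * (`|x - y| + `|t - s| `^ 4^-1) `^ gamma.

End SurfaceGrowth.

(* Main.v *)
Require Import Defs.
From HB Require Import structures.
From mathcomp Require Import all_boot all_order all_algebra.
From mathcomp Require Import all_classical all_reals all_analysis.
From mathcomp Require Import measurable_realfun ring lra.
Import Order.TTheory GRing.Theory Num.Theory.
Import numFieldNormedType.Exports.
Local Open Scope classical_set_scope.
Local Open Scope ring_scope.

(** The hypothesis turns [v_x] into a Hoelder continuous function near the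
    origin, and a Hoelder continuous solution of a fourth order parabolic equation
    is smooth.

    Let [w] be the Hoelder continuous representative of [v_x] ([slope]).  Testing the
    equation of [v] with x-derivatives of tensor products [f x * psi t], and
    using that [w] is the weak derivative of [v], shows that [w] solves
    [w_t + w_xxxx + (w^2)_xxx = 0] weakly ([slope_equation]).

    The smoothing takes place on Fourier coefficients in [x].  They are taken
    against the real functions [cas (k x) = cos (k x) + sin (k x)], whose derivatives
    are again multiples of functions of the same family, so that no complex
    number occurs.  For a cut-off [z], the coefficient [a_k (t)] of [z * w(., t)] solves
    an ordinary differential equation [a_k' = - k^4 a_k - g_k], where [g_k] gathers the
    terms in which at most three derivatives fall on [cas].  If the coefficients of all
    the localisations of [w] and [w^2] are of order [|k|^(- n - gamma)], then [g_k] is of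
    order [|k|^(3 - n - gamma)] and the damping by [k^4] leaves [a_k] of order
    [|k|^(- (n + 1) - gamma)]: one power is gained ([decay_step]).  A convolution
    estimate passes the gain on to [w^2] ([hart_prod], [decay_sqr]).  For [n = 0] the
    bounds on [w] and on [w^2] are both given by Hoelder continuity
    ([hart_holder], [decay0]).  Hence every power is reached ([decay_all]), the
    Hartley series of [w] can be differentiated term by term, and [w] has jointly
    continuous x-derivatives [W i] of every order, whose time derivatives are the
    differential polynomials that the equation prescribes ([interior_smoothing]).

    To come back to [v], one integrates: there is [V] with [V_x = w] and
    [V_t = - (w_xxx + (w^2)_xx)] ([potential]).  On products of test functions, [v] and [V]
    have the same x- and t-derivatives, so their pairings differ by a multiple of the
    integral ([tensor_constant]), and a function is determined almost everywhere by
    its pairings with tensors ([ae_zero]).  So [v = V + K] almost everywhere.  Finally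
    [V + K] and the differential polynomials in the [W i] form a class that is closed
    under both partial derivatives on [Q (1/8)], one-sided at the top, hence consists of
    smooth functions
    ([Cinfty_class], [ev_Cinfty]). *)

Set Implicit Arguments.
Unset Strict Implicit.
Unset Printing Implicit Defensive.

(** * Continuity, derivatives and integrals on the line *)

Section Continuity.
Context {R : realType} {T : topologicalType}.
Implicit Types f g : T -> R.

Lemma contD f g : continuous f -> continuous g -> continuous (fun x => f x + g x).
Proof. by move=> cf cg x; apply: cvgD; [exact: cf|exact: cg]. Qed.

Lemma contN f : continuous f -> continuous (fun x => - f x).
Proof. by move=> cf x; apply: cvgN; exact: cf. Qed.

Lemma contB f g : continuous f -> continuous g -> continuous (fun x => f x - g x).
Proof. by move=> cf cg x; apply: cvgB; [exact: cf|exact: cg]. Qed.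

Lemma contM f g : continuous f -> continuous g -> continuous (fun x => f x * g x).
Proof. by move=> cf cg x; apply: cvgM; [exact: cf|exact: cg]. Qed.

Lemma cont_cst (c : R) : continuous (fun _ : T => c).
Proof. by move=> x; exact: cvg_cst. Qed.

Lemma contZ (c : R) f : continuous f -> continuous (fun x => c * f x).
Proof. by apply: contM; exact: cont_cst. Qed.

Lemma contX f n : continuous f -> continuous (fun x => f x ^+ n).
Proof.
move=> cf; elim: n => [|n IH].
  by under eq_fun do rewrite expr0; exact: cont_cst.
by under eq_fun do rewrite exprS; exact: contM.
Qed.

Lemma cont_comp (U V W : topologicalType) (f : V -> W) (g : U -> V) :
  continuous f -> continuous g -> continuous (fun x => f (g x)).
Proof. by move=> cf cg x; apply: continuous_comp; [exact: cg|exact: cf]. Qed.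

End Continuity.

Section Drv.
Context {R : realType}.
Implicit Types (f g F G : R -> R) (a b c x : R).

(** Differentiation as a relation between everywhere defined functions: one
    statement gives both the existence and the value of the derivative. *)
Definition drv f g := forall x : R, is_derive x 1 f (g x).

Lemma drv_continuous f g : drv f g -> continuous f.
Proof.
move=> fg x; apply: differentiable_continuous.
by apply/derivable1_diffP; have := fg x => -[].
Qed.

Lemma drv_ext f g f' g' : f =1 f' -> g =1 g' -> drv f g -> drv f' g'.
Proof. by move=> /funext <- /funext <-. Qed.

Lemma drvD f g F G : drv f F -> drv g G ->
  drv (fun x => f x + g x) (fun x => F x + G x).
Proof. by move=> hf hg x; have := hf x; have := hg x => ? ?; exact: is_deriveD. Qed.

Lemma drvN f F : drv f F -> drv (fun x => - f x) (fun x => - F x).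
Proof. by move=> hf x; have := hf x => ?; exact: is_deriveN. Qed.

Lemma drvB f g F G : drv f F -> drv g G ->
  drv (fun x => f x - g x) (fun x => F x - G x).
Proof. by move=> hf hg; apply: drvD => //; exact: drvN. Qed.

Lemma drvM f g F G : drv f F -> drv g G ->
  drv (fun x => f x * g x) (fun x => F x * g x + f x * G x).
Proof.
move=> hf hg x; have := hf x; have := hg x => ? ?.
apply: is_derive_eq.
by rewrite /GRing.scale /=; ring.
Qed.

Lemma drv_cst c : drv (fun=> c) (fun=> 0).
Proof. by move=> x; exact: is_derive_cst. Qed.

Lemma drv_id : drv (fun x => x) (fun=> 1).
Proof. by move=> x; exact: is_derive_id. Qed.

Lemma drvZ c f F : drv f F -> drv (fun x => c * f x) (fun x => c * F x).
Proof.
move=> hf; have := drvM (drv_cst c) hf; apply: drv_ext => // x.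
by rewrite mul0r add0r.
Qed.

Lemma drv_comp f F g G : drv f F -> drv g G ->
  drv (fun x => f (g x)) (fun x => G x * F (g x)).
Proof.
by move=> hf hg x; rewrite mulrC; apply: is_derive1_comp.
Qed.

Lemma drv_shift c f F : drv f F -> drv (fun x => f (x + c)) (fun x => F (x + c)).
Proof.
move=> hf; have := drv_comp hf (drvD drv_id (drv_cst c)).
by apply: drv_ext => // x; rewrite addr0 mul1r.
Qed.

Lemma drv_mvt f F a b : drv f F -> a <= b ->
  exists2 c, a <= c <= b & f b - f a = F c * (b - a).
Proof.
move=> hf ab.
have [|c cab e] := @MVT_segment _ f F a b ab (fun x _ => hf x).
  by apply: continuous_subspaceT; exact: drv_continuous hf.
by exists c => //; move: cab; rewrite in_itv.
Qed.

Lemma drv_ge0_mono f F a b : drv f F -> (forall x, a <= x <= b -> 0 <= F x) ->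
  a <= b -> f a <= f b.
Proof.
move=> hf F0 ab; have [c cab e] := drv_mvt hf ab.
by rewrite -subr_ge0 e mulr_ge0 ?subr_ge0// F0.
Qed.

End Drv.

Section J.
Context {R : realType}.
Implicit Types (f g F G : R -> R) (a b c x : R).
Notation mu := (@lebesgue_measure R).

(** Real-valued, so that linear manipulations carry no finiteness condition. *)
Definition J a b f : R := (\int[mu]_(x in `[a, b]) f x)%R.

Lemma cont_integrable f a b : continuous f ->
  mu.-integrable `[a, b] (EFin \o f).
Proof.
move=> cf; apply: continuous_compact_integrable; first exact: segment_compact.
exact: continuous_subspaceT.
Qed.

Lemma J_FTC2 f F a b : a <= b -> continuous f -> drv F f -> J a b f = F b - F a.
Proof.
rewrite le_eqVlt => /predU1P[<- _ _|ab cf dF].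
  by rewrite /J set_itv1 Rintegral_set1 subrr.
rewrite /J /Rintegral (@continuous_FTC2 _ f F)//.
- exact: continuous_subspaceT.
- have cF := drv_continuous dF; split.
  + by move=> x _; have := dF x => -[].
  + by apply: cvg_at_right_filter; exact: cF.
  + by apply: cvg_at_left_filter; exact: cF.
- by move=> x _; rewrite derive1E; have := dF x => ?; rewrite derive_val.
Qed.

Lemma prim_exists f : continuous f -> exists F, drv F f.
Proof.
move=> cf.
pose F x := if 0 <= x then J 0 x f else - J x 0 f.
exists F => x.
pose a : R := - `|x| - 1.
have axE : a < x by rewrite /a; have := ler_norm (- x); rewrite normrN; lra.
have a0 : a < 0 by rewrite /a; have := normr_ge0 x; lra.
have ch (p q : R) : a <= p -> p <= q -> J a q f - J a p f = J p q f.
  move=> ap pq; rewrite /J Rintegral_itvB ?bnd_simp//.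
    rewrite Rintegral_itv_obnd_cbnd//.
    by apply: integrableS (@cont_integrable f p q cf) => //; exact: subset_itv_oc_cc.
  exact: cont_integrable.
have FE y : a < y -> F y = J a y f - J a 0 f.
  move=> ay; rewrite /F; case: ifPn => [y0|]; last rewrite -ltNge => y0.
    by rewrite ch// ltW.
  by rewrite -(@ch y 0) ?opprB// ltW.
have [d1 d2] : derivable (fun y => J a y f) x 1 /\ derive1 (fun y => J a y f) x = f x.
  apply: (@continuous_FTC1_closed _ _ _ _ (x + 1)) => //;
    [by lra|exact: cont_integrable|exact: cf].
have dJ : is_derive x 1 (fun y => J a y f - J a 0 f) (f x).
  have h : is_derive x 1 (fun y => J a y f) (f x) by apply: DeriveDef; [exact: d1|rewrite -derive1E; exact: d2].
  rewrite -[f x]subr0; apply: is_deriveB.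
apply: near_eq_is_derive dJ.
by near=> y; rewrite FE//; near: y; exact: lt_nbhsr.
Unshelve. all: by end_near. Qed.

Lemma J_eq f g a b : (forall x, a <= x <= b -> f x = g x) -> J a b f = J a b g.
Proof.
by move=> fg; apply: eq_Rintegral => x; rewrite inE/= in_itv/= => /fg.
Qed.

Lemma J_add f g a b : a <= b -> continuous f -> continuous g ->
  J a b (fun x => f x + g x) = J a b f + J a b g.
Proof.
by move=> ab cf cg; rewrite /J RintegralD//; exact: cont_integrable.
Qed.

Lemma J_sub f g a b : a <= b -> continuous f -> continuous g ->
  J a b (fun x => f x - g x) = J a b f - J a b g.
Proof.
by move=> ab cf cg; rewrite /J RintegralB//; exact: cont_integrable.
Qed.

Lemma J_scale c f a b : continuous f ->
  J a b (fun x => c * f x) = c * J a b f.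
Proof. by move=> cf; rewrite /J RintegralZl//; exact: cont_integrable. Qed.

Lemma J0 a b : J a b (fun=> 0) = 0.
Proof. by rewrite /J /Rintegral integral0. Qed.

Lemma J_cst c a b : a <= b -> J a b (fun=> c) = c * (b - a).
Proof.
move=> ab; rewrite (@J_FTC2 _ (fun x => c * x))//; first by ring.
  by move=> x; exact: cvg_cst.
by have := drvZ c (@drv_id R); apply: drv_ext => // x; rewrite mulr1.
Qed.

Lemma J_le f g a b : continuous f -> continuous g ->
  (forall x, a <= x <= b -> f x <= g x) -> J a b f <= J a b g.
Proof.
move=> cf cg fg.
apply: (le_Rintegral _ (cont_integrable a b cf) (cont_integrable a b cg)).
  by [].
by move=> x /=; rewrite in_itv/=; exact: fg.
Qed.

Lemma J_ge0 f a b : continuous f ->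
  (forall x, a <= x <= b -> 0 <= f x) -> 0 <= J a b f.
Proof.
move=> cf f0; rewrite -(J0 a b); apply: J_le => // x; exact: cvg_cst.
Qed.

Lemma J_norm_le f a b M : a <= b -> continuous f ->
  (forall x, a <= x <= b -> `|f x| <= M) -> `|J a b f| <= M * (b - a).
Proof.
move=> ab cf fM; rewrite ler_norml -mulNr -!J_cst//; apply/andP; split.
  apply: J_le => //; first by move=> x; exact: cvg_cst.
  by move=> x /fM; rewrite ler_norml => /andP[].
apply: J_le => //; first by move=> x; exact: cvg_cst.
by move=> x /fM; rewrite ler_norml => /andP[].
Qed.

Lemma J_chasles f a b c : continuous f -> a <= b -> b <= c ->
  J a c f = J a b f + J b c f.
Proof.
move=> cf ab bc; have [F dF] := prim_exists cf.
rewrite !(@J_FTC2 _ F)//; last exact: le_trans bc.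
by ring.
Qed.

Lemma J_shift f a b c : continuous f -> a <= b ->
  J a b (fun x => f (x + c)) = J (a + c) (b + c) f.
Proof.
move=> cf ab; have [F dF] := prim_exists cf.
rewrite (@J_FTC2 f F)//; last by rewrite lerD2r.
rewrite (@J_FTC2 _ (fun x => F (x + c)))//; last exact: drv_shift.
move=> x; apply: (@continuous_comp _ _ _ (fun x => x + c) f); last exact: cf.
by apply: continuousD => //; exact: cvg_cst.
Qed.

Lemma J_parts f g F G a b : a <= b -> continuous F -> continuous G ->
  drv f F -> drv g G ->
  J a b (fun x => F x * g x) = f b * g b - f a * g a - J a b (fun x => f x * G x).
Proof.
move=> ab cF cG df dg.
have cf := drv_continuous df; have cg := drv_continuous dg.
have cFg := contM cF cg; have cfG := contM cf cG.
apply/eqP; rewrite eq_sym subr_eq -J_add//; apply/eqP.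
by rewrite (@J_FTC2 _ (fun x => f x * g x))//; [exact: contD|exact: drvM].
Qed.

(** The primitive is defined and differentiable on the whole line, although the
    integral only describes it to the right of [a]. *)
Lemma drv_J f a : continuous f -> exists2 F, drv F f & forall x, a <= x -> F x = J a x f.
Proof.
move=> cf; have [F dF] := prim_exists cf.
exists (fun x => F x - F a).
  by have := drvB dF (drv_cst (F a)); apply: drv_ext => // x; rewrite subr0.
by move=> x ax; rewrite (@J_FTC2 _ F).
Qed.

Lemma J_gt0 f a b x0 : continuous f -> a < x0 < b ->
  (forall x, a <= x <= b -> 0 <= f x) -> 0 < f x0 -> 0 < J a b f.
Proof.
move=> cf /andP[ax0 x0b] f0 fx0.
have [F dF FE] := drv_J a cf.
rewrite -FE; last by rewrite ltW// (lt_trans ax0).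
have Fa0 : F a = 0 by rewrite FE// /J set_itv1 Rintegral_set1.
have mF x y : a <= x -> x <= y -> y <= b -> F x <= F y.
  move=> ax xy yb; apply: (drv_ge0_mono dF) => // z /andP[xz zy]; apply: f0; lra.
have Fb0 : 0 <= F b by rewrite -Fa0; apply: mF; lra.
rewrite lt_neqAle Fb0 andbT; apply/eqP => Fb.
have F0 x : a <= x <= b -> F x = 0.
  by move=> /andP[ax xb]; apply/le_anti; have := mF a x; have := mF x b; rewrite Fa0 -Fb => -> // -> //; lra.
have := dF x0.
have : is_derive x0 1 F 0.
  apply: near_eq_is_derive (is_derive_cst (0:R) x0 1).
  near=> y; rewrite F0//; apply/andP; split; apply: ltW; near: y.
    exact: lt_nbhsr.
  exact: lt_nbhsl.
move=> h1 h2.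
have := @derive_val _ _ _ _ _ F _ h1; rewrite (@derive_val _ _ _ _ _ F _ h2) => e.
by rewrite e ltxx in fx0.
Unshelve. all: by end_near. Qed.

End J.

(** * Smooth functions, bumps and test functions *)

Section Smooth.
Context {R : realType}.
Implicit Types (f g F G u z : R -> R) (a b c p q x : R).

Definition D f : R -> R := derive1 f.

(** A second order Taylor bound identifies the derivative; this is how
    series are differentiated term by term, and how flat functions are differentiated at
    the origin. *)
Lemma is_derive_quad f x l C : (forall h, `|h| <= 1 -> `|f (x + h) - f x - h * l| <= C * h ^+ 2) ->
  is_derive x 1 f l.
Proof.
move=> H.
suff cv : h^-1 *: (f (h *: (1:R) + x) - f x) @[h --> 0^'] --> l.
  apply: DeriveDef; first by apply/cvg_ex; exists l; exact: cv.
  by apply: cvg_lim => //; exact: cv.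
apply/cvgrPdist_le => e e0; near=> h.
have h0 : h != 0 by near: h; exact: nbhs_dnbhs_neq.
have h1 : `|h| <= 1.
  by near: h; apply: dnbhs0_le.
have he : `|h| <= e / (`|C| + 1).
  by near: h; apply: dnbhs0_le; rewrite divr_gt0// ltr_wpDl.
have := H h h1; rewrite /GRing.scale/= mulr1 (addrC h x) => Hh.
rewrite -(@ler_pM2l _ `|h|) ?normr_gt0// -normrM.
have -> : h * (l - h^-1 * (f (x + h) - f x)) = - (f (x + h) - f x - h * l).
  by field.
rewrite normrN (le_trans Hh)// -[h ^+ 2]real_normK ?num_real// expr2 mulrA mulrC.
apply: ler_wpM2l => //.
rewrite -(@ler_pM2r _ (`|C| + 1)) ?ltr_wpDl// in he.
move: he; rewrite divfK ?gt_eqF ?ltr_wpDl// => he.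
apply: le_trans he; rewrite [leRHS]mulrC; apply: ler_wpM2r => //.
by rewrite (le_trans (ler_norm _))// lerDl.
Unshelve. all: by end_near. Qed.

Fixpoint Cn n f : Prop :=
  if n is n'.+1 then exists2 g, drv f g & Cn n' g else continuous f.

Definition smooth f := forall n, Cn n f.

Lemma CnS n f : Cn n.+1 f -> Cn n f.
Proof.
elim: n f => [|n IH] f [g dg Cg]; first exact: drv_continuous dg.
by exists g => //; exact: IH.
Qed.

Lemma Cn_cst n c : Cn n (fun=> c).
Proof.
elim: n c => [|n IH] c; first exact: cont_cst.
by exists (fun=> 0) => //; exact: drv_cst.
Qed.

Lemma Cn_id n : Cn n (fun x : R => x).
Proof.
case: n => [|n]; first by move=> x; exact: cvg_id.
by exists (fun=> 1); [exact: drv_id|exact: Cn_cst].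
Qed.

Lemma CnD n f g : Cn n f -> Cn n g -> Cn n (fun x => f x + g x).
Proof.
elim: n f g => [|n IH] f g; first exact: contD.
move=> [F dF CF] [G dG CG]; exists (fun x => F x + G x); last exact: IH.
exact: drvD.
Qed.

Lemma CnM n f g : Cn n f -> Cn n g -> Cn n (fun x => f x * g x).
Proof.
elim: n f g => [|n IH] f g; first exact: contM.
move=> hf hg; have := CnS hf; have := CnS hg; move: hf hg.
move=> [F dF CF] [G dG CG] hg hf; exists (fun x => F x * g x + f x * G x).
  exact: drvM.
by apply: CnD; exact: IH.
Qed.

Lemma Cn_comp n f g : Cn n f -> Cn n g -> Cn n (fun x => f (g x)).
Proof.
elim: n f g => [|n IH] f g; first exact: cont_comp.
move=> [F dF CF] hg; have := CnS hg; case: hg => G dG CG hg.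
exists (fun x => G x * F (g x)); first exact: drv_comp.
by apply: CnM => //; exact: IH.
Qed.

Lemma smooth_cst c : smooth (fun=> c). Proof. by move=> n; exact: Cn_cst. Qed.
Lemma smooth_id : smooth (fun x => x). Proof. by move=> n; exact: Cn_id. Qed.
Lemma smoothD f g : smooth f -> smooth g -> smooth (fun x => f x + g x).
Proof. by move=> hf hg n; exact: CnD. Qed.
Lemma smoothM f g : smooth f -> smooth g -> smooth (fun x => f x * g x).
Proof. by move=> hf hg n; exact: CnM. Qed.
Lemma smooth_comp f g : smooth f -> smooth g -> smooth (fun x => f (g x)).
Proof. by move=> hf hg n; exact: Cn_comp. Qed.
Lemma smoothZ c f : smooth f -> smooth (fun x => c * f x).
Proof. by apply: smoothM; exact: smooth_cst. Qed.
Lemma smoothN f : smooth f -> smooth (fun x => - f x).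
Proof. by move=> /(smoothZ (-1)); under eq_fun do rewrite mulN1r. Qed.
Lemma smoothB f g : smooth f -> smooth g -> smooth (fun x => f x - g x).
Proof. by move=> hf hg; apply: smoothD => //; exact: smoothN. Qed.
Lemma smoothX f n : smooth f -> smooth (fun x => f x ^+ n).
Proof.
move=> hf; elim: n => [|n IH].
  by under eq_fun do rewrite expr0; exact: smooth_cst.
by under eq_fun do rewrite exprS; exact: smoothM.
Qed.

Lemma smooth_cont f : smooth f -> continuous f.
Proof. by move=> /(_ 0). Qed.

Lemma smooth_prim F f : smooth f -> drv F f -> smooth F.
Proof.
move=> hf dF [|n]; first exact: drv_continuous dF.
by exists f.
Qed.

Lemma smooth_drv f : smooth f -> drv f (D f) /\ smooth (D f).
Proof.
move=> hf.
have e g : drv f g -> D f = g.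
  by move=> fg; apply/funext => x; rewrite /D derive1E; have := fg x => ?; rewrite derive_val.
split; first by have [g dg _] := hf 1%N; rewrite (e g).
by move=> n; have [g dg Cg] := hf n.+1; rewrite (e g).
Qed.

Lemma drv_derive1 f F : drv f F -> D f = F.
Proof.
by move=> fg; apply/funext => x; rewrite /D derive1E; have := fg x => ?; rewrite derive_val.
Qed.

(** The functions [x^(- m) exp (- 1 / x)] extended by 0: as a family they are stable
    under differentiation, which makes [flat 0] smooth. *)
Definition flat m x : R := if 0 < x then x^-1 ^+ m * expR (- x^-1) else 0.

Lemma flat_ge0 m x : 0 <= flat m x.
Proof.
rewrite /flat; case: ifPn => // x0.
by rewrite mulr_ge0 ?expR_ge0// exprn_ge0// invr_ge0 ltW.
Qed.

(** The exponential series dominates [x^(- m - 2) / (m + 2)!] at the point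
    [1 / x]. *)
Lemma flat_le m x : flat m x <= (m.+2)`!%:R * x ^+ 2.
Proof.
rewrite /flat; case: ifPn => [x0|_]; last by rewrite mulr_ge0// sqr_ge0.
have y0 : 0 <= x^-1 by rewrite invr_ge0 ltW.
rewrite expRN ler_pdivrMr ?expR_gt0//.
have := expR_ge1Dxn m.+1 y0.
set f := (m.+2)`!%:R; set E := expR _ => H.
have f0 : 0 < f :> R by rewrite ltr0n fact_gt0.
have xx0 : 0 < x ^+ 2 by rewrite exprn_gt0.
have -> : x^-1 ^+ m = f * x ^+ 2 * (x^-1 ^+ m.+2 / f).
  have -> : x^-1 ^+ m.+2 = x^-1 ^+ m * x^-1 ^+ 2 by rewrite -exprD addn2.
  move: (x^-1 ^+ m) => t; field.
  by rewrite !gt_eqF.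
apply: ler_wpM2l; first by rewrite mulr_ge0 ?(ltW f0) ?(ltW xx0).
by apply: le_trans H; rewrite lerDr.
Qed.

Lemma flat_drv m : drv (flat m) (fun x => - m%:R * flat m.+1 x + flat m.+2 x).
Proof.
move=> x; have [x0|x0|->] := ltgtP x 0.
- rewrite /flat; rewrite !ifF ?mulr0 ?addr0; last 2 first.
    by apply/negbTE; rewrite -leNgt ltW.
    by apply/negbTE; rewrite -leNgt ltW.
  apply: near_eq_is_derive (is_derive_cst (0:R) x 1).
  near=> y; rewrite ifF//; apply/negbTE; rewrite -leNgt; apply: ltW; near: y.
  exact: lt_nbhsl.
- rewrite {2 3}/flat x0.
  have dx : is_derive x 1 (fun y : R => y^-1) (- x ^- 2).
    apply: is_derive_eq; first by apply: is_deriveV; rewrite gt_eqF.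
    by rewrite /GRing.scale/= mulr1.
  have h1 := @is_deriveX _ _ _ m _ _ _ dx.
  have h2 := @is_derive1_comp _ _ (- (fun y : R => y^-1)) _ _ _ (is_derive_expR (- x^-1)) (is_deriveN dx).
  have h3 := is_deriveM h1 h2.
  apply: near_eq_is_derive; last first.
    apply: (is_derive_eq h3).
    rewrite /GRing.scale/= !fctE /=.
    have -> : x ^- 2 = x^-1 ^+ 2 by rewrite exprVn.
    move: (x^-1) (expR _) => y E.
    case: m {h1 h3} => [|m]; first by rewrite /= !mulr0n; ring.
    by rewrite -[m.+1.-1]/m !exprS; ring.
  near=> y; have y0 : 0 < y by near: y; exact: lt_nbhsr.
  by rewrite /flat y0 !fctE.
- have f0 k : flat k 0 = 0 by rewrite /flat ltxx.
  rewrite !f0 mulr0 addr0; apply: (@is_derive_quad _ _ _ (m.+2)`!%:R) => h _.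
  by rewrite f0 add0r mulr0 !subr0 ger0_norm ?flat_ge0// flat_le.
Unshelve. all: by end_near. Qed.

Lemma flat_smooth m : smooth (flat m).
Proof.
move=> n; elim: n m => [|n IH] m; first exact: drv_continuous (@flat_drv m).
exists (fun x => - m%:R * flat m.+1 x + flat m.+2 x); first exact: flat_drv.
by apply: CnD => //; apply: CnM => //; exact: Cn_cst.
Qed.

Definition hump a b x := flat 0 (x - a) * flat 0 (b - x).

Lemma hump_smooth a b : smooth (hump a b).
Proof.
apply: smoothM; apply: smooth_comp; try exact: flat_smooth.
- by apply: smoothB; [exact: smooth_id|exact: smooth_cst].
- by apply: smoothB; [exact: smooth_cst|exact: smooth_id].
Qed.

Lemma flat0_gt0 x : 0 < x -> 0 < flat 0 x.
Proof. by move=> x0; rewrite /flat x0 expr0 mul1r expR_gt0. Qed.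

Lemma flat0_le0 x : x <= 0 -> flat 0 x = 0.
Proof. by move=> x0; rewrite /flat ifF//; apply/negbTE; rewrite -leNgt. Qed.

Lemma flat0_le1 x : flat 0 x <= 1.
Proof.
rewrite /flat; case: ifPn => // x0; rewrite expr0 mul1r -expR0 ler_expR.
by rewrite oppr_le0 invr_ge0 ltW.
Qed.

Lemma hump_ge0 a b x : 0 <= hump a b x.
Proof. by rewrite mulr_ge0// flat_ge0. Qed.

Lemma hump_le1 a b x : hump a b x <= 1.
Proof. by rewrite mulr_ile1// ?flat_ge0// flat0_le1. Qed.

Lemma hump_gt0 a b x : a < x < b -> 0 < hump a b x.
Proof. by case/andP => ax xb; rewrite mulr_gt0// flat0_gt0// subr_gt0. Qed.

Lemma hump_out a b x : ~~ (a < x < b) -> hump a b x = 0.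
Proof.
rewrite negb_and -!leNgt => /orP[h|h]; rewrite /hump.
  by rewrite flat0_le0 ?mul0r// subr_le0.
by rewrite [X in _ * X]flat0_le0 ?mulr0// subr_le0.
Qed.

Definition supp a b f := forall x, ~~ (a <= x <= b) -> f x = 0.

Lemma hump_supp a b : supp a b (hump a b).
Proof.
move=> x h; apply: hump_out; apply: contra h => /andP[? ?]; apply/andP; lra.
Qed.

Lemma supp_sub a b p q f : a <= p -> q <= b -> supp p q f -> supp a b f.
Proof. by move=> ap qb h x hx; apply: h; apply: contra hx => /andP[? ?]; apply/andP; lra. Qed.

(** Outside the closed interval the function vanishes on a neighbourhood. *)
Lemma supp_drv a b f F : supp a b f -> drv f F -> supp a b F.
Proof.
move=> hs df x hx.
have h0 : is_derive x 1 f 0.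
  apply: near_eq_is_derive (is_derive_cst (0:R) x 1).
  move: hx; rewrite negb_and -!ltNge => /orP[h|h]; near=> y; rewrite hs//.
    by rewrite negb_and -!ltNge; apply/orP; left; near: y; exact: lt_nbhsl.
  by rewrite negb_and -!ltNge; apply/orP; right; near: y; exact: lt_nbhsr.
have := df x => h1.
by rewrite -(@derive_val _ _ _ _ _ f _ h1) (@derive_val _ _ _ _ _ f _ h0).
Unshelve. all: by end_near. Qed.

Lemma J_eq0 f a b : (forall x, a <= x <= b -> f x = 0) -> J a b f = 0.
Proof. by move=> h; rewrite (@J_eq _ _ (fun=> 0))// J0. Qed.

Lemma supp_end a b f : supp a b f -> continuous f -> f a = 0 /\ f b = 0.
Proof.
have key (g : R -> R) c : continuous g -> (forall x, x < c -> g x = 0) -> g c = 0.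
  move=> cg h.
  have /cvgrPdist_lt H := cg c.
  apply/eqP; rewrite -normr_le0; apply/ler_addgt0Pr => e e0; rewrite add0r.
  have /nbhs_ballP[d /= d0 /(_ (c - d / 2))] := H e e0.
  rewrite /ball/= opprB addrC subrK gtr0_norm ?divr_gt0//.
  rewrite (h (c - _)); last by rewrite ltrBlDr ltrDl divr_gt0.
  by rewrite subr0 => H1; apply/ltW/H1; rewrite ltr_pdivrMr// ltr_pMr// ltr1n.
move=> hs cf; split; first by apply: key => // x xa; apply: hs; rewrite negb_and -ltNge xa.
rewrite -[b]opprK; apply: (key (fun x => f (- x)) (- b)).
  by apply: cont_comp => //; apply: contN => x; exact: cvg_id.
by move=> x xa; apply: hs; rewrite negb_and -!ltNge; apply/orP; right; lra.
Qed.

Lemma J_supp a b p q f : continuous f -> supp p q f -> a <= p -> p <= q -> q <= b ->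
  J a b f = J p q f.
Proof.
move=> cf hs ap pq qb.
have [fp fq] := supp_end hs cf.
rewrite (@J_chasles _ _ a p) ?(le_trans pq)//.
rewrite (@J_chasles _ _ p q)//.
rewrite (@J_eq0 f a p) ?(@J_eq0 f q b) ?add0r ?addr0// => x /andP[h1 h2].
  move: h1; rewrite le_eqVlt => /predU1P[<-//|h]; apply: hs.
  by rewrite negb_and -!ltNge h orbT.
move: h2; rewrite le_eqVlt => /predU1P[->//|h]; apply: hs.
by rewrite negb_and -!ltNge h.
Qed.

(** A function of integral zero has a primitive with the same support: this is
    what allows derivatives of test functions to be recognised. *)
Lemma supp_prim p q f : smooth f -> supp p q f -> p <= q -> J p q f = 0 ->
  exists F, [/\ smooth F, supp p q F & drv F f].
Proof.
move=> sf hs pq I0; have [F dF FE] := drv_J p (smooth_cont sf).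
have F0 : F p = 0 by rewrite FE// /J set_itv1 Rintegral_set1.
have Fq : F q = 0 by rewrite FE.
exists F; split => //; first exact: smooth_prim dF.
move=> x; rewrite negb_and -!ltNge => /orP[h|h].
  have [c /andP[c1 c2] e] := drv_mvt dF (ltW h).
  move: e; rewrite F0 sub0r.
  have -> : f c = 0.
    move: c2; rewrite le_eqVlt => /predU1P[->|c2].
      by have [] := supp_end hs (smooth_cont sf).
    by apply: hs; rewrite negb_and -!ltNge c2.
  by rewrite mul0r => /eqP; rewrite oppr_eq0 => /eqP.
have [c /andP[c1 c2] e] := drv_mvt dF (ltW h).
move: e; rewrite Fq subr0.
have -> : f c = 0.
  move: c1; rewrite le_eqVlt => /predU1P[<-|c1].
    by have [] := supp_end hs (smooth_cont sf).
  by apply: hs; rewrite negb_and -!ltNge c1 orbT.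
by rewrite mul0r.
Qed.

(** The strict inequalities keep the support compact in the open interval, with
    room left for cut-offs that are equal to 1 on it. *)
Definition tst a b f := smooth f /\ exists p q, [/\ a < p, p < q, q < b & supp p q f].

Lemma tst_smooth a b f : tst a b f -> smooth f. Proof. by case. Qed.
Lemma tst_cont a b f : tst a b f -> continuous f.
Proof. by move=> /tst_smooth/smooth_cont. Qed.

Lemma tst_supp a b f : tst a b f -> supp a b f.
Proof.
by move=> [_ [p [q [ap pq qb]]]]; apply: supp_sub; exact: ltW.
Qed.

Lemma tst_sub a b p q f : a <= p -> q <= b -> tst p q f -> tst a b f.
Proof.
move=> ap qb [sf [p' [q' [h1 h2 h3 h4]]]]; split => //; exists p', q'; split => //; lra.
Qed.

Lemma tst_drv a b f : tst a b f -> tst a b (D f).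
Proof.
move=> [sf [p [q [ap pq qb hs]]]]; have [df sf'] := smooth_drv sf.
by split => //; exists p, q; split => //; exact: supp_drv df.
Qed.

Lemma tstMr a b f g : tst a b f -> smooth g -> tst a b (fun x => f x * g x).
Proof.
move=> [sf [p [q [ap pq qb hs]]]] sg; split; first exact: smoothM.
by exists p, q; split => // x hx; rewrite hs ?mul0r.
Qed.

Lemma tstZ a b c f : tst a b f -> tst a b (fun x => c * f x).
Proof.
move=> [sf [p [q [ap pq qb hs]]]]; split; first exact: smoothZ.
by exists p, q; split => // x hx; rewrite hs ?mulr0.
Qed.

Lemma tstD a b f g : tst a b f -> tst a b g -> tst a b (fun x => f x + g x).
Proof.
move=> [sf [p [q [ap pq qb hs]]]] [sg [p' [q' [ap' pq' qb' hs']]]].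
split; first exact: smoothD.
exists (Num.min p p'), (Num.max q q'); split.
- by rewrite lt_min ap.
- by rewrite lt_max gt_min pq.
- by rewrite gt_max qb.
- move=> x; rewrite ge_min le_max => hx.
  by rewrite hs ?hs' ?addr0//; apply: contra hx => /andP[-> ->]; rewrite ?orbT.
Qed.

Lemma tst_hump a b p q : a < p -> p < q -> q < b -> tst a b (hump p q).
Proof.
by move=> ap pq qb; split; [exact: hump_smooth|exists p, q; split => //; exact: hump_supp].
Qed.

Lemma J_hump_gt0 a b p q : a <= p -> p < q -> q <= b -> 0 < J a b (hump p q).
Proof.
move=> ap pq qb.
apply: (@J_gt0 _ _ _ _ ((p + q) / 2)); first exact: smooth_cont (hump_smooth _ _).
- by apply/andP; split; lra.
- by move=> x _; exact: hump_ge0.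
- by apply: hump_gt0; apply/andP; split; lra.
Qed.

(** The normalised primitive of a bump. *)
Lemma step_exists p q : p < q -> exists S : R -> R,
  [/\ smooth S, forall x, x <= p -> S x = 0, forall x, q <= x -> S x = 1
    & forall x, 0 <= S x <= 1].
Proof.
move=> pq; pose I := J p q (hump p q).
have I0 : 0 < I by exact: J_hump_gt0.
have sb := hump_smooth p q; have cb := smooth_cont sb.
have [F dF FE] := drv_J p cb.
have Fp : F p = 0 by rewrite FE// /J set_itv1 Rintegral_set1.
have Fq : F q = I by rewrite FE// ltW.
have mF x y : x <= y -> F x <= F y.
  by apply: (drv_ge0_mono dF) => z _; exact: hump_ge0.
have F0 x : x <= p -> F x = 0.
  move=> xp; have [c /andP[c1 c2] e] := drv_mvt dF xp; move: e; rewrite Fp sub0r.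
  rewrite hump_out ?mul0r; last by rewrite negb_and -!leNgt c2.
  by move=> /eqP; rewrite oppr_eq0 => /eqP.
have F1 x : q <= x -> F x = I.
  move=> qx; have [c /andP[c1 c2] e] := drv_mvt dF qx; move: e; rewrite Fq.
  rewrite hump_out ?mul0r; last by rewrite negb_and -!leNgt c1 orbT.
  by move=> /eqP; rewrite subr_eq0 => /eqP.
exists (fun x => I^-1 * F x); split.
- by apply: smoothZ; exact: smooth_prim dF.
- by move=> x xp; rewrite F0// mulr0.
- by move=> x xp; rewrite F1// mulVf// gt_eqF.
- move=> x; apply/andP; split.
    rewrite mulr_ge0 ?invr_ge0 ?(ltW I0)//.
    have [/F0->//|/ltW/mF] := leP x p; by rewrite Fp.
  rewrite mulrC ler_pdivrMr// mul1r.
  by have [/F1->//|/ltW/mF] := leP q x; rewrite Fq.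
Qed.

Lemma cutoff_exists a b p q : a < p -> p <= q -> q < b -> exists2 z, tst a b z &
  forall x, p <= x <= q -> z x = 1.
Proof.
move=> ap pq qb.
have [S [sS S0 S1 S01]] := @step_exists ((a + p) / 2) p ltac:(lra).
have [T [sT T0 T1 T01]] := @step_exists q ((q + b) / 2) ltac:(lra).
exists (fun x => S x * (1 - T x)); last first.
  by move=> x /andP[px xq]; rewrite S1// T0// subr0 mulr1.
split; first by apply: smoothM => //; apply: smoothB => //; exact: smooth_cst.
exists ((a + p) / 2), ((q + b) / 2); split; try lra.
move=> x; rewrite negb_and -!ltNge => /orP[h|h].
  by rewrite S0 ?mul0r// ltW.
by rewrite T1 ?subrr ?mulr0// ltW.
Qed.

Lemma tst_cutoff a b f : tst a b f -> exists2 g, tst a b g & forall x, f x * g x = f x.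
Proof.
move=> [sf [p [q [ap pq qb hs]]]].
have [g tg g1] := cutoff_exists ap (ltW pq) qb.
exists g => // x; have [h|h] := boolP (p <= x <= q); first by rewrite g1 ?mulr1.
by rewrite hs ?mul0r.
Qed.

(** If [u x > 0], then a bump around [x] inside the neighbourhood where [u] stays
    positive has positive integral against [u]. *)
Lemma fundamental_lemma a b u : continuous u ->
  (forall z, tst a b z -> J a b (fun x => z x * u x) = 0) ->
  forall x, a < x < b -> u x = 0.
Proof.
move: u; have key u : continuous u ->
  (forall z, tst a b z -> J a b (fun x => z x * u x) = 0) ->
  forall x, a < x < b -> u x <= 0.
  move=> cu H x /andP[ax xb]; rewrite leNgt; apply/negP => ux.
  have /cvgrPdist_lt /(_ _ ux) /nbhs_ballP[d /= d0 hd] := cu x.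
  pose e := Num.min d (Num.min (x - a) (b - x)) / 2.
  have e0 : 0 < e by rewrite divr_gt0// !lt_min d0 !subr_gt0 ax.
  have [ed ea eb] : [/\ e < d, e < x - a & e < b - x].
    have h : e < Num.min d (Num.min (x - a) (b - x)).
      by rewrite ltr_pdivrMr// ltr_pMr ?ltr1n// !lt_min d0 !subr_gt0 ax.
    by move: h; rewrite !lt_min => /and3P[].
  have tb : tst a b (hump (x - e) (x + e)) by apply: tst_hump; lra.
  have := H _ tb; apply/eqP; rewrite gt_eqF//.
  have up y : x - e < y < x + e -> 0 < u y.
    move=> /andP[y1 y2]; have := hd y; rewrite /ball/= => /(_ _).
    have -> : `|x - y| < d by rewrite ltr_norml; apply/andP; split; lra.
    by move=> /(_ isT); rewrite ltr_norml => /andP[_]; lra.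
  apply: (@J_gt0 _ _ _ _ x) => //.
  - by apply: contM => //; exact: tst_cont tb.
  - by rewrite ax.
  - move=> y _; have [h|h] := boolP (x - e < y < x + e).
      by rewrite mulr_ge0 ?hump_ge0// ltW// up.
    by rewrite hump_out ?mul0r.
  - by rewrite mulr_gt0// hump_gt0//; apply/andP; split; lra.
move=> u cu H x hx; apply/le_anti/andP; split; first exact: key.
rewrite -oppr_le0; apply: (key (fun x => - u x)) => //; first exact: contN.
move=> z tz; under [X in J _ _ X]funext do rewrite mulrN -mulN1r.
by rewrite J_scale ?H ?mulr0//; apply: contM => //; exact: tst_cont tz.
Qed.

(** Subtracting from a test function its multiple of a fixed bump leaves the
    derivative of a test function; so [u] minus its mean against the bump is orthogonal to
    all test functions. *)
Lemma dubois_reymond a b u : continuous u ->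
  (forall z, tst a b z -> J a b (fun x => u x * D z x) = 0) ->
  forall x y, a < x < b -> a < y < b -> u x = u y.
Proof.
move=> cu H x0 y0 hx0 hy0.
have ab : a < b by move: hx0 => /andP[]; exact: lt_trans.
pose p := (2 * a + b) / 3; pose q := (a + 2 * b) / 3.
have ap : a < p by rewrite /p; lra.
have pq : p < q by rewrite /p /q; lra.
have qb : q < b by rewrite /q; lra.
have tb := tst_hump ap pq qb.
set r0 := hump p q in tb.
have I0 : 0 < J a b r0 by apply: J_hump_gt0 => //; exact: ltW.
pose m := J a b (fun x => r0 x * u x) / J a b r0.
have cr0 : continuous r0 := tst_cont tb.
suff um x : a < x < b -> u x = m by rewrite !um.
move=> hx; apply/eqP; rewrite -subr_eq0; apply/eqP.
apply: (@fundamental_lemma a b (fun x => u x - m)) => //.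
  by apply: contB => //; exact: cont_cst.
move=> z tz; have cz := tst_cont tz.
pose f x := z x - J a b z / J a b r0 * r0 x.
have tf : tst a b f by apply: tstD => //; under eq_fun do rewrite -mulNr; exact: tstZ.
have [sf [p' [q' [ap' pq' qb' hs]]]] := tf.
have If : J p' q' f = 0.
  rewrite -(@J_supp a b p' q')//; [|exact: tst_cont tf|exact: ltW..].
  rewrite J_sub// ?J_scale ?divfK ?subrr ?gt_eqF//; first exact: ltW.
  by apply: contM => //; exact: cont_cst.
have [F [sF hF dF]] := supp_prim sf hs (ltW pq') If.
have tF : tst a b F by split => //; exists p', q'.
have := H F tF; rewrite (drv_derive1 dF).
have -> : (fun x => u x * f x) =
   (fun x => z x * u x - J a b z / J a b r0 * (r0 x * u x)).
  by apply/funext => y; rewrite /f; ring.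
rewrite J_sub//; [|exact: ltW|exact: contM|]; last first.
  by apply: contM; [exact: cont_cst|exact: contM].
rewrite J_scale; last exact: contM.
move/eqP; rewrite subr_eq0 => /eqP e.
have -> : (fun x => z x * (u x - m)) = (fun x => z x * u x - m * z x).
  by apply/funext => y; ring.
rewrite J_sub//; [|exact: ltW|exact: contM|apply: contM => //; exact: cont_cst].
by rewrite J_scale// e /m; ring.
Qed.

End Smooth.

(** * Continuous functions of two variables *)

Section TwoVar.
Context {R : realType}.
Implicit Types (f g : R -> R) (w : R -> R -> R) (a b c d e x t : R).
Notation mu := (@lebesgue_measure R).
Local Notation RR := (measurableTypeR R * measurableTypeR R)%type.

Lemma cont_pair (T U V : topologicalType) (f : T -> U) (g : T -> V) :
  continuous f -> continuous g -> continuous (fun p : T => (f p, g p)).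
Proof. by move=> cf cg p; apply: cvg_pair; [exact: cf|exact: cg]. Qed.

(** Joint continuity of a curried function, the form in which space and time can
    be frozen separately. *)
Definition jcont w := continuous (fun z : R * R => w z.1 z.2).

Lemma jcontP w : jcont w <-> forall x t e, 0 < e -> exists2 d, 0 < d &
  forall y s, `|x - y| < d -> `|t - s| < d -> `|w x t - w y s| < e.
Proof.
split=> [cw x t e e0|H].
  have /cvgrPdist_lt /(_ e e0) /nbhs_ballP[d /= d0 h] := cw (x, t).
  by exists d => // y s xy ts; exact: (h (y, s)).
move=> [x t]; apply/cvgrPdist_lt => e e0; have [d d0 h] := H x t e e0.
exists (ball x d, ball t d); first by split; exact: nbhsx_ballx.
by move=> [y s] [/= xy ts]; exact: h.
Qed.

Lemma jcont_x w t : jcont w -> continuous (fun x => w x t).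
Proof.
move=> cw; apply: (cont_comp (f := fun z : R * R => w z.1 z.2) (g := fun x => (x, t))) => //.
by apply: cont_pair => x; [exact: cvg_id|exact: cvg_cst].
Qed.

Lemma jcont_t w x : jcont w -> continuous (w x).
Proof.
move=> cw; apply: (cont_comp (f := fun z : R * R => w z.1 z.2) (g := fun t => (x, t))) => //.
by apply: cont_pair => t; [exact: cvg_cst|exact: cvg_id].
Qed.

Lemma jcont_swap w : jcont w -> jcont (fun t x => w x t).
Proof.
move=> /jcontP cw; apply/jcontP => x t e e0; have [d d0 h] := cw t x e e0.
by exists d => // y s xy ts; apply: h.
Qed.

Lemma jcontD w w' : jcont w -> jcont w' -> jcont (fun x t => w x t + w' x t).
Proof. exact: contD. Qed.
Lemma jcontB w w' : jcont w -> jcont w' -> jcont (fun x t => w x t - w' x t).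
Proof. exact: contB. Qed.
Lemma jcontM w w' : jcont w -> jcont w' -> jcont (fun x t => w x t * w' x t).
Proof. exact: contM. Qed.
Lemma jcontX w n : jcont w -> jcont (fun x t => w x t ^+ n).
Proof. exact: contX. Qed.
Lemma jcont_fx f : continuous f -> jcont (fun x _ => f x).
Proof. by move=> cf; apply: (cont_comp cf) => z; exact: cvg_fst. Qed.
Lemma jcont_ft f : continuous f -> jcont (fun _ t => f t).
Proof. by move=> cf; apply: (cont_comp cf) => z; exact: cvg_snd. Qed.
Lemma jcont_cst c : jcont (fun _ _ => c).
Proof. exact: cont_cst. Qed.
(** Compactness of the interval makes the continuity in [t] uniform in [x]. *)
Lemma jcont_tube w a b t e : jcont w -> 0 < e -> exists2 d, 0 < d &
  forall s x, `|t - s| < d -> a <= x <= b -> `|w x t - w x s| < e.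
Proof.
move=> cw e0.
have := @segment_compact R a b => /compact_near_coveringP.
move=> /(_ R (nbhs t) (fun s x => `|w x t - w x s| < e) _).
have H x : `[a, b]%classic x -> \forall y \near x & s \near nbhs t, `|w y t - w y s| < e.
  move=> _; have /jcontP /(_ x t (e / 2) ltac:(by rewrite divr_gt0)) [d d0 h] := cw.
  exists (ball x d, ball t d); first by split; exact: nbhsx_ballx.
  move=> [y s] [/= h1 h2].
  have t1 := h y s h1 h2; have t2 := h y t h1 ltac:(by rewrite subrr normr0).
  rewrite (_ : _ - _ = (w x t - w y s) - (w x t - w y t)); last by ring.
  by rewrite (le_lt_trans (ler_normB _ _))// [e]splitr ltrD.
move=> /(_ H) /nbhs_ballP[d /= d0 h].
by exists d => // s x ts xab; apply: (h s ts); rewrite /= in_itv.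
Qed.

Lemma J_param_cont w a b : a <= b -> jcont w -> continuous (fun t => J a b (fun x => w x t)).
Proof.
move=> ab cw t; apply/cvgrPdist_le => e e0.
have [d d0 h] := @jcont_tube w a b t (e / (b - a + 1)) cw ltac:(by rewrite divr_gt0// ltr_wpDl// subr_ge0).
apply/nbhs_ballP; exists d => //= s ts.
rewrite -J_sub//; try exact: jcont_x.
have := @J_norm_le _ (fun x => w x t - w x s) a b (e / (b - a + 1)) ab.
have ba : 0 < b - a + 1 by rewrite ltr_wpDl// subr_ge0.
move=> /(_ _ _)/le_trans; apply.
- by apply: contB; exact: jcont_x.
- by move=> x xab; apply/ltW/h.
- by rewrite -mulrA ger_pMr// mulrC ler_pdivrMr// mul1r lerDl.
Qed.

(** An open set is the union of the rational rectangles that it contains. *)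
Lemma open2_measurable (U : set (R * R)) : open U -> measurable (U : set RR).
Proof.
move=> oU.
pose bx (q : (rat * rat) * (rat * rat)) : set (R * R) :=
  `]ratr q.1.1, ratr q.1.2[ `*` `]ratr q.2.1, ratr q.2.2[.
pose F q : set RR := if `[< bx q `<=` U >] then bx q else set0.
have -> : U = \bigcup_q F q.
  apply/seteqP; split => [[x t] Uz|z [q _]]; last first.
    by rewrite /F; case: ifPn => // /asboolP h /h.
  have : nbhs (x, t) U by exact: open_nbhs_nbhs.
  move=> /nbhs_ballP[d /= d0 h].
  have [q1 h1] := @rat_in_itvoo _ (x - d) x ltac:(lra).
  have [q2 h2] := @rat_in_itvoo _ x (x + d) ltac:(lra).
  have [q3 h3] := @rat_in_itvoo _ (t - d) t ltac:(lra).
  have [q4 h4] := @rat_in_itvoo _ t (t + d) ltac:(lra).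
  move: h1 h2 h3 h4; rewrite !in_itv/= => /andP[? ?] /andP[? ?] /andP[? ?] /andP[? ?].
  exists ((q1, q2), (q3, q4)) => //; rewrite /F ifT.
    by split; rewrite /= in_itv/=; apply/andP.
  apply/asboolP => -[y s] [/=]; rewrite !in_itv/= => /andP[? ?] /andP[? ?].
  by apply: h; split => /=; rewrite /ball/= ltr_norml; apply/andP; split; lra.
apply: countable_bigcupT_measurable; first exact: countableP.
by move=> q; rewrite /F; case: ifPn => // _; apply: measurableX; exact: measurable_itv.
Qed.

Lemma jcont_measurable w (A : set RR) : jcont w -> measurable A ->
  measurable_fun A ((fun z => w z.1 z.2) : RR -> measurableTypeR R).
Proof.
move=> cw mA; apply: measurable_funTS.
apply: (measurability _ (measurable_realfun.RGenOpens.measurableE R)).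
move=> _ [_ [p [q ->] <-]]; rewrite setTI; apply: open2_measurable.
apply: open_comp; last exact: interval_open.
by move=> z _; exact: cw.
Qed.

Definition box a b c d : set (R * R) := `[a, b] `*` `[c, d].

Lemma box_measurable a b c d : measurable (box a b c d : set RR).
Proof. by apply: measurableX; exact: measurable_itv. Qed.

Lemma box_compact a b c d : compact (box a b c d).
Proof. by apply: compact_setX; exact: segment_compact. Qed.

Lemma leb2_box a b c d : a <= b -> c <= d ->
  leb2 (box a b c d : set RR) = ((b - a) * (d - c))%:E.
Proof.
move=> ab cd; rewrite /leb2 /= product_measure1E//.
transitivity (lebesgue_measure `[a, b] * lebesgue_measure `[c, d])%E => //.
rewrite !lebesgue_measure_itv/= !lte_fin.
move: ab cd; rewrite le_eqVlt => /predU1P[->|ab]; first by rewrite ltxx subrr mul0r mul0e.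
rewrite le_eqVlt => /predU1P[->|cd]; first by rewrite ltxx subrr mulr0 mule0.
by rewrite ab cd.
Qed.

Lemma jcont_bounded w a b c d : jcont w ->
  exists2 M, 0 < M & forall x t, a <= x <= b -> c <= t <= d -> `|w x t| <= M.
Proof.
move=> cw.
have /compact_bounded[M [_ hM]] : compact ((fun z : R * R => w z.1 z.2) @` box a b c d).
  by apply: continuous_compact; [exact: continuous_subspaceT|exact: box_compact].
exists (`|M| + 1); first by rewrite ltr_wpDl.
move=> x t hx ht; apply: (hM (`|M| + 1)).
  by rewrite (le_lt_trans (ler_norm _))// ltrDl.
by exists (x, t) => //; split; rewrite /= in_itv.
Qed.

Lemma box_integrable w a b c d : jcont w -> a <= b -> c <= d ->
  leb2.-integrable (box a b c d : set RR) (fun z => (w z.1 z.2)%:E).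
Proof.
move=> cw ab cd.
apply: (@measurable_bounded_integrable _ _ _ leb2 (fun z : RR => w z.1 z.2)).
- exact: box_measurable.
- by rewrite leb2_box// ltry.
- by apply: jcont_measurable => //; exact: box_measurable.
- have [M M0 hM] := @jcont_bounded w a b c d cw.
  exists M; split; first exact: num_real.
  move=> N MN [x t] [/= hx ht]; apply: le_trans (ltW MN).
  by apply: hM; [move: hx|move: ht]; rewrite /= in_itv.
Qed.

Lemma int_J f a b : continuous f -> (\int[mu]_(x in `[a, b]) (f x)%:E)%E = (J a b f)%:E.
Proof.
move=> cf; rewrite /J /Rintegral fineK//.
by apply: integrable_fin_num => //; exact: cont_integrable.
Qed.

(** Fubini on the whole plane, applied to the extension of [w] by 0.  Comparing both
    iterated integrals with the double one gives their exchange. *)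
Lemma box_integral w a b c d : jcont w -> a <= b -> c <= d ->
  (\int[leb2]_(z in (box a b c d : set RR)) (w z.1 z.2)%:E)%E
   = (J a b (fun x => J c d (w x)))%:E
  /\ J a b (fun x => J c d (w x)) = J c d (fun t => J a b (fun x => w x t)).
Proof.
move=> cw ab cd.
have iw := box_integrable cw ab cd.
move: (iw); rewrite (integrable_mkcond _ (box_measurable a b c d)) => iw'.
have E1 : (\int[leb2]_(z in (box a b c d : set RR)) (w z.1 z.2)%:E)%E
   = (J a b (fun x => J c d (w x)))%:E.
  rewrite integral_mkcond -(integral12_prod_meas1 iw').
  rewrite -int_J; last by apply: (@J_param_cont (fun t x => w x t)) => //; exact: jcont_swap.
  rewrite [RHS]integral_mkcond; apply: eq_integral => x _.
  rewrite /fubini_F patchE; case: ifPn => [|]; rewrite ?inE ?notin_setE => hx.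
    rewrite -int_J; last exact: jcont_t.
    rewrite [RHS]integral_mkcond; apply: eq_integral => t _.
    rewrite !patchE; case: ifPn => [|]; rewrite ?inE ?notin_setE => ht.
      by rewrite ifT// inE; case: ht.
    by rewrite ifF//; apply/negbTE; rewrite notin_setE => ht'; apply: ht.
  rewrite integral0_eq// => t _; rewrite patchE ifF//.
  by apply/negbTE; rewrite notin_setE => -[].
split; first exact: E1.
apply: EFin_inj; rewrite -E1.
rewrite integral_mkcond -(integral21_prod_meas1 iw').
rewrite -int_J; last exact: J_param_cont.
rewrite [RHS]integral_mkcond; apply: eq_integral => t _.
rewrite /fubini_G patchE; case: ifPn => [|]; rewrite ?inE ?notin_setE => hx.
  rewrite -int_J; last exact: jcont_x.
  rewrite [RHS]integral_mkcond; apply: eq_integral => x _.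
  rewrite !patchE; case: ifPn => [|]; rewrite ?inE ?notin_setE => ht.
    by rewrite ifT// inE; case: ht.
  by rewrite ifF//; apply/negbTE; rewrite notin_setE => ht'; apply: ht.
rewrite integral0_eq// => x _; rewrite patchE ifF//.
by apply/negbTE; rewrite notin_setE => -[].
Qed.

Lemma J_fubini w a b c d : jcont w -> a <= b -> c <= d ->
  J a b (fun x => J c d (w x)) = J c d (fun t => J a b (fun x => w x t)).
Proof. by move=> cw ab cd; have [] := box_integral cw ab cd. Qed.

End TwoVar.

(** * The functions cas on the circle *)

Section Cas.
Context {R : realType}.
Implicit Types (f g : R -> R) (j k : int) (x y : R).

(** The kernel of the Hartley transform: a real orthogonal system whose [k]-th
    element has the derivative [k * cas (- k)]. *)
Definition cas k x : R := cos (k%:~R * x) + sin (k%:~R * x).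

(** The iterated derivatives of [cas k]. *)
Fixpoint dcas i k x : R := if i is i'.+1 then k%:~R * dcas i' (- k) x else cas k x.

Lemma drv_scale f F (c : R) : drv f F -> drv (fun x => f (c * x)) (fun x => c * F (c * x)).
Proof.
move=> df; have := drv_comp df (drvZ c (@drv_id R)).
by apply: drv_ext => // x; rewrite mulr1.
Qed.

Lemma drv_cos : drv (@cos R) (fun x => - sin x).
Proof. by move=> x; exact: is_derive_cos. Qed.
Lemma drv_sin : drv (@sin R) (@cos R).
Proof. by move=> x; exact: is_derive_sin. Qed.

Lemma cas_drv k : drv (cas k) (fun x => k%:~R * cas (- k) x).
Proof.
have := drvD (drv_scale k%:~R drv_cos) (drv_scale k%:~R drv_sin).
apply: drv_ext => // x; rewrite /cas !mulrNz !mulNr cosN sinN; ring.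
Qed.

Lemma dcas_drv i k : drv (dcas i k) (dcas i.+1 k).
Proof.
elim: i k => [|i IH] k; first exact: cas_drv.
exact: drvZ.
Qed.

Lemma cas_smooth k : smooth (cas k).
Proof.
have H n i : Cn n (dcas i k).
  elim: n i => [|n IH] i; first exact: drv_continuous (@dcas_drv i k).
  by exists (dcas i.+1 k); [exact: dcas_drv|].
by move=> n; exact: (H n 0%N).
Qed.

Lemma cas_cont k : continuous (cas k). Proof. exact: smooth_cont (cas_smooth k). Qed.

Lemma cas_le2 k x : `|cas k x| <= 2.
Proof.
rewrite (le_trans (ler_normD _ _))//.
by have := cos_max (k%:~R * x); have := sin_max (k%:~R * x); lra.
Qed.

Lemma cas0 x : cas 0 x = 1.
Proof. by rewrite /cas mul0r cos0 sin0 addr0. Qed.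

Lemma dcas_le i k x : `|dcas i k x| <= 2 * (`|k|%N)%:R ^+ i.
Proof.
elim: i k => [|i IH] k; first by rewrite expr0 mulr1 cas_le2.
rewrite /= normrM exprS mulrCA ler_pM// ?(le_trans (IH _)) ?abszN//.
by rewrite -intr_norm -abszE.
Qed.

Lemma casM j k x : cas j x * cas k x =
  2^-1 * (cas (j - k) x + cas (k - j) x + cas (j + k) x - cas (- j - k) x).
Proof.
rewrite /cas.
have -> : (- j - k)%:~R = - (j + k)%:~R :> R by rewrite -mulrNz opprD.
have -> : (k - j)%:~R = - (j - k)%:~R :> R by rewrite -mulrNz opprB.
rewrite !mulNr !cosN !sinN rmorphB rmorphD /= !mulrDl !mulNr.
by rewrite !cosD !sinD !cosN !sinN; field.
Qed.

Lemma cos_cas k x : cos x * cas k x = 2^-1 * (cas (k + 1) x + cas (k - 1) x).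
Proof.
rewrite /cas rmorphB rmorphD /= !mulrDl !mulNr !mul1r.
by rewrite !cosD !sinD !cosN !sinN; field.
Qed.

Lemma sin_cas k x : sin x * cas k x = 2^-1 * (cas (1 - k) x - cas (- k - 1) x).
Proof.
rewrite /cas !rmorphB rmorphN /= !mulrDl !mulNr !mul1r.
by rewrite !cosD !sinD !cosN !sinN; field.
Qed.

(** Half a period changes the sign: this is how the modulus of continuity of a
    function bounds its coefficients. *)
Lemma cas_shift k x : k != 0 -> cas k (x + pi / k%:~R) = - cas k x.
Proof.
move=> k0; have kR : k%:~R != 0 :> R by rewrite intr_eq0.
have e : k%:~R * (pi / k%:~R) = pi :> R by field.
by rewrite /cas mulrDr e cosDpi sinDpi; ring.
Qed.

(** The [k]-th Hartley coefficient, without normalisation. *)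
Definition hart k f : R := J (- pi) pi (fun x => f x * cas k x).

Let pipi : - pi <= pi :> R.
Proof. by have := @pi_ge0 R; lra. Qed.

Lemma hart_add k f g : continuous f -> continuous g ->
  hart k (fun x => f x + g x) = hart k f + hart k g.
Proof.
move=> cf cg; rewrite /hart -J_add//; [|exact: contM (@cas_cont k)..].
by apply: J_eq => x _; rewrite mulrDl.
Qed.

Lemma hart_sub k f g : continuous f -> continuous g ->
  hart k (fun x => f x - g x) = hart k f - hart k g.
Proof.
move=> cf cg; rewrite /hart -J_sub//; [|exact: contM (@cas_cont k)..].
by apply: J_eq => x _; rewrite mulrBl.
Qed.

Lemma hart_scale k (c : R) f : continuous f -> hart k (fun x => c * f x) = c * hart k f.
Proof.
move=> cf; rewrite /hart -J_scale//; last exact: contM (@cas_cont k).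
by apply: J_eq => x _; rewrite mulrA.
Qed.

Lemma hart_norm k f (M : R) : continuous f -> (forall x, `|f x| <= M) ->
  `|hart k f| <= 4 * pi * M.
Proof.
move=> cf fM.
apply: le_trans (@J_norm_le _ _ _ _ (M * 2) pipi _ _) _; first exact: contM (@cas_cont k).
  by move=> x _; rewrite normrM ler_pM// cas_le2.
by rewrite opprK le_eqVlt; apply/orP; left; apply/eqP; ring.
Qed.

Lemma int_cas m : m != 0 -> J (- pi) pi (cas m) = 0.
Proof.
move=> m0; have mR : m%:~R != 0 :> R by rewrite intr_eq0.
have d : drv (fun x => - m%:~R^-1 * cas (- m) x) (cas m).
  have := drvZ (- m%:~R^-1) (@cas_drv (- m)); apply: drv_ext => // x.
  by rewrite opprK mulrNz; field.
rewrite (@J_FTC2 _ _ _ _ _ pipi (@cas_cont m) d).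
suff -> : cas (- m) (- pi) = cas (- m) pi by rewrite subrr.
have snpi n : sin (n%:R * pi) = 0 :> R.
  elim: n => [|n IH]; first by rewrite mul0r sin0.
  by rewrite -natr1 mulrDl mul1r sinDpi IH oppr0.
have spi (p : int) : sin (p%:~R * pi) = 0 :> R.
  by case: p => n; rewrite ?NegzE ?mulrNz ?mulNr ?sinN snpi ?oppr0.
by rewrite /cas mulrN cosN sinN spi oppr0.
Qed.

Lemma cas_orth j k : hart k (cas j) = if j == k then 2 * pi else 0.
Proof.
have -> : hart k (cas j) = 2^-1 * (J (- pi) pi (cas (j - k)) + J (- pi) pi (cas (k - j)) +
   J (- pi) pi (cas (j + k)) - J (- pi) pi (cas (- j - k))).
  rewrite -!J_add//; try exact: cas_cont; last by apply: contD; exact: cas_cont.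
  rewrite -J_sub//; try exact: cas_cont; last first.
    by apply: contD; [apply: contD|]; exact: cas_cont.
  rewrite -J_scale; last first.
    by apply: contB; [apply: contD; [apply: contD|]|]; exact: cas_cont.
  by apply: J_eq => x _; rewrite casM.
have c0 : J (- pi) pi (cas 0) = 2 * pi :> R.
  rewrite (@J_eq _ _ (fun=> 1)) ?J_cst//; first by ring.
  by move=> x _; exact: cas0.
case: eqP => [->|/eqP jk].
  rewrite subrr c0; have [->|k0] := eqVneq k 0.
    change (2^-1 * (2 * pi + 2 * pi + J (- pi) pi (cas 0) - J (- pi) pi (cas 0)) = 2 * pi).
    by rewrite c0; field.
  rewrite !int_cas; first by field.
    by rewrite -opprD oppr_eq0 -mulr2n mulrn_eq0.
  by rewrite -mulr2n mulrn_eq0.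
rewrite (int_cas (_ : j - k != 0)) ?subr_eq0// (int_cas (_ : k - j != 0)) ?subr_eq0 1?eq_sym//.
have [e|jk'] := eqVneq (j + k) 0.
  have -> : - j - k = j + k by rewrite -opprD e oppr0.
  by rewrite addrK addr0 mulr0.
by rewrite !int_cas ?subr0 ?addr0 ?mulr0// -opprD oppr_eq0.
Qed.

(** On the circle, a point at distance at least [d] from 0 has a cosine at most
    [cos d]. *)
Lemma cos_far (d y : R) : 0 < d -> d <= pi -> d <= `|y| -> `|y| <= 2 * pi - d ->
  cos y <= cos d.
Proof.
move=> d0 dpi dy yd; rewrite -cos_norm.
have H z : d <= z -> z <= pi -> cos z <= cos d.
  by move=> dz zpi; rewrite leNgt ltr_cos -?leNgt// in_itv/=; apply/andP; split; lra.
have [h|h] := leP `|y| pi; first exact: H.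
have -> : cos `|y| = cos (2 * pi - `|y|).
  by rewrite mulr_natl cosB cos2pi sin2pi mul1r mul0r addr0.
by apply: H; lra.
Qed.

(** The kernel [(1 + cos (x - x0))^n] concentrates at [x0].  Within [d] of [x0]
    the integrand is nonnegative, and within [d / 2] it is at least [eta] times the value of
    the kernel at distance [d / 2]; beyond [d] it is at most [M] times the value of the kernel
    at distance [d].  If the total integral vanishes, the far part bounds the near part. *)
Lemma peak_estimate f x0 (d eta M : R) n : continuous f -> 0 < d -> d <= 2^-1 -> 0 < eta ->
  0 < M -> `|x0| <= 2^-1 -> (forall x, x0 - d <= x <= x0 + d -> eta <= f x) ->
  (forall x, - pi <= x <= pi -> `|f x| <= M) ->
  J (- pi) pi (fun x => f x * (1 + cos (x - x0)) ^+ n) = 0 ->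
  eta * d * (1 + cos (d / 2)) ^+ n <= (M * 2 * pi + M * 2 * pi) * (1 + cos d) ^+ n.
Proof.
move=> cf d0 d12 eta0 M0 hx0 fbig hM I0.
have pi2 := @pi_ge2 R.
move: hx0; rewrite ler_norml => /andP[xl xr].
pose q x : R := 1 + cos (x - x0); rewrite -/(q _) in I0.
have cq : continuous q.
  apply: contD; first exact: cont_cst.
  apply: cont_comp; first exact: continuous_cos.
  by apply: contB; [move=> x; exact: cvg_id|exact: cont_cst].
have q0 x : 0 <= q x by rewrite /q; have := cos_geN1 (x - x0); lra.
pose q1 : R := 1 + cos (d / 2); pose q2 : R := 1 + cos d.
rewrite -/q1 -/q2.
have q21 : q2 < q1.
  by rewrite ltrD2l ltr_cos; [lra|rewrite in_itv/=; apply/andP; split; lra..].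
have cosd0 : 0 <= cos d by apply: cos_ge0_pihalf; apply/andP; split; lra.
have q20 : 0 < q2 by rewrite /q2; lra.
have cfq : continuous (fun x => f x * q x ^+ n) by apply: contM => //; exact: contX.
have far x : - pi <= x <= pi -> d <= `|x - x0| -> `|f x * q x ^+ n| <= M * q2 ^+ n.
  move=> hx h; rewrite normrM ler_pM// ?hM// ger0_norm ?exprn_ge0//.
  apply: lerXn2r; rewrite ?nnegrE ?(ltW q20)//.
  rewrite lerD2l; apply: cos_far => //; first lra.
  move: hx => /andP[? ?]; rewrite ler_norml; apply/andP; split; lra.
move: I0.
rewrite (@J_chasles _ _ _ (x0 - d) pi)//; [|lra..].
rewrite (@J_chasles _ _ (x0 - d) (x0 - d / 2) pi)//; [|lra..].
rewrite (@J_chasles _ _ (x0 - d / 2) (x0 + d / 2) pi)//; [|lra..].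
rewrite (@J_chasles _ _ (x0 + d / 2) (x0 + d) pi)//; [|lra..].
have T1 : `|J (- pi) (x0 - d) (fun x => f x * q x ^+ n)| <= M * q2 ^+ n * (x0 - d - - pi).
  apply: J_norm_le => //; first lra.
  by move=> x /andP[? ?]; apply: far; [apply/andP; split; lra|rewrite ler0_norm; lra].
have T5 : `|J (x0 + d) pi (fun x => f x * q x ^+ n)| <= M * q2 ^+ n * (pi - (x0 + d)).
  apply: J_norm_le => //; first lra.
  by move=> x /andP[? ?]; apply: far; [apply/andP; split; lra|rewrite ger0_norm; lra].
have T2 : 0 <= J (x0 - d) (x0 - d / 2) (fun x => f x * q x ^+ n).
  apply: J_ge0 => // x /andP[? ?]; rewrite mulr_ge0 ?exprn_ge0//.
  by apply: le_trans (fbig x _); [exact: ltW|apply/andP; split; lra].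
have T4 : 0 <= J (x0 + d / 2) (x0 + d) (fun x => f x * q x ^+ n).
  apply: J_ge0 => // x /andP[? ?]; rewrite mulr_ge0 ?exprn_ge0//.
  by apply: le_trans (fbig x _); [exact: ltW|apply/andP; split; lra].
have T3 : eta * d * q1 ^+ n <= J (x0 - d / 2) (x0 + d / 2) (fun x => f x * q x ^+ n).
  have -> : eta * d * q1 ^+ n = J (x0 - d / 2) (x0 + d / 2) (fun=> eta * q1 ^+ n).
    by rewrite J_cst; [field|lra].
  apply: J_le => //; first exact: cont_cst.
  move=> x /andP[? ?]; rewrite ler_pM ?exprn_ge0 ?(ltW eta0) ?(ltW (lt_trans q20 q21))//.
    by apply: fbig; apply/andP; split; lra.
  apply: lerXn2r; rewrite ?nnegrE ?(ltW (lt_trans q20 q21))// lerD2l -(cos_norm (x - x0)).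
  have xx : `|x - x0| <= d / 2 by rewrite ler_norml; apply/andP; split; lra.
  by rewrite leNgt ltr_cos -?leNgt// in_itv/= ?normr_ge0/=; first [lra|apply/andP; split; lra].
have P2 : 0 <= q2 ^+ n by rewrite exprn_ge0// ltW.
have Q1 : M * q2 ^+ n * (x0 - d - - pi) <= M * q2 ^+ n * (2 * pi).
  by apply: ler_wpM2l; [rewrite mulr_ge0// ltW|lra].
have Q5 : M * q2 ^+ n * (pi - (x0 + d)) <= M * q2 ^+ n * (2 * pi).
  by apply: ler_wpM2l; [rewrite mulr_ge0// ltW|lra].
move: T1 T5; rewrite !ler_norml => /andP[A1 _] /andP[A5 _] E.
clear - E A1 A5 T2 T3 T4 Q1 Q5.
set K := M * q2 ^+ n * (2 * pi) in Q1 Q5.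
have -> : (M * 2 * pi + M * 2 * pi) * q2 ^+ n = K + K by rewrite /K; ring.
set j1 := J (- pi) _ _ in E A1; set j2 := J _ _ _ in E T2.
lra.
Qed.

(** All the coefficients of [f * (1 + cos (x - x0))^n] vanish as well, because
    [cos] and [sin] times [cas k] are combinations of neighbouring [cas].  If [f x0 > 0], the
    concentration of the kernel contradicts this for large [n]. *)
Lemma hart_unique_le0 f x0 : continuous f -> (forall k, hart k f = 0) ->
  `|x0| <= 2^-1 -> f x0 <= 0.
Proof.
move=> cf hf hx0; rewrite leNgt; apply/negP => fx0.
pose q x : R := 1 + cos (x - x0).
have cq : continuous q.
  apply: contD; first exact: cont_cst.
  apply: cont_comp; first exact: continuous_cos.
  by apply: contB; [move=> x; exact: cvg_id|exact: cont_cst].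
have q0 x : 0 <= q x by rewrite /q; have := cos_geN1 (x - x0); lra.
have cI n k : continuous (fun x => f x * q x ^+ n * cas k x).
  by apply: contM (@cas_cont k); apply: contM => //; exact: contX.
have I n k : J (- pi) pi (fun x => f x * q x ^+ n * cas k x) = 0.
  elim: n k => [|n IH] k.
    by rewrite -(hf k); apply: J_eq => x _; rewrite expr0 mulr1.
  (* one more factor [1 + cos (x - x0)] is expanded by the addition formula *)
  pose Cc := 2^-1 * cos x0; pose Cs := 2^-1 * sin x0.
  rewrite (@J_eq _ _ (fun x => f x * q x ^+ n * cas k x +
    (Cc * (f x * q x ^+ n * cas (k + 1) x) + Cc * (f x * q x ^+ n * cas (k - 1) x) +
    (Cs * (f x * q x ^+ n * cas (1 - k) x) + (- Cs) * (f x * q x ^+ n * cas (- k - 1) x))))).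
    have cz c m : continuous (fun x => c * (f x * q x ^+ n * cas m x)).
      by apply: contM; [exact: cont_cst|exact: cI].
    rewrite J_add//; last by apply: contD; apply: contD; exact: cz.
    rewrite J_add//; [|by apply: contD; exact: cz..].
    rewrite !J_add//; [|exact: cz..].
    by rewrite !J_scale// !IH !mulr0 !addr0.
  move=> x _.
  have -> : f x * q x ^+ n.+1 * cas k x = f x * q x ^+ n * cas k x +
     f x * q x ^+ n * (cos x0 * (cos x * cas k x) + sin x0 * (sin x * cas k x)).
    by rewrite exprS {1}/q cosB; ring.
  by rewrite cos_cas sin_cas /Cc /Cs; ring.
have I0 n : J (- pi) pi (fun x => f x * q x ^+ n) = 0.
  by rewrite -(I n 0); apply: J_eq => x _; rewrite cas0 mulr1.
pose eta := f x0 / 2.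
have eta0 : 0 < eta by rewrite /eta; lra.
have /cvgrPdist_lt /(_ _ eta0) /nbhs_ballP[d1 /= d10 hd1] := cf x0.
pose d := Num.min (d1 / 2) (2^-1).
have d0 : 0 < d by rewrite lt_min; apply/andP; split; lra.
have dd1 : d < d1 by rewrite gt_min; apply/orP; left; lra.
have d12 : d <= 2^-1 by rewrite ge_min lexx orbT.
have pi2 := @pi_ge2 R.
have fbig x : x0 - d <= x <= x0 + d -> eta <= f x.
  move=> /andP[h1 h2]; have := hd1 x; rewrite /ball/=.
  have -> : `|x0 - x| < d1 by rewrite ltr_norml; apply/andP; split; lra.
  by move=> /(_ isT); rewrite ltr_norml => /andP[_]; rewrite /eta; lra.
have [M M0 hM] : exists2 M, 0 < M & forall x, - pi <= x <= pi -> `|f x| <= M.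
  have [M M0 hM] := @jcont_bounded _ (fun x _ => f x) (- pi) pi 0 0 (jcont_fx cf).
  by exists M => // x hx; apply: (hM x 0) => //; rewrite lexx.
pose q1 : R := 1 + cos (d / 2); pose q2 : R := 1 + cos d.
have q21 : q2 < q1.
  by rewrite ltrD2l ltr_cos; [lra|rewrite in_itv/=; apply/andP; split; lra..].
have cosd0 : 0 <= cos d by apply: cos_ge0_pihalf; apply/andP; split; lra.
have q20 : 0 < q2 by rewrite /q2; lra.
(* the common ratio [q2 / q1] is less than 1, so the estimate fails for large [n] *)
have main n : eta * d * q1 ^+ n <= (M * 2 * pi + M * 2 * pi) * q2 ^+ n.
  exact: (peak_estimate cf d0 d12 eta0 M0 hx0 fbig hM (I0 n)).
pose z := q2 / q1.
have q10 : 0 < q1 := lt_trans q20 q21.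
have z1 : `|z| < 1 by rewrite ger0_norm ?divr_ge0 ?ltW// ltr_pdivrMr// mul1r.
pose K := M * 2 * pi + M * 2 * pi.
have K0 : 0 < K by rewrite addr_gt0// mulr_gt0 ?pi_gt0// mulr_gt0.
have e0 : 0 < eta * d / K by rewrite divr_gt0// mulr_gt0.
have /cvgrPdist_lt /(_ _ e0) [N _ /(_ N (leqnn N))] := cvg_expr z1.
rewrite sub0r normrN ger0_norm ?exprn_ge0 ?divr_ge0 ?ltW//.
rewrite ltr_pdivlMr// /z expr_div_n mulrAC ltr_pdivrMr ?exprn_gt0//.
by rewrite mulrC ltNge main.
Qed.

Lemma hart_unique f x0 : continuous f -> (forall k, hart k f = 0) ->
  `|x0| <= 2^-1 -> f x0 = 0.
Proof.
move=> cf hf hx; apply/le_anti/andP; split; first exact: hart_unique_le0.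
rewrite -oppr_le0; apply: (@hart_unique_le0 (fun x => - f x)) => //; first exact: contN.
move=> k; rewrite -(mulr0 (-1)) -(hf k) -hart_scale//.
by congr hart; apply/funext => x; rewrite mulN1r.
Qed.

End Cas.

(** * Weights on the integers and series dominated by them *)

Section Weight.
Context {R : realType}.
Variable gam : R.
Hypothesis gam0 : 0 < gam.
Implicit Types (j k : int) (n N : nat) (x : R).

(** A positive substitute for [|k|]. *)
Definition brk k : R := (`|k|%N).+1%:R.

Lemma brk_ge1 k : 1 <= brk k. Proof. by rewrite ler1n. Qed.
Lemma brk_gt0 k : 0 < brk k. Proof. by rewrite ltr0n. Qed.
Lemma brkN k : brk (- k) = brk k. Proof. by rewrite /brk abszN. Qed.
Lemma brkD j k : brk (j + k) <= brk j + brk k.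
Proof. rewrite -natrD ler_nat addSn ltnS addnS; apply: leqW.
by rewrite -lez_nat PoszD !abszE ler_normD. Qed.

Definition wt n k : R := brk k ^+ n * brk k `^ gam.
(** The weight [(1 + |k|)^(- n - gam)]: the decay of the coefficients of a function
    whose [n]-th derivative is Hoelder continuous of exponent [gam].  For [n = 1] it is summable. *)
Definition om n k : R := (wt n k)^-1.

Lemma wt_gt0 n k : 0 < wt n k.
Proof. by rewrite mulr_gt0// ?exprn_gt0 ?powR_gt0 ?brk_gt0. Qed.
Lemma om_gt0 n k : 0 < om n k. Proof. by rewrite invr_gt0 wt_gt0. Qed.
Lemma om_ge0 n k : 0 <= om n k. Proof. exact: ltW (om_gt0 n k). Qed.
Lemma omN n k : om n (- k) = om n k. Proof. by rewrite /om /wt brkN. Qed.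

Lemma om_anti n m k : (n <= m)%N -> om m k <= om n k.
Proof.
move=> nm; rewrite lef_pV2 ?posrE ?wt_gt0// ler_wpM2r ?powR_ge0//.
by rewrite ler_weXn2l ?brk_ge1.
Qed.

Lemma omD n m k : brk k ^+ m * om (n + m) k = om n k.
Proof.
have b0 := brk_gt0 k; have g0 := powR_gt0 gam b0.
rewrite /om /wt exprD; field.
by rewrite !gt_eqF// exprn_gt0.
Qed.

Lemma om_le1 n k : om n k <= 1.
Proof.
apply: (le_trans (om_anti k (leq0n n))).
rewrite invf_le1 ?wt_gt0// /wt expr0 mul1r.
rewrite -[leLHS](powRr0 (brk k)); apply: ler_powR; [exact: brk_ge1|exact: ltW].
Qed.

Lemma om_ge n k : gam <= 1 -> (brk k ^+ n.+1)^-1 <= om n k.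
Proof.
move=> g1; rewrite lef_pV2 ?posrE ?wt_gt0 ?exprn_gt0 ?brk_gt0//.
rewrite exprSr ler_wpM2l ?exprn_ge0 ?(ltW (brk_gt0 k))//.
by rewrite ler1_powR// brk_ge1.
Qed.

Lemma wt_mono n k l (c : R) : 1 <= c -> brk k <= c * brk l -> gam <= 1 -> wt n k <= c ^+ n.+1 * wt n l.
Proof.
move=> c1 h g1.
have c0 : 0 <= c by exact: le_trans c1.
have b0 := ltW (brk_gt0 l).
have cb0 : 0 <= c * brk l by rewrite mulr_ge0.
rewrite /wt exprSr mulrACA -exprMn ler_pM ?exprn_ge0 ?powR_ge0 ?(ltW (brk_gt0 k))//.
  by apply: lerXn2r; rewrite ?nnegrE// ltW// brk_gt0.
apply: (@le_trans _ _ ((c * brk l) `^ gam)).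
  by apply: ge0_ler_powR; rewrite ?nnegrE ?(ltW gam0) ?(ltW (brk_gt0 k)).
by rewrite powRM// ler_wpM2r ?powR_ge0// ler1_powR.
Qed.

(** One of [|j|], [|l|] is at least half of [|j + l|], and the corresponding factor is
    comparable with the weight at [j + l]; hence weights are stable under convolution. *)
Lemma om_conv n j l : gam <= 1 -> om n j * om n l <= 2 ^+ n.+1 * om n (j + l) * (om n j + om n l).
Proof.
move=> g1.
have H : wt n (j + l) <= 2 ^+ n.+1 * (wt n j + wt n l).
  have E0 : 0 <= 2 ^+ n.+1 :> R by rewrite exprn_ge0.
  have [h|h] := leP (brk j) (brk l).
    apply: le_trans (wt_mono n (_ : 1 <= 2) (_ : brk (j + l) <= 2 * brk l) g1) _; first by lra.
      by have := brkD j l; lra.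
    by rewrite ler_wpM2l// lerDr ltW// wt_gt0.
  apply: le_trans (wt_mono n (_ : 1 <= 2) (_ : brk (j + l) <= 2 * brk j) g1) _; first by lra.
    by have := brkD j l; lra.
  by rewrite ler_wpM2l// lerDl ltW// wt_gt0.
have a0 := wt_gt0 n j; have b0 := wt_gt0 n l; have c0 := wt_gt0 n (j + l).
rewrite /om; move: (wt n j) (wt n l) (wt n (j + l)) a0 b0 c0 H => a b c a0 b0 c0 H.
rewrite -(@ler_pM2l _ (a * b * c)) ?mulr_gt0//.
have -> : a * b * c * (a^-1 * b^-1) = c.
  by field; rewrite !gt_eqF.
apply: (le_trans H); rewrite le_eqVlt; apply/orP; left; apply/eqP.
by field; rewrite !gt_eqF.
Qed.

(** The integral of [x^(- 1 - gam)] from [N] to infinity: its increments dominate the weight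
    of order 1. *)
Definition tau N : R := gam^-1 * N%:R `^ (- gam).

(** The inequality is [z^gam * (1 + gam / y) <= y^gam] for [y = z + 1], which
    follows from [ln (y / z) >= 1 / y] and [exp u >= 1 + u]. *)
Lemma tau_step N : om 1 (Posz N.+1) <= tau N.+1 - tau N.+2.
Proof.
rewrite /om /wt /brk expr1 absz_nat /tau -mulrBr.
set y : R := N.+2%:R; set z : R := N.+1%:R.
have z0 : 0 < z by rewrite ltr0n.
have y0 : 0 < y by rewrite ltr0n.
have yz : y = z + 1 by rewrite /y /z -natr1.
have py : 0 < y `^ gam by exact: powR_gt0.
have pz : 0 < z `^ gam by exact: powR_gt0.
rewrite !powRN.
have key : z `^ gam * (1 + gam / y) <= y `^ gam.
  have -> : y `^ gam = z `^ gam * expR (gam * ln (y / z)).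
    rewrite /powR !gt_eqF// -expRD -mulrDr lnM ?posrE ?invr_gt0// lnV ?posrE//.
    by congr expR; ring.
  rewrite ler_wpM2l ?(ltW pz)//; apply: le_trans (expR_ge1Dx _).
  rewrite lerD2l ler_wpM2l ?(ltW gam0)//.
  have : ln (z / y) <= z / y - 1.
    by rewrite lerBrDl; apply: (le_trans (expR_ge1Dx _)); rewrite lnK// posrE divr_gt0.
  have -> : ln (y / z) = - ln (z / y).
    by rewrite !lnM ?posrE ?invr_gt0// !lnV ?posrE//; ring.
  have -> : z / y - 1 = - y^-1.
    have -> : z = y - 1 by rewrite yz; ring.
    by field; rewrite gt_eqF.
  by rewrite lerNr.
rewrite -(@ler_pM2l _ (gam * y * y `^ gam * z `^ gam)) ?mulr_gt0//.
have -> : gam * y * y `^ gam * z `^ gam * (y * y `^ gam)^-1 = gam * z `^ gam.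
  by field; rewrite !gt_eqF.
have -> : gam * y * y `^ gam * z `^ gam * (gam^-1 * ((z `^ gam)^-1 - (y `^ gam)^-1)) =
   y * (y `^ gam - z `^ gam) by field; rewrite !gt_eqF.
have : y * (z `^ gam * (1 + gam / y)) <= y * y `^ gam by rewrite ler_wpM2l// ltW.
have -> : y * (z `^ gam * (1 + gam / y)) = y * z `^ gam + gam * z `^ gam.
  by field; rewrite gt_eqF.
lra.
Qed.

Lemma tau_ge0 N : 0 <= tau N.
Proof. by rewrite mulr_ge0 ?invr_ge0 ?(ltW gam0)// powR_ge0. Qed.

Lemma tau_sum N M : (N <= M)%N -> \sum_(N.+1 <= m < M.+1) om 1 (Posz m) <= tau N.+1 - tau M.+1.
Proof.
move=> NM; rewrite -(subnK NM); elim: (M - N)%N => [|p IH].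
  by rewrite add0n big_geq// subrr.
rewrite addSn big_nat_recr/=; last by rewrite ltnS leq_addl.
have := tau_step (p + N); lra.
Qed.

Lemma tau_cvg : tau N.+1 @[N --> \oo] --> (0:R).
Proof.
apply/cvgrPdist_lt => e e0.
have ge0 : 0 < gam * e by rewrite mulr_gt0.
pose X := expR (- gam^-1 * ln (gam * e)).
near=> N; rewrite sub0r normrN ger0_norm ?tau_ge0// /tau.
rewrite mulrC ltr_pdivrMr// mulrC powRN.
have X0 : 0 < X by exact: expR_gt0.
have XN : X < N.+1%:R.
  near: N; exists (Num.truncn X).+1 => // N /= hN.
  apply: (lt_le_trans (truncnS_gt X)); rewrite ler_nat; exact: leqW.
have -> : gam * e = (X `^ gam)^-1.
  rewrite /X /powR gt_eqF// expRK -expRN.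
  rewrite (_ : - (gam * _) = ln (gam * e)) ?lnK ?posrE//.
  by field; rewrite gt_eqF.
rewrite ltf_pV2 ?posrE ?powR_gt0//.
by apply: gt0_ltr_powR; rewrite ?nnegrE ?ltW.
Unshelve. all: by end_near. Qed.

Lemma lim_tau x (c A : R) : (forall N, x <= c + A * tau N.+1) -> x <= c.
Proof.
move=> H; apply/ler_addgt0Pr => e e0.
have A0 : 0 < `|A| + 1 by rewrite ltr_wpDl.
have e1 : 0 < e / (`|A| + 1) by rewrite divr_gt0.
have /cvgrPdist_lt /(_ _ e1) [N _ /(_ N (leqnn N))] := tau_cvg.
rewrite sub0r normrN ger0_norm ?tau_ge0// => h.
apply: (le_trans (H N)); rewrite lerD2l.
apply: (@le_trans _ _ ((`|A| + 1) * tau N.+1)).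
  rewrite ler_wpM2r ?tau_ge0// (le_trans (ler_norm _))//; lra.
by rewrite mulrC -ler_pdivlMr// ltW.
Qed.

(** The integers from [- N] to [N - 1], since [Negz m] is [- (m + 1)]. *)
Definition ibox N : seq int := [seq Posz m | m <- iota 0 N] ++ [seq Negz m | m <- iota 0 N].

Lemma sum_ibox N (F : int -> R) :
  \sum_(j <- ibox N) F j = \sum_(0 <= m < N) (F (Posz m) + F (Negz m)).
Proof.
by rewrite big_cat !big_map /= big_split /= /index_iota subn0.
Qed.

Lemma ibox_uniq N : uniq (ibox N).
Proof.
rewrite cat_uniq !map_inj_uniq ?iota_uniq//=; try by move=> ? ? [].
rewrite andbT; apply/hasPn => _ /mapP[m _ ->]; apply/negP => /mapP[p _]; by [].
Qed.

Lemma mem_ibox N j : (j \in ibox N) = match j with Posz m => (m < N)%N | Negz m => (m < N)%N end.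
Proof.
rewrite mem_cat; case: j => m.
  rewrite mem_map ?mem_iota/=; last by move=> ? ? [].
  rewrite orbC; case: mapP => //= -[p _]; by [].
rewrite [X in _ || X]mem_map ?mem_iota/=; last by move=> ? ? [].
by case: mapP => //= -[p _].
Qed.

Lemma om_Negz n m : om n (Negz m) <= om n (Posz m).
Proof.
rewrite lef_pV2 ?posrE ?wt_gt0//.
have h : brk (Posz m) <= brk (Negz m) by rewrite /brk ler_nat ltnS NegzE abszN absz_nat.
rewrite /wt ler_pM ?exprn_ge0 ?powR_ge0 ?(ltW (brk_gt0 _))//.
  by apply: lerXn2r => //; rewrite nnegrE ltW// brk_gt0.
by apply: ge0_ler_powR; rewrite ?nnegrE ?(ltW gam0) ?(ltW (brk_gt0 _)).
Qed.

Lemma ibox_diff N M (F : int -> R) (A : R) : (forall j, `|F j| <= A * om 1 j) -> (N <= M)%N ->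
  `|\sum_(j <- ibox M.+1) F j - \sum_(j <- ibox N.+1) F j| <= 2 * A * tau N.+1.
Proof.
move=> hF NM.
have A0 : 0 <= A by have := le_trans (normr_ge0 _) (hF 0); rewrite pmulr_lge0// om_gt0.
rewrite !sum_ibox (@big_cat_nat _ _ _ N.+1)//=.
rewrite addrC addrK.
apply: (le_trans (ler_norm_sum _ _ _)).
apply: (@le_trans _ _ (\sum_(N.+1 <= m < M.+1) (2 * A * om 1 (Posz m)))).
  apply: ler_sum => m _; apply: (le_trans (ler_normD _ _)).
  have := hF (Posz m); have := hF (Negz m).
  have : A * om 1 (Negz m) <= A * om 1 (Posz m) by rewrite ler_wpM2l// om_Negz.
  lra.
rewrite -mulr_sumr ler_wpM2l ?mulr_ge0//.
by apply: (le_trans (tau_sum NM)); rewrite gerBl tau_ge0.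
Qed.

(** An upper bound for the sum of the weight of order 1 over all the integers. *)
Definition om_total : R := 2 + 2 * tau 1.

Lemma ibox_sum_le N : \sum_(j <- ibox N) om 1 j <= om_total.
Proof.
have h1 : \sum_(j <- ibox 1) om 1 j <= 2.
  by rewrite sum_ibox big_nat1; have := om_le1 1 (Posz 0); have := om_le1 1 (Negz 0); lra.
case: N => [|N]; first by rewrite sum_ibox big_geq// /om_total; have := tau_ge0 1; lra.
have hF j : `|om 1 j| <= 1 * om 1 j by rewrite mul1r ger0_norm// om_ge0.
have := @ibox_diff 0 N (om 1) 1 hF (leq0n N); rewrite ler_norml => /andP[_].
rewrite /om_total; lra.
Qed.

(** For arbitrary finite sets of integers, because the convolution estimate also
    needs sums over translates and reflections of boxes. *)
Lemma sum_om_le (s : seq int) : uniq s -> \sum_(j <- s) om 1 j <= om_total.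
Proof.
move=> us.
pose N := (\max_(j <- s) `|j|%N).+1.
have sN : {subset s <= ibox N}.
  move=> j js; rewrite mem_ibox.
  have h : (`|j|%N < N)%N by rewrite ltnS; apply: (@leq_bigmax_seq _ s predT (fun j => `|j|%N)).
  by case: j js h => m _; rewrite ?NegzE ?abszN absz_nat// => /ltnW.
apply: le_trans (ibox_sum_le N).
rewrite [leRHS](bigID (mem s) predT) /=.
rewrite -[X in X <= _]addr0; apply: lerD; last by apply: sumr_ge0 => *; exact: om_ge0.
rewrite -(big_filter _ (mem s)) le_eqVlt; apply/orP; left; apply/eqP/perm_big.
apply: uniq_perm => //; first by rewrite filter_uniq// ibox_uniq.
by move=> j; rewrite mem_filter /=; case: (boolP (j \in s)) => // /sN ->.
Qed.

Lemma om_total_ge0 : 0 <= om_total. Proof. by rewrite /om_total; have := tau_ge0 1; lra. Qed.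

(** The partial sums over boxes converge, with an explicit rate, as soon as the
    family is dominated by the weight of order 1. *)
Definition int_series (u : int -> R) : R := limn (fun N => \sum_(j <- ibox N.+1) u j).

Lemma int_series_approx u (A : R) N : (forall j, `|u j| <= A * om 1 j) ->
  `|int_series u - \sum_(j <- ibox N.+1) u j| <= 2 * A * tau N.+1.
Proof.
move=> hu; pose P N := \sum_(j <- ibox N.+1) u j.
have cvP : cvgn P.
  apply: cauchy_cvg; apply/cauchy_ballP => e e0.
  have A0 : 0 <= A by have := le_trans (normr_ge0 _) (hu 0); rewrite pmulr_lge0// om_gt0.
  have A1 : 0 < 4 * A + 1 by lra.
  have e1 : 0 < e / (4 * A + 1) by rewrite divr_gt0.
  have /cvgrPdist_lt /(_ _ e1) [K _ hK] := tau_cvg.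
  have := hK K (leqnn K); rewrite sub0r normrN ger0_norm ?tau_ge0// ltr_pdivlMr// => h.
  exists ([set x | exists2 n, (K <= n)%N & x = P n], [set x | exists2 n, (K <= n)%N & x = P n]).
    by split; exists K => // n hn; exists n.
  move=> _ [/= [n hn ->] [m hm ->]]; rewrite /ball/=.
  have := ibox_diff hu hn; have := ibox_diff hu hm; rewrite -/(P _) -/(P _) -/(P _).
  have := tau_ge0 K.+1.
  rewrite !ler_norml ltr_norml => ? /andP[? ?] /andP[? ?].
  by apply/andP; split; nra.
have : P n @[n --> \oo] --> int_series u by exact: cvP.
move=> cv.
have cv2 : `|P n - P N| @[n --> \oo] --> `|int_series u - P N|.
  by apply: cvg_norm; apply: cvgB => //; exact: cvg_cst.
apply: (cvgr_to_le cv2).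
near=> n; apply: ibox_diff => //; near: n; exact: nbhs_infty_ge.
Unshelve. all: by end_near. Qed.

Lemma int_series_bound u (A : R) : (forall j, `|u j| <= A * om 1 j) -> `|int_series u| <= A * om_total.
Proof.
move=> hu; have A0 : 0 <= A by have := le_trans (normr_ge0 _) (hu 0); rewrite pmulr_lge0// om_gt0.
apply: (@lim_tau _ _ (2 * A)) => N.
have := int_series_approx N hu.
set s := \sum_(_ <- _) _.
have : `|s| <= A * om_total.
  apply: (le_trans (ler_norm_sum _ _ _)).
  apply: (@le_trans _ _ (\sum_(j <- ibox N.+1) (A * om 1 j))); first by apply: ler_sum => j _; exact: hu.
  by rewrite -mulr_sumr ler_wpM2l// ibox_sum_le.
rewrite !ler_norml => /andP[? ?] /andP[? ?]; apply/andP; split; lra.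
Qed.

(** The second order Taylor remainders are dominated by the weight, uniformly in
    the index, so that they can be summed. *)
Lemma int_series_drv (u u' u'' : int -> R -> R) (A : R) :
  (forall j, drv (u j) (u' j)) -> (forall j, drv (u' j) (u'' j)) ->
  (forall j x, `|u j x| <= A * om 1 j) -> (forall j x, `|u' j x| <= A * om 1 j) ->
  (forall j x, `|u'' j x| <= A * om 1 j) ->
  drv (fun x => int_series (u ^~ x)) (fun x => int_series (u' ^~ x)).
Proof.
move=> d1 d2 b0 b1 b2 x.
have A0 : 0 <= A by have := le_trans (normr_ge0 _) (b0 0 0); rewrite pmulr_lge0// om_gt0.
apply: (@is_derive_quad _ _ _ _ (A * om_total)) => h h1.
have tay j : `|u j (x + h) - u j x - h * u' j x| <= A * om 1 j * h ^+ 2.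
  have [c [hc e]] : exists c, `|c - x| <= `|h| /\ u j (x + h) - u j x = u' j c * h.
    have [h0|h0] := leP 0 h.
      have [c /andP[c1 c2] e] := drv_mvt (d1 j) (ltac:(lra) : x <= x + h).
      exists c; rewrite e; split; last by ring.
      rewrite !ger0_norm//; lra.
    have [c /andP[c1 c2] e] := drv_mvt (d1 j) (ltac:(lra) : x + h <= x).
    exists c; rewrite -[LHS]opprB e; split; last by ring.
    rewrite ler0_norm ?(ltr0_norm h0); lra.
  have [c' e'] : exists c', u' j c - u' j x = u'' j c' * (c - x).
    have [cx|xc] := leP x c; first by have [c' _ e'] := drv_mvt (d2 j) cx; exists c'.
    by have [c' _ e'] := drv_mvt (d2 j) (ltW xc); exists c'; rewrite -[LHS]opprB e'; ring.
  rewrite e (_ : _ - _ = u'' j c' * ((c - x) * h)); last by rewrite mulrA -e'; ring.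
  rewrite normrM ler_pM// normrM -[h ^+ 2]real_normK ?num_real// expr2.
  by rewrite ler_wpM2r.
apply: (@lim_tau _ _ (6 * A)) => N.
have a1 := int_series_approx N (b0 ^~ (x + h)); have a2 := int_series_approx N (b0 ^~ x).
have a3 := int_series_approx N (b1 ^~ x).
have fin : `|\sum_(j <- ibox N.+1) u j (x + h) - \sum_(j <- ibox N.+1) u j x -
    h * \sum_(j <- ibox N.+1) u' j x| <= A * om_total * h ^+ 2.
  rewrite mulr_sumr -!sumrB; apply: (le_trans (ler_norm_sum _ _ _)).
  apply: (@le_trans _ _ (\sum_(j <- ibox N.+1) (A * om 1 j * h ^+ 2))).
    by apply: ler_sum => j _.
  rewrite -mulr_suml -mulr_sumr ler_wpM2r ?sqr_ge0// ler_wpM2l//.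
  exact: ibox_sum_le.
have a4 : `|h * (int_series (u' ^~ x) - \sum_(j <- ibox N.+1) u' j x)| <= 2 * A * tau N.+1.
  rewrite normrM -[leRHS]mul1r ler_pM//.
move: a1 a2 a4 fin; rewrite mulrBr !ler_norml.
set T := tau N.+1; set S1 := \sum_(_ <- _) _; set S2 := \sum_(_ <- _) _.
set S3 := h * \sum_(_ <- _) _.
move=> /andP[? ?] /andP[? ?] /andP[? ?] /andP[? ?].
apply/andP; split; lra.
Qed.

Lemma int_series_cont (T : topologicalType) (u : int -> T -> R) (A : R) : (forall j, continuous (u j)) ->
  (forall j (p : T), `|u j p| <= A * om 1 j) -> continuous (fun p : T => int_series (u ^~ p)).
Proof.
move=> cu b0 x; apply/cvgrPdist_lt => e e0.
have A0 : 0 <= A by have := le_trans (normr_ge0 _) (b0 0 x); rewrite pmulr_lge0// om_gt0.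
have A1 : 0 < 8 * A + 1 by lra.
have e1 : 0 < e / (8 * A + 1) by rewrite divr_gt0.
have /cvgrPdist_lt /(_ _ e1) [K _ hK] := tau_cvg.
have := hK K (leqnn K); rewrite sub0r normrN ger0_norm ?tau_ge0// ltr_pdivlMr// => h.
have cP : continuous (fun p : T => \sum_(j <- ibox K.+1) u j p).
  elim: (ibox K.+1) => [|j s IH].
    by under eq_fun do rewrite big_nil; exact: cont_cst.
  by under eq_fun do rewrite big_cons; exact: contD.
have e2 : 0 < e / 2 by rewrite divr_gt0.
have /cvgrPdist_lt /(_ _ e2) := cP x; apply: filterS => y.
have := int_series_approx K (b0 ^~ x); have := int_series_approx K (b0 ^~ y).
have := tau_ge0 K.+1.
rewrite !ler_norml !ltr_norml => ? /andP[? ?] /andP[? ?] /andP[? ?].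
have At : A * tau K.+1 * 8 < e by nra.
by apply/andP; split; lra.
Qed.

End Weight.

(** * Hartley series: inversion, products, Hoelder functions *)

Section Inversion.
Context {R : realType}.
Variable gam : R.
Hypotheses (gam0 : 0 < gam) (gam1 : gam <= 1).
Implicit Types (f g : R -> R) (j k : int) (n N : nat) (x : R) (A B : R).
Local Notation om := (@om R gam).
Local Notation tau := (@tau R gam).

Let pi0 : 0 < pi :> R := pi_gt0 R.
Let pipi : - pi <= pi :> R.
Proof. by have := @pi_ge0 R; lra. Qed.

Lemma tau_anti N M : (N <= M)%N -> tau M.+1 <= tau N.+1.
Proof.
move=> NM; rewrite /tau ler_wpM2l ?invr_ge0 ?(ltW gam0)// !powRN.
rewrite lef_pV2 ?posrE ?powR_gt0// ge0_ler_powR ?nnegrE ?(ltW gam0)//.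
by rewrite ler_nat.
Qed.

(** Passage to the limit in inequalities with an error of order [tau]; all the
    estimates on series are first proved for partial sums. *)
Lemma lim_tauK x (c A : R) K : 0 <= A -> (forall N, (K <= N)%N -> x <= c + A * tau N.+1) -> x <= c.
Proof.
move=> A0 H; apply: (lim_tau gam0 (A := A)) => N.
apply: (le_trans (H (N + K)%N (leq_addl _ _))).
by rewrite lerD2l ler_wpM2l// tau_anti// leq_addr.
Qed.

Lemma cont_sum (I : Type) (s : seq I) (u : I -> R -> R) : (forall i, continuous (u i)) ->
  continuous (fun x => \sum_(i <- s) u i x).
Proof.
move=> cu; elim: s => [|i s IH].
  by under eq_fun do rewrite big_nil; exact: cont_cst.
by under eq_fun do rewrite big_cons; exact: contD.
Qed.

Lemma hart_sum (I : Type) (s : seq I) (u : I -> R -> R) k : (forall i, continuous (u i)) ->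
  hart k (fun x => \sum_(i <- s) u i x) = \sum_(i <- s) hart k (u i).
Proof.
move=> cu; elim: s => [|i s IH].
  rewrite big_nil /hart -[RHS](J0 (- pi) pi); apply: J_eq => x _.
  by rewrite big_nil mul0r.
rewrite big_cons -IH -hart_add//; last exact: cont_sum.
by congr hart; apply/funext => x; rewrite big_cons.
Qed.

Definition hart_series (a : int -> R) x := int_series (fun j => a j * cas j x).

Lemma hart_series_term a A : (forall j, `|a j| <= A * om 1 j) -> forall j x, `|a j * cas j x| <= 2 * A * om 1 j.
Proof.
move=> ha j x; rewrite normrM mulrC -mulrA ler_pM//; exact: cas_le2.
Qed.

Lemma om_bound_ge0 (a : int -> R) n A : (forall j, `|a j| <= A * om n j) -> 0 <= A.
Proof. by move=> /(_ 0) /(le_trans (normr_ge0 _)); rewrite pmulr_lge0// om_gt0. Qed.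

Lemma hart_series_cont a A : (forall j, `|a j| <= A * om 1 j) -> continuous (hart_series a).
Proof.
move=> ha; apply: (int_series_cont gam0 _ (hart_series_term ha)) => j.
exact: contZ (@cas_cont _ _).
Qed.

Lemma hart_hart_series a A k : (forall j, `|a j| <= A * om 1 j) -> hart k (hart_series a) = 2 * pi * a k.
Proof.
move=> ha; have A0 := om_bound_ge0 ha.
have cF := hart_series_cont ha.
apply/eqP; rewrite -subr_eq0 -normr_le0.
apply: (@lim_tauK _ 0 (4 * pi * (4 * A)) (`|k|.+1)).
  by rewrite !mulr_ge0// ltW.
move=> N kN; rewrite add0r.
have cu j : continuous (fun x => a j * cas j x).
  exact: contZ (@cas_cont _ _).
have -> : 2 * pi * a k = hart k (fun x => \sum_(j <- ibox N.+1) a j * cas j x).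
  rewrite hart_sum// (bigD1_seq k) ?ibox_uniq//=; last first.
    move: kN; rewrite mem_ibox; case: k => m h; first exact: leqW.
    exact: leqW (ltnW h).
  rewrite [X in _ + X]big1 ?addr0; last first.
    move=> j jk; rewrite hart_scale; last exact: cas_cont.
    by rewrite cas_orth (negbTE jk) mulr0.
  by rewrite (hart_scale _ _ (@cas_cont _ k)) cas_orth eqxx mulrC.
rewrite -hart_sub//; last exact: cont_sum.
rewrite -mulrA; apply: hart_norm; first by apply: contB => //; exact: cont_sum.
move=> x; have := int_series_approx gam0 N (fun j => hart_series_term ha j x).
by rewrite [X in X * tau _](_ : _ = 4 * A)//; ring.
Qed.

(** The difference between [f] and its series is continuous and all its
    coefficients vanish. *)
Lemma hart_inversion f A x : continuous f -> (forall k, `|hart k f| <= A * om 1 k) ->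
  `|x| <= 2^-1 -> f x = hart_series (fun j => hart j f / (2 * pi)) x.
Proof.
move=> cf hf hx.
have p2 : 0 < 2 * pi :> R by rewrite mulr_gt0.
have ha j : `|hart j f / (2 * pi)| <= A / (2 * pi) * om 1 j.
  by rewrite normrM normfV (gtr0_norm p2) mulrAC ler_wpM2r// invr_ge0 ltW.
apply/eqP; rewrite -subr_eq0; apply/eqP.
apply: (@hart_unique _ (fun x => f x - hart_series (fun j => hart j f / (2 * pi)) x)) => //.
  by apply: contB => //; exact: hart_series_cont ha.
move=> k; rewrite hart_sub//; last exact: hart_series_cont ha.
rewrite (hart_hart_series k ha) mulrC divfK ?subrr// gt_eqF//.
Qed.

Lemma hart_casM j k g : continuous g -> hart k (fun x => cas j x * g x) =
  2^-1 * (hart (j - k) g + hart (k - j) g + hart (j + k) g - hart (- j - k) g).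
Proof.
move=> cg; have cgc m : continuous (fun x => g x * cas m x) by exact: contM (@cas_cont _ _).
rewrite /hart -!J_add//; last by exact: contD.
rewrite -J_sub//; last by apply: contD => //; exact: contD.
rewrite -J_scale; last by apply: contB => //; apply: contD => //; exact: contD.
apply: J_eq => x _.
have -> : cas j x * g x * cas k x = g x * (cas j x * cas k x) by ring.
by rewrite casM; ring.
Qed.

(** The coefficients of a product are convolutions of the coefficients.  Only
    [f] is replaced by its series, which is legitimate where [g] does not vanish.  The
    hypothesis [0 < n] is what makes the weights summable. *)
Lemma hart_prod n : (0 < n)%N -> exists2 K, 0 <= K & forall f g A B,
  continuous f -> continuous g -> (forall x, 2^-1 < `|x| -> g x = 0) ->
  (forall k, `|hart k f| <= A * om n k) -> (forall k, `|hart k g| <= B * om n k) ->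
  forall k, `|hart k (fun x => f x * g x)| <= K * A * B * om n k.
Proof.
move=> n0.
have B0 := om_total_ge0 gam0.
have p2 : 0 < 2 * pi :> R by rewrite mulr_gt0.
exists ((2 * pi)^-1 * 2 ^+ n.+1 * (4 * @om_total R gam)).
  by rewrite !mulr_ge0 ?invr_ge0 ?exprn_ge0// ltW.
move=> f g A B cf cg g0 hf hg k.
have A0 := om_bound_ge0 hf; have Bg0 := om_bound_ge0 hg.
have hf1 j : `|hart j f| <= A * om 1 j.
  by apply: (le_trans (hf j)); rewrite ler_wpM2l// om_anti.
pose a j := hart j f / (2 * pi).
have han j : `|a j| <= A / (2 * pi) * om n j.
  by rewrite normrM normfV (gtr0_norm p2) mulrAC ler_wpM2r// invr_ge0 ltW.
have ha j : `|a j| <= A / (2 * pi) * om 1 j.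
  by rewrite normrM normfV (gtr0_norm p2) mulrAC ler_wpM2r// invr_ge0 ltW.
have A20 := om_bound_ge0 ha.
have cS := hart_series_cont ha.
have -> : hart k (fun x => f x * g x) = hart k (fun x => hart_series a x * g x).
  congr hart; apply/funext => x.
  have [h|h] := leP `|x| 2^-1; last by rewrite g0// !mulr0.
  by rewrite (hart_inversion cf hf1 h).
have [M M0 hM] : exists2 M, 0 < M & forall x, `|g x| <= M.
  have [M M0 hM] := @jcont_bounded _ (fun x _ => g x) (- 2^-1) (2^-1) 0 0 (jcont_fx cg).
  exists M => // x; have [h|h] := leP `|x| 2^-1; last by rewrite g0// normr0 ltW.
  by apply: (hM x 0); rewrite ?lexx// -ler_norml.
have cu j : continuous (fun x => a j * cas j x * g x).
  by apply: contM cg; exact: contZ (@cas_cont _ _).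
have cP N : continuous (fun x => (\sum_(j <- ibox N.+1) a j * cas j x) * g x).
  by apply: contM cg; apply: cont_sum => j; exact: contZ (@cas_cont _ _).
have cSg : continuous (fun x => hart_series a x * g x) by exact: contM.
pose C := (2 * pi)^-1 * 2 ^+ n.+1 * A * B * om n k.
have C0 : 0 <= C.
  have i0 : 0 <= (2 * pi)^-1 :> R by rewrite invr_ge0 ltW.
  by do !apply: mulr_ge0 => //; exact: om_ge0.
have term j : `|hart k (fun x => a j * cas j x * g x)| <=
    C * (om 1 j + om 1 (k - j) + om 1 j + om 1 (k + j)).
  have -> : hart k (fun x => a j * cas j x * g x) = a j * (2^-1 *
     (hart (j - k) g + hart (k - j) g + hart (j + k) g - hart (- j - k) g)).
    rewrite -hart_casM// -hart_scale; last by apply: contM => //; exact: cas_cont.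
    by congr hart; apply/funext => x; rewrite mulrA.
  have h1 := hg (j - k); have h2 := hg (k - j); have h3 := hg (j + k); have h4 := hg (- j - k).
  rewrite -(opprB k j) omN in h1; rewrite -opprD omN in h4.
  have -> : k + j = j + k by rewrite addrC.
  rewrite -(opprB k j) -opprD in h1 h4 *.
  apply: (@le_trans _ _ (A / (2 * pi) * om n j * (B * om n (k - j) + B * om n (j + k)))).
    rewrite normrM ler_pM// normrM ger0_norm ?invr_ge0//.
    move: h1 h2 h3 h4; rewrite !ler_norml => /andP[? ?] /andP[? ?] /andP[? ?] /andP[? ?].
    rewrite mulrC ler_pdivrMr// ler_norml; apply/andP; split; lra.
  have c1 := om_conv gam0 n j (k - j) gam1.
  have c2 := om_conv gam0 n (- j) (j + k) gam1.
  rewrite omN addKr in c2; rewrite (addrC j) subrK in c1.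
  have K0 : 0 <= A / (2 * pi) * B by rewrite mulr_ge0.
  apply: (@le_trans _ _ (A / (2 * pi) * B * (2 ^+ n.+1 * om n k * (om n j + om n (k - j)) +
     2 ^+ n.+1 * om n k * (om n j + om n (j + k))))).
    have -> : A / (2 * pi) * om n j * (B * om n (k - j) + B * om n (j + k)) =
      A / (2 * pi) * B * (om n j * om n (k - j) + om n j * om n (j + k)) by ring.
    by rewrite ler_wpM2l// lerD.
  have -> : A / (2 * pi) * B * (2 ^+ n.+1 * om n k * (om n j + om n (k - j)) +
     2 ^+ n.+1 * om n k * (om n j + om n (j + k))) =
     C * (om n j + om n (k - j) + om n j + om n (j + k)) by rewrite /C; ring.
  by rewrite ler_wpM2l// !lerD// om_anti.
apply: (@lim_tauK _ _ (4 * pi * (2 * (2 * (A / (2 * pi))) * M)) 0%N).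
  by move: (A / (2 * pi)) A20 => A' A'0; rewrite !mulr_ge0// ltW.
move=> N _.
have P1 : `|hart k (fun x => (\sum_(j <- ibox N.+1) a j * cas j x) * g x)| <= C * (4 * @om_total R gam).
  have -> : hart k (fun x => (\sum_(j <- ibox N.+1) a j * cas j x) * g x) =
     \sum_(j <- ibox N.+1) hart k (fun x => a j * cas j x * g x).
    rewrite -hart_sum//; congr hart; apply/funext => x.
    by rewrite mulr_suml.
  apply: (le_trans (ler_norm_sum _ _ _)).
  apply: (@le_trans _ _ (\sum_(j <- ibox N.+1) (C * (om 1 j + om 1 (k - j) + om 1 j + om 1 (k + j))))).
    by apply: ler_sum => j _; exact: term.
  rewrite -mulr_sumr ler_wpM2l// !big_split/=.
  have b1 := sum_om_le gam0 (ibox_uniq N.+1).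
  (* the indices [k - j] and [k + j] run over finite sets of integers too *)
  have b2 : \sum_(j <- ibox N.+1) om 1 (k - j) <= @om_total R gam.
    have u2 : uniq [seq k - j | j <- ibox N.+1].
      by rewrite map_inj_uniq ?ibox_uniq// => i i' /addrI/oppr_inj.
    by have := sum_om_le gam0 u2; rewrite big_map.
  have b3 : \sum_(j <- ibox N.+1) om 1 (k + j) <= @om_total R gam.
    have u3 : uniq [seq k + j | j <- ibox N.+1].
      by rewrite map_inj_uniq ?ibox_uniq// => i i' /addrI.
    by have := sum_om_le gam0 u3; rewrite big_map.
  lra.
have P2 : `|hart k (fun x => hart_series a x * g x) -
    hart k (fun x => (\sum_(j <- ibox N.+1) a j * cas j x) * g x)| <=
    4 * pi * (2 * (2 * (A / (2 * pi))) * M) * tau N.+1.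
  rewrite -hart_sub//.
  have -> : 4 * pi * (2 * (2 * (A / (2 * pi))) * M) * tau N.+1 =
    4 * pi * (2 * (2 * (A / (2 * pi))) * tau N.+1 * M).
    by move: (A / (2 * pi)) (tau N.+1) => ? ?; ring.
  apply: hart_norm; first exact: contB.
  move=> x; rewrite -mulrBl normrM ler_pM//.
  exact: (int_series_approx gam0 N (fun j => hart_series_term ha j x)).
have -> : (2 * pi)^-1 * 2 ^+ n.+1 * (4 * om_total gam) * A * B * om n k = C * (4 * @om_total R gam).
  by rewrite /C; ring.
move: P1 P2; rewrite !ler_norml => /andP[? ?] /andP[? ?]; apply/andP; split; lra.
Qed.

(** Shifting by half a period, for [k <> 0], [2 * hart k f] is the integral of
    [(f x - f (x - pi / k)) * cas k x]. *)
Lemma hart_holder f (H : R) : continuous f -> (forall x, 2^-1 < `|x| -> f x = 0) ->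
  (forall x y, `|f x - f y| <= H * `|x - y| `^ gam) ->
  forall k, `|hart k f| <= 80 * H * om 0 k.
Proof.
move=> cf f0 hH k.
have pi4 : pi < 4 :> R by have := @pihalf_02 R; lra.
have H0 : 0 <= H.
  by have := le_trans (normr_ge0 _) (hH 0 1); rewrite pmulr_lge0// powR_gt0// sub0r normrN normr1.
(* for [k = 0] the bound comes from the size of [f], which vanishes at 1 *)
have [->|k0] := eqVneq k 0.
  have fM x : `|f x| <= 2 * H.
    have [h|h] := leP `|x| 2^-1; last by rewrite f0// normr0 mulr_ge0.
    have := hH x 1; rewrite (f0 1) ?subr0 ?normr1; last by lra.
    move=> /le_trans; apply; rewrite mulrC ler_wpM2r//.
    move: h; rewrite ler_norml => /andP[h1 h2].
    apply: (@le_trans _ _ (2 `^ gam)); last by rewrite ler1_powR//; lra.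
    rewrite ge0_ler_powR ?nnegrE ?(ltW gam0)//; last by rewrite ler_norml; apply/andP; split; lra.
  apply: (le_trans (hart_norm 0 cf fM)).
  rewrite /om /wt /brk absz_nat expr1n mul1r powR1 invr1 mulr1 mulrA ler_wpM2r//; lra.
have cfc : continuous (fun x => f x * cas k x) by exact: contM (@cas_cont _ _).
have s1 : supp (- 2^-1) (2^-1) (fun x => f x * cas k x).
  by move=> x hx; rewrite f0 ?mul0r// ltNge ler_norml.
pose h : R := pi / k%:~R.
have hb : `|h| <= 8 / brk k.
  rewrite /h normrM normfV (gtr0_norm pi0) -intr_norm -abszE.
  rewrite /brk; have : (0 < `|k|)%N by rewrite absz_gt0.
  case: (`|k|%N) => // m _; rewrite ler_pdivrMr ?ltr0n// mulrAC ler_pdivlMr ?ltr0n//.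
  rewrite -!natr1; have m0 : 0 <= m%:R :> R by []; nra.
have h4 : `|h| <= 4.
  apply: (le_trans hb); rewrite ler_pdivrMr ?brk_gt0//.
  have : (2 : R) <= brk k by rewrite /brk ler_nat ltnS absz_gt0.
  lra.
move: (h4); rewrite ler_norml => /andP[hl hr].
(* [-5, 5] contains the support of [f] and that of its shift, as [|h| <= 4] *)
have e1 : hart k f = J (- 5) 5 (fun x => f x * cas k x).
  have p2 := @pi_ge2 R.
  by rewrite /hart (J_supp cfc s1) ?(J_supp (a := -5) cfc s1)//; lra.
have e2 : hart k f = - J (- 5) 5 (fun x => f (x - h) * cas k x).
  rewrite e1 (J_supp cfc s1); [|lra..].
  rewrite -(@J_supp _ (- 5 - h) (5 - h) _ _ _ cfc s1); [|lra..].
  rewrite -J_shift//; last lra.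
  rewrite -[RHS]mulN1r -J_scale; last first.
    apply: contM (@cas_cont _ _); apply: cont_comp => //.
    by apply: contB; [move=> x; exact: cvg_id|exact: cont_cst].
  apply: J_eq => x _.
  have -> : cas k x = - cas k (x - h) by rewrite -(cas_shift _ k0) subrK.
  by rewrite mulrN mulN1r opprK.
have cs : continuous (fun x => f (x - h)).
  apply: cont_comp => //.
  by apply: contB; [move=> x; exact: cvg_id|exact: cont_cst].
have e3 : 2 * hart k f = J (- 5) 5 (fun x => (f x - f (x - h)) * cas k x).
  rewrite mulr_natl mulr2n {1}e1 e2 -J_sub//; [|lra|exact: contM (@cas_cont _ _)].
  by apply: J_eq => x _; rewrite mulrBl.
have e4 : `|2 * hart k f| <= H * (8 * om 0 k) * 2 * (5 - - 5).
  rewrite e3; apply: J_norm_le; [lra|by apply: contM (@cas_cont _ _); exact: contB|].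
  move=> x _; rewrite normrM ler_pM//; last exact: cas_le2.
  apply: (le_trans (hH _ _)); rewrite ler_wpM2l// opprB addrC subrK.
  apply: (@le_trans _ _ ((8 / brk k) `^ gam)).
    rewrite ge0_ler_powR ?nnegrE ?(ltW gam0)// divr_ge0// ltW// brk_gt0//.
  rewrite powRM ?invr_ge0 ?(ltW (brk_gt0 _))// ler_pM ?powR_ge0//.
    by rewrite ler1_powR//; lra.
  by rewrite /om /wt expr0 mul1r -powR_inv1 ?(ltW (brk_gt0 _))// powRAC powR_inv1 ?powR_ge0.
move: e4; rewrite normrM ger0_norm// => e4; lra.
Qed.

End Inversion.

(** * Decay of the coefficients of a weak solution *)

Section Core.
Context {R : realType}.
Implicit Types (f g z : R -> R) (i j n m N : nat) (k : int) (x t b c : R).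

Definition Dn i f := iter i (@D R) f.

Lemma Dn_drv i f : smooth f -> drv (Dn i f) (Dn i.+1 f) /\ smooth (Dn i f).
Proof.
move=> sf; elim: i => [|i [IH1 IH2]]; first by split => //; have [] := smooth_drv sf.
have [h1 h2] := smooth_drv IH2.
by have [] := smooth_drv h2.
Qed.

Lemma tst_Dn a b i f : tst a b f -> tst a b (Dn i f).
Proof. by move=> tf; elim: i => // i IH; exact: tst_drv. Qed.

(** Leibniz rule for two chains of derivatives [z] and [c], in the two orders
    that the equation needs. *)
Lemma leibniz34 (z c : nat -> R -> R) : (forall i, drv (z i) (z i.+1)) -> (forall i, drv (c i) (c i.+1)) ->
  Dn 3 (fun x => z 0%N x * c 0%N x) = (fun x => z 3%N x * c 0%N x + 3 * (z 2%N x * c 1%N x)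
     + 3 * (z 1%N x * c 2%N x) + z 0%N x * c 3%N x) /\
  Dn 4 (fun x => z 0%N x * c 0%N x) = (fun x => z 4%N x * c 0%N x + 4 * (z 3%N x * c 1%N x)
     + 6 * (z 2%N x * c 2%N x) + 4 * (z 1%N x * c 3%N x) + z 0%N x * c 4%N x).
Proof.
move=> dz dc.
have d i j : drv (fun x => z i x * c j x) (fun x => z i.+1 x * c j x + z i x * c j.+1 x).
  exact: drvM.
have e1 : Dn 1 (fun x => z 0%N x * c 0%N x) = (fun x => z 1%N x * c 0%N x + z 0%N x * c 1%N x).
  exact: drv_derive1.
have e2 : Dn 2 (fun x => z 0%N x * c 0%N x) = (fun x => z 2%N x * c 0%N x + 2 * (z 1%N x * c 1%N x) + z 0%N x * c 2%N x).
  rewrite /Dn iterS -/(Dn 1 _) e1; apply: drv_derive1.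
  apply: drv_ext (drvD (d 1 0) (d 0 1))%N => // x; ring.
have e3 : Dn 3 (fun x => z 0%N x * c 0%N x) = (fun x => z 3%N x * c 0%N x + 3 * (z 2%N x * c 1%N x)
     + 3 * (z 1%N x * c 2%N x) + z 0%N x * c 3%N x).
  rewrite /Dn iterS -/(Dn 2 _) e2; apply: drv_derive1.
  apply: drv_ext (drvD (drvD (d 2 0) (drvZ 2 (d 1 1))) (d 0 2))%N => // x; ring.
split => //.
rewrite /Dn iterS -/(Dn 3 _) e3; apply: drv_derive1.
by apply: drv_ext (drvD (drvD (drvD (d 3 0) (drvZ 3 (d 2 1))) (drvZ 3 (d 1 2))) (d 0 3))%N => // x; ring.
Qed.

(** [(F - |g| / K) * exp (K t)] is nonincreasing. *)
Lemma ode_half (F B : R -> R) (K g t0 t1 : R) : drv F (fun t => - B t) -> 0 < K -> t0 <= t1 ->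
  (forall t, t0 <= t <= t1 -> K * F t - g <= B t) ->
  F t1 <= `|F t0| * expR (- (K * (t1 - t0))) + `|g| / K.
Proof.
move=> dF K0 t01 hB.
pose phi t := (F t - `|g| / K) * expR (K * t).
have dphi : drv phi (fun t => - B t * expR (K * t) + (F t - `|g| / K) * (K * expR (K * t))).
  apply: drvM.
    by apply: drv_ext (drvB dF (drv_cst (`|g| / K))) => // t; rewrite subr0.
  apply: drv_scale => t; exact: is_derive_expR.
have : - phi t0 <= - phi t1.
  apply: (drv_ge0_mono (drvN dphi)) => // t /hB ht.
  have -> : - (- B t * expR (K * t) + (F t - `|g| / K) * (K * expR (K * t))) =
    (B t - (K * F t - `|g|)) * expR (K * t) by field; rewrite gt_eqF.
  rewrite mulr_ge0 ?expR_ge0// subr_ge0; apply: le_trans ht.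
  by rewrite lerB// ler_norm.
rewrite lerN2 /phi => H.
have -> : - (K * (t1 - t0)) = K * t0 - K * t1 by ring.
rewrite expRD expRN.
have E1 := expR_gt0 (K * t1); have E0 := expR_gt0 (K * t0).
rewrite -lerBlDr mulrA ler_pdivlMr//; apply: (le_trans H).
rewrite ler_wpM2r ?expR_ge0//.
by apply: le_trans (ler_norm _); rewrite gerBl divr_ge0 ?normr_ge0 ?(ltW K0).
Qed.

Lemma ode_bound (F B : R -> R) (K g t0 t1 : R) : drv F (fun t => - B t) -> 0 < K -> t0 <= t1 ->
  (forall t, t0 <= t <= t1 -> `|B t - K * F t| <= g) ->
  `|F t1| <= `|F t0| * expR (- (K * (t1 - t0))) + `|g| / K.
Proof.
move=> dF K0 t01 hB; rewrite ler_norml; apply/andP; split.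
  rewrite lerNl -(normrN (F t0)).
  apply: (@ode_half (fun t => - F t) (fun t => - B t)) => //; first exact: drvN.
  by move=> t /hB; rewrite ler_norml => /andP[? ?]; lra.
apply: (@ode_half F B) => // t /hB; rewrite ler_norml => /andP[? ?]; lra.
Qed.

Lemma exp_decay (K d : R) n : 0 < d -> 0 < K ->
  expR (- (K * d)) <= n.+1`!%:R * (d * K) ^- n.+1.
Proof.
move=> d0 K0; rewrite expRN (mulrC K).
have dK : 0 < d * K by rewrite mulr_gt0.
have := expR_ge1Dxn n (ltW dK).
have p0 : 0 < (d * K) ^+ n.+1 by rewrite exprn_gt0.
have f0 : 0 < n.+1`!%:R :> R by rewrite ltr0n fact_gt0.
move=> H.
have H2 : (d * K) ^+ n.+1 / n.+1`!%:R <= expR (d * K) by apply: le_trans H; rewrite lerDr.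
have -> : n.+1`!%:R * (d * K) ^- n.+1 = ((d * K) ^+ n.+1 / n.+1`!%:R)^-1 :> R.
  by rewrite invfM invrK mulrC.
by rewrite lef_pV2 ?posrE ?expR_gt0// divr_gt0.
Qed.

Variables (gam r0 b0 : R) (w : R -> R -> R) (H M : R).
Hypotheses (gam0 : 0 < gam) (gam1 : gam <= 1).
Hypotheses (r00 : 0 < r0) (r01 : r0 <= 2^-1) (b00 : 0 < b0).
Hypothesis cw : jcont w.
Hypothesis wM : forall x t, `|w x t| <= M.
Hypothesis wH : forall x y t, `|w x t - w y t| <= H * `|x - y| `^ gam.
Hypothesis wE : forall f psi, tst (- r0) r0 f -> tst (- b0) 0 psi ->
  J (- b0) 0 (fun t => J (- r0) r0 (fun x =>
    w x t * (f x * D psi t - Dn 4 f x * psi t) + w x t ^+ 2 * (Dn 3 f x * psi t))) = 0.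
Local Notation om := (@om R gam).

Let rr : - r0 <= r0. Proof. by move: r00 b00 => ? ?; lra. Qed.
Let bb : - b0 <= 0. Proof. by move: r00 b00 => ? ?; lra. Qed.

(** Minus the time derivative of the pairing of [w] with [f], as read off from the
    weak equation. *)
Definition flux f t := J (- r0) r0 (fun x => w x t * Dn 4 f x - w x t ^+ 2 * Dn 3 f x).

Lemma smoothDn_cont i f : smooth f -> continuous (Dn i f).
Proof. by move=> sf; have [_ /smooth_cont] := Dn_drv i sf. Qed.

Lemma flux_jcont f : smooth f -> jcont (fun x t => w x t * Dn 4 f x - w x t ^+ 2 * Dn 3 f x).
Proof.
move=> sf; apply: jcontB; apply: jcontM => //; try exact: jcont_fx (smoothDn_cont sf).
exact: jcontX.
Qed.

(** For a fixed [f] the weak equation says that the pairing with [f], plus a primitive of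
    its flux, is weakly constant in time; du Bois-Reymond makes it constant. *)
Lemma weak_ode f : tst (- r0) r0 f -> exists2 F, drv F (fun t => - flux f t) &
  forall t, - b0 <= t <= 0 -> F t = J (- r0) r0 (fun x => w x t * f x).
Proof.
move: (b00) => b00' tf; have sf := tst_smooth tf.
pose A t := J (- r0) r0 (fun x => w x t * f x).
have jA : jcont (fun x t => w x t * f x) by apply: jcontM => //; exact: jcont_fx (tst_cont tf).
have cA : continuous A by exact: J_param_cont.
have cB : continuous (flux f) by apply: J_param_cont => //; exact: flux_jcont.
have [G dG] := prim_exists cB; have cG := drv_continuous dG.
have uc : forall x y, - b0 < x < 0 -> - b0 < y < 0 -> A x + G x = A y + G y.
  apply: (@dubois_reymond _ (- b0) 0 (fun t => A t + G t)); first exact: contD.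
  move=> psi tpsi.
  have [dpsi sdpsi] := smooth_drv (tst_smooth tpsi).
  have cpsi := tst_cont tpsi; have cdpsi := smooth_cont sdpsi.
  have [p1 p2] := supp_end (tst_supp tpsi) cpsi.
  have e1 : J (- b0) 0 (fun t => flux f t * psi t) = - J (- b0) 0 (fun t => G t * D psi t).
    by rewrite (J_parts bb cB cdpsi dG dpsi) p1 p2 !mulr0 subrr sub0r.
  have e2 : J (- b0) 0 (fun t => A t * D psi t) = J (- b0) 0 (fun t => flux f t * psi t).
    apply/eqP; rewrite -subr_eq0 -J_sub//; [|exact: contM..].
    apply/eqP; rewrite -[RHS](wE tf tpsi); apply: J_eq => t _.
    rewrite /A /flux mulrC [X in _ - X]mulrC -!J_scale; last first.
      exact: jcont_x jA.
      exact: jcont_x (flux_jcont sf).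
    rewrite -J_sub//; last first.
      by apply: contZ; exact: jcont_x (flux_jcont sf).
      by apply: contZ; exact: jcont_x jA.
    apply: J_eq => x _.
    by move: (Dn 4 f x) (Dn 3 f x) (D psi t) => p4 p3 q1; ring.
  have -> : (fun x => (A x + G x) * D psi x) = (fun x => A x * D psi x + G x * D psi x).
    by apply/funext => x; rewrite mulrDl.
  by rewrite J_add//; [rewrite e2 e1 addNr|exact: contM..].
pose c := A (- b0 / 2) + G (- b0 / 2).
have uc' t : - b0 < t < 0 -> A t + G t = c by move=> ht; apply: uc => //; apply/andP; split; lra.
(* the end points are reached by continuity *)
have key t : - b0 <= t <= 0 -> A t + G t = c.
  move=> ht; pose u s := A s + G s - c.
  have cu : continuous u by apply: contB; [exact: contD|exact: cont_cst].
  apply/eqP; rewrite -subr_eq0 -/(u t) -normr_le0; apply/ler_addgt0Pr => e e0; rewrite add0r.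
  have /cvgrPdist_lt /(_ e e0) /nbhs_ballP[d /= d0 hd] := cu t.
  (* a point [s] of the open interval close to [t], on the segment from [t] to the middle *)
  pose q := Num.min (1 / 2) (d / (2 * b0)).
  have q0 : 0 < q by rewrite lt_min divr_gt0//= divr_gt0// mulr_gt0.
  have q1 : q <= 1 / 2 by rewrite ge_min lexx.
  have q2 : q * b0 <= d / 2.
    have : q <= d / (2 * b0) by rewrite ge_min lexx orbT.
    by rewrite ler_pdivlMr ?mulr_gt0//; lra.
  pose s := t + q * (- b0 / 2 - t).
  have us : u s = 0.
    rewrite /u uc' ?subrr// /s; move: ht => /andP[h1 h2].
    by apply/andP; split; nra.
  have := hd s; rewrite /ball/= us subr0 => /(_ _)/ltW; apply.
  rewrite /s opprD addNKr normrN normrM (gtr0_norm q0).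
  have : `|- b0 / 2 - t| <= b0 by move: ht => /andP[h1 h2]; rewrite ler_norml; apply/andP; split; lra.
  move=> hh; apply: (@le_lt_trans _ _ (q * b0)); [by rewrite ler_wpM2l// ltW|lra].
exists (fun t => c - G t).
  by apply: drv_ext (drvB (drv_cst c) dG) => // t; rewrite sub0r.
by move=> t ht; rewrite -(key t ht) addrK.
Qed.

(** Order [n + gam] of decay for the coefficients of all the localisations of [w^m],
    uniformly in time away from the initial time. *)
Definition decay m n := forall z, tst (- r0) r0 z -> forall b, 0 < b -> b < b0 ->
  exists C, forall k t, - b <= t <= 0 -> `|hart k (fun x => z x * w x t ^+ m)| <= C * om n k.

Lemma zw_jcont z m : continuous z -> jcont (fun x t => z x * w x t ^+ m).
Proof. by move=> cz; apply: jcontM; [exact: jcont_fx|exact: jcontX]. Qed.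

(** The localisations live in a fundamental domain of the circle. *)
Lemma zw_supp z m t x : tst (- r0) r0 z -> 2^-1 < `|x| -> z x * w x t ^+ m = 0.
Proof.
move=> tz hx; rewrite (tst_supp tz) ?mul0r// -ler_norml -ltNge.
exact: le_lt_trans hx.
Qed.

Lemma J_hart k g : continuous g -> (forall x, ~~ (- r0 <= x <= r0) -> g x = 0) ->
  J (- r0) r0 (fun x => g x * cas k x) = hart k g.
Proof.
move: (r00) (r01) => ? ? cg g0; have p2 := @pi_ge2 R.
rewrite /hart (@J_supp _ (- pi) pi (- r0) r0)//; try lra; first exact: contM (@cas_cont _ _).
by move=> x hx; rewrite g0 ?mul0r.
Qed.

Lemma lip_holder z (L : R) : (forall x, `|z x| <= L) -> (forall x y, `|z x - z y| <= L * `|x - y|) ->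
  forall x y, `|z x - z y| <= 2 * L * `|x - y| `^ gam.
Proof.
move=> zb zl x y; have L0 : 0 <= L by apply: le_trans (zb 0).
have [h|h] := leP `|x - y| 1.
  apply: (le_trans (zl x y)); rewrite mulr_natl mulr2n mulrDl.
  apply: ler_wpDr; first by rewrite mulr_ge0 ?powR_ge0.
  rewrite ler_wpM2l//; have [->|h0] := eqVneq `|x - y| 0; first exact: powR_ge0.
  by apply: ger1_powR => //; rewrite h andbT lt_neqAle eq_sym h0 normr_ge0.
apply: (@le_trans _ _ (2 * L)).
  by have := zb x; have := zb y; rewrite !ler_norml => /andP[? ?] /andP[? ?]; apply/andP; split; lra.
rewrite ler_peMr ?mulr_ge0//.
have -> : (1 : R) = 1 `^ gam by rewrite powR1.
by rewrite ge0_ler_powR ?nnegrE ?(ltW gam0) ?(ltW h).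
Qed.

Lemma tst_bounded a b z : tst a b z -> exists2 L, 0 < L & forall x, `|z x| <= L.
Proof.
move=> tz; have [L L0 hL] := @jcont_bounded _ (fun x _ => z x) a b 0 0 (jcont_fx (tst_cont tz)).
exists L => // x; have [h|h] := boolP (a <= x <= b); first by apply: (hL x 0); rewrite ?lexx.
by rewrite (tst_supp tz h) normr0 ltW.
Qed.

Lemma tst_lip a b z : tst a b z -> exists2 L, 0 < L &
   (forall x, `|z x| <= L) /\ (forall x y, `|z x - z y| <= L * `|x - y|).
Proof.
move=> tz; have [L1 L10 h1] := tst_bounded tz; have [L2 L20 h2] := tst_bounded (tst_drv tz).
have [dz _] := smooth_drv (tst_smooth tz).
exists (L1 + L2); first exact: addr_gt0.
split=> [x|]; first by apply: (le_trans (h1 x)); rewrite lerDl ltW.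
have key x y : x <= y -> `|z x - z y| <= (L1 + L2) * `|x - y|.
  move=> xy; have [c _ e] := drv_mvt dz xy.
  rewrite distrC e normrM (distrC x) ler_wpM2r//.
  by apply: (le_trans (h2 c)); rewrite lerDr ltW.
move=> x y; have [h|h] := leP x y; first exact: key.
by rewrite distrC (distrC x); apply: key; exact: ltW.
Qed.

Let M0 : 0 <= M. Proof. exact: le_trans (wM 0 0). Qed.
Let H0 : 0 <= H.
Proof.
have := le_trans (normr_ge0 _) (wH 0 1 0); rewrite pmulr_lge0// powR_gt0//.
by rewrite sub0r normrN normr1.
Qed.

(** Both [w] and [w^2] are Hoelder continuous, and so are their localisations. *)
Lemma decay0 m : (m <= 2)%N -> decay m 0.
Proof.
move=> m2 z tz b b1 b2.
have [L L0 [zb zl]] := tst_lip tz.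
have [N N0 [wN wNH]] : exists2 N, 0 <= N & (forall x t, `|w x t ^+ m| <= N) /\
   (forall x y t, `|w x t ^+ m - w y t ^+ m| <= N * `|x - y| `^ gam).
  case: m m2 => [|[|[|m]]] // _.
  - exists 1 => //; split; first by move=> x t; rewrite expr0 normr1.
    by move=> x y t; rewrite !expr0 subrr normr0 mul1r powR_ge0.
  - exists (M + H); first exact: addr_ge0.
    split=> [x t|x y t]; rewrite !expr1; first by apply: (le_trans (wM x t)); rewrite lerDl.
    by apply: (le_trans (wH x y t)); rewrite ler_wpM2r ?powR_ge0// lerDr.
  - exists (M ^+ 2 + 2 * M * H); first by rewrite addr_ge0 ?sqr_ge0// !mulr_ge0.
    split=> [x t|x y t].
      rewrite normrX (@le_trans _ _ (M ^+ 2))//; last by rewrite lerDl !mulr_ge0.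
      by apply: lerXn2r; rewrite ?nnegrE.
    rewrite subr_sqr mulrC normrM.
    apply: (@le_trans _ _ (2 * M * (H * `|x - y| `^ gam))).
      rewrite ler_pM//; apply: (le_trans (ler_normD _ _)); have := wM x t; have := wM y t; lra.
    by rewrite mulrA ler_wpM2r ?powR_ge0// lerDr sqr_ge0.
exists (80 * (2 * L * N + L * N)) => k t _.
apply: hart_holder => //.
- exact: jcont_x (zw_jcont (tst_cont tz)).
- by move=> x; exact: zw_supp.
- move=> x y.
  have -> : z x * w x t ^+ m - z y * w y t ^+ m =
    (z x - z y) * w x t ^+ m + z y * (w x t ^+ m - w y t ^+ m) by ring.
  apply: (le_trans (ler_normD _ _)); rewrite [leRHS]mulrDl !normrM lerD//.
    rewrite mulrAC ler_pM//; exact: lip_holder.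
  by rewrite -mulrA ler_pM.
Qed.

(** A second cut-off equal to 1 on the support of the first one splits
    [z * w^2] into a product of two localisations of [w]. *)
Lemma decay_sqr n : (0 < n)%N -> decay 1 n -> decay 2 n.
Proof.
move=> n0 P1 z tz b b1 b2.
have [y ty yz] := tst_cutoff tz.
have [Cz hz] := P1 z tz b b1 b2; have [Cy hy] := P1 y ty b b1 b2.
have [K K0 hK] := hart_prod gam0 gam1 n0.
exists (K * Cz * Cy) => k t ht.
have -> : (fun x => z x * w x t ^+ 2) = (fun x => (z x * w x t ^+ 1) * (y x * w x t ^+ 1)).
  by apply/funext => x; rewrite -{1}yz; ring.
apply: hK.
- exact: jcont_x (zw_jcont (tst_cont tz)).
- exact: jcont_x (zw_jcont (tst_cont ty)).
- by move=> x; exact: zw_supp.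
- by move=> j; exact: hz.
- by move=> j; exact: hy.
Qed.

(** Up to sign and a power of [k], [dcas i k] is [cas k] or [cas (- k)]. *)
Lemma J_dcas g (C : R) n i k : continuous g -> (forall x, ~~ (- r0 <= x <= r0) -> g x = 0) ->
  (forall p : int, `|hart p g| <= C * om n p) ->
  `|J (- r0) r0 (fun x => g x * dcas i k x)| <= C * (`|k|%N)%:R ^+ i * om n k.
Proof.
move=> cg g0 hg; elim: i k => [|i IH] k; first by have := hg k; rewrite -(J_hart k cg g0) expr0 mulr1.
have cd : continuous (fun x => g x * dcas i (- k) x).
  by apply: contM => //; exact: drv_continuous (@dcas_drv _ _ _).
have -> : J (- r0) r0 (fun x => g x * dcas i.+1 k x) = k%:~R * J (- r0) r0 (fun x => g x * dcas i (- k) x).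
  by rewrite -J_scale//; apply: J_eq => x _ /=; ring.
rewrite normrM -intr_norm -abszE exprS.
have := IH (- k); rewrite abszN omN => h.
have -> : C * ((`|k|%N)%:R * (`|k|%N)%:R ^+ i) * om n k = (`|k|%N)%:R * (C * (`|k|%N)%:R ^+ i * om n k) by ring.
by rewrite ler_wpM2l.
Qed.

(** The coefficient of [z * w] solves a linear equation with damping [k^4].  The
    forcing contains at most three derivatives of [cas k], hence is of order
    [|k|^(3 - n - gam)]; dividing by [k^4] gains one power.  The initial value is damped
    by [exp (- k^4 d)], which is smaller than any power: this is why the time interval
    shrinks from [b0] to [b]. *)
Lemma decay_step n : decay 1 n -> decay 2 n -> decay 1 n.+1.
Proof.
move=> P1 P2 z tz b b1 b2.
pose b' := (b + b0) / 2.
have b'1 : 0 < b' by rewrite /b'; lra.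
have b'2 : b' < b0 by rewrite /b'; lra.
have bb' : b < b' by rewrite /b'; lra.
have tsub1 s : - b <= s <= 0 -> - b' <= s <= 0.
  by move=> /andP[? ->]; rewrite andbT; lra.
have dist s : - b <= s <= 0 -> b' - b <= s - - b'.
  by move=> /andP[? _]; lra.
have tsub2 s : - b' <= s <= 0 -> - b0 <= s <= 0.
  by move=> /andP[? ->]; rewrite andbT; lra.
have h0 : - b' <= (0 : R) <= 0 by apply/andP; split; lra.
have hb' : - b' <= - b' <= 0 by apply/andP; split; lra.
have tzi i : tst (- r0) r0 (Dn i z) := tst_Dn i tz.
have [C hC] : exists C, forall i m k t, (i <= 4)%N -> (m = 1%N \/ m = 2%N) -> - b' <= t <= 0 ->
     `|hart k (fun x => Dn i z x * w x t ^+ m)| <= C * om n k.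
  have Hm m : (m = 1%N \/ m = 2%N) -> exists C, 0 <= C /\ forall i k t, (i <= 4)%N -> - b' <= t <= 0 ->
     `|hart k (fun x => Dn i z x * w x t ^+ m)| <= C * om n k.
    move=> hm; have PP : decay m n by case: hm => ->.
    elim: (4)%N => [|p [C [C0 hC]]].
      have [C hC] := PP _ (tzi 0%N) b' b'1 b'2; exists C; split.
        by apply: (om_bound_ge0 (n := n) (gam := gam) (a := fun k => hart k (fun x => Dn 0 z x * w x 0 ^+ m))) => k; exact: hC.
      by move=> [|//] k t _ ht; exact: hC.
    have [C' hC'] := PP _ (tzi p.+1) b' b'1 b'2.
    have C'0 : 0 <= C'.
      by apply: (om_bound_ge0 (n := n) (gam := gam) (a := fun k => hart k (fun x => Dn p.+1 z x * w x 0 ^+ m))) => k; exact: hC'.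
    exists (C + C'); split; first exact: addr_ge0.
    move=> i k t; rewrite leq_eqVlt => /predU1P[->|ip] ht.
      by apply: (le_trans (hC' k t ht)); rewrite ler_wpM2r ?om_ge0// lerDr.
    by apply: (le_trans (hC i k t ip ht)); rewrite ler_wpM2r ?om_ge0// lerDl.
  have [C1 [C10 h1]] := Hm 1%N (or_introl erefl); have [C2 [C20 h2]] := Hm 2%N (or_intror erefl).
  exists (C1 + C2) => i m k t hi [->|->] ht.
    by apply: (le_trans (h1 i k t hi ht)); rewrite ler_wpM2r ?om_ge0// lerDl.
  by apply: (le_trans (h2 i k t hi ht)); rewrite ler_wpM2r ?om_ge0// lerDr.
have C0 : 0 <= C.
  apply: (om_bound_ge0 (n := n) (gam := gam) (a := fun k => hart k (fun x => Dn 0 z x * w x 0 ^+ 1))) => k.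
  by apply: hC => //; left.
pose d := b' - b.
have d0 : 0 < d by rewrite /d; lra.
pose E := n.+2`!%:R * (2 / d) ^+ n.+2.
have E0 : 0 <= E by rewrite mulr_ge0// exprn_ge0// divr_ge0// ltW.
(* 23 = (4 + 6 + 4 + 1) + (3 + 3 + 1 + 1) is the total of the Leibniz coefficients of the
   forcing, and 16 comes from [(1 + |k|)^4 <= 16 * k^4]; [E] accounts for the initial value *)
exists (C * (1 + E) + 16 * (23 * C)) => k t ht.
have [->|k0] := eqVneq k 0.
  have h1 : `|hart 0 (fun x => z x * w x t ^+ 1)| <= C * om n 0.
    by apply: (hC 0%N 1%N) => //; [left|exact: tsub1].
  apply: (le_trans h1).
  have o0 p : om p 0 = 1.
    by rewrite /om /wt /brk absz_nat expr1n mul1r powR1 invr1.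
  rewrite !o0 !mulr1 mulrDr mulr1; have := mulr_ge0 C0 E0.
  by move: (C * E) C0 => q ? ?; lra.
pose f x := z x * cas k x.
have tf : tst (- r0) r0 f by apply: tstMr => //; exact: cas_smooth.
have [F dF FE] := weak_ode tf.
have AE s : J (- r0) r0 (fun x => w x s * f x) = hart k (fun x => z x * w x s ^+ 1).
  rewrite -J_hart; first by apply: J_eq => x _; rewrite /f; ring.
    exact: jcont_x (zw_jcont (tst_cont tz)).
  by move=> x hx; rewrite (tst_supp tz hx) mul0r.
pose K : R := (`|k|%N)%:R ^+ 4.
have kge1 : 1 <= (`|k|%N)%:R :> R.
  by rewrite ler1n; move: k0; rewrite -absz_gt0.
have brk2 : brk k <= 2 * (`|k|%N)%:R :> R by rewrite /brk -natr1 mulr_natl mulr2n lerD2l.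
have K1 : 1 <= K by rewrite exprn_ege1.
have kK : (`|k|%N)%:R <= K by rewrite -[leLHS]expr1 ler_weXn2l.
have K0 : 0 < K by exact: lt_le_trans K1.
have [L3 L4] := @leibniz34 (fun i => Dn i z) (fun i => dcas i k)
  (fun i => (Dn_drv i (tst_smooth tz)).1) (fun i => @dcas_drv R i k).
pose I i m j s := J (- r0) r0 (fun x => (Dn i z x * w x s ^+ m) * dcas j k x).
have cI i m j s : continuous (fun x => (Dn i z x * w x s ^+ m) * dcas j k x).
  apply: contM; last exact: drv_continuous (@dcas_drv _ _ _).
  exact: jcont_x (zw_jcont (tst_cont (tzi i))).
have bI i m j s : (i <= 4)%N -> (m = 1%N \/ m = 2%N) -> (j <= 3)%N -> - b' <= s <= 0 ->
   `|I i m j s| <= C * (brk k ^+ 3 * om n k).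
  move=> hi hm hj hs.
  apply: (le_trans (J_dcas (C := C) (n := n) j k _ _ _)).
  - exact: jcont_x (zw_jcont (tst_cont (tzi i))).
  - by move=> x hx; rewrite (tst_supp (tzi i) hx) mul0r.
  - by move=> p; apply: hC.
  - rewrite -mulrA ler_wpM2l// ler_wpM2r ?om_ge0//.
    apply: (@le_trans _ _ ((`|k|%N)%:R ^+ 3)); first by rewrite ler_weXn2l.
    by apply: lerXn2r; rewrite ?nnegrE ?(ltW (brk_gt0 _))// /brk ler_nat.
(* the Leibniz term with all four derivatives on [cas k] is the damping *)
have fluxE s : flux f s = K * hart k (fun x => z x * w x s ^+ 1) +
   (I 4%N 1%N 0%N s + (4 * I 3%N 1%N 1%N s + (6 * I 2%N 1%N 2%N s + 4 * I 1%N 1%N 3%N s)) -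
   (I 3%N 2%N 0%N s + (3 * I 2%N 2%N 1%N s + (3 * I 1%N 2%N 2%N s + I 0%N 2%N 3%N s)))).
  have -> : hart k (fun x => z x * w x s ^+ 1) = I 0%N 1%N 0%N s.
    rewrite -J_hart//; first exact: jcont_x (zw_jcont (tst_cont tz)).
    by move=> x hx; rewrite (tst_supp tz hx) mul0r.
  have cZ c i m j : continuous (fun x => c * ((Dn i z x * w x s ^+ m) * dcas j k x)) by exact: contZ.
  have cJ1 : continuous (fun x => 6 * (Dn 2 z x * w x s ^+ 1 * dcas 2 k x) + 4 * (Dn 1 z x * w x s ^+ 1 * dcas 3 k x)).
    by apply: contD.
  have cJ2 : continuous (fun x => 3 * (Dn 1 z x * w x s ^+ 2 * dcas 2 k x) + Dn 0 z x * w x s ^+ 2 * dcas 3 k x).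
    by apply: contD.
  rewrite /I -!J_scale// -!J_add//; try by apply: contD.
  rewrite -J_sub//; try by apply: contD => //; apply: contD.
  rewrite -J_add//; last by apply: contB; apply: contD => //; apply: contD.
  rewrite /flux; apply: J_eq => x _.
  rewrite (congr1 (fun h => h x) (L3 : Dn 3 f = _)) (congr1 (fun h => h x) (L4 : Dn 4 f = _)).
  cbn beta.
  have -> : dcas 4 k x = K * dcas 0 k x.
    have ek : (`|k|%N)%:R = `|k%:~R| :> R by rewrite -intr_norm -abszE.
    have -> : K = k%:~R ^+ 4 by rewrite /K ek -normrX ger0_norm// exprn_even_ge0.
    by rewrite /= !opprK !mulrNz; ring.
  move: (Dn 0 z x) (Dn 1 z x) (Dn 2 z x) (Dn 3 z x) (Dn 4 z x) => z0 z1 z2 z3 z4.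
  move: (dcas 0 k x) (dcas 1 k x) (dcas 2 k x) (dcas 3 k x) => c0 c1 c2 c3.
  by move: (w x s) => y; ring.
have g0 : 0 <= 23 * (C * (brk k ^+ 3 * om n k)).
  by rewrite !mulr_ge0// ?om_ge0// exprn_ge0// ltW// brk_gt0.
have ODE := @ode_bound F (flux f) K (23 * (C * (brk k ^+ 3 * om n k))) (- b') t dF K0.
have ht' : - b' <= t <= 0 := tsub1 t ht.
have := ODE _ _; rewrite FE; last exact: tsub2.
rewrite FE; last exact: tsub2.
rewrite !AE (ger0_norm g0).
have ht'' : - b' <= t by move: ht' => /andP[].
move=> /(_ ht'' _)/le_trans; apply.
  move=> s /andP[s1 s2].
  have hs : - b' <= s <= 0 by rewrite s1/=; move: ht => /andP[_]; exact: le_trans.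
  rewrite FE; last exact: tsub2.
  rewrite fluxE AE addrAC subrr add0r.
  have i1 : `|I 4%N 1%N 0%N s| <= C * (brk k ^+ 3 * om n k) by apply: bI => //; left.
  have i2 : `|I 3%N 1%N 1%N s| <= C * (brk k ^+ 3 * om n k) by apply: bI => //; left.
  have i3 : `|I 2%N 1%N 2%N s| <= C * (brk k ^+ 3 * om n k) by apply: bI => //; left.
  have i4 : `|I 1%N 1%N 3%N s| <= C * (brk k ^+ 3 * om n k) by apply: bI => //; left.
  have i5 : `|I 3%N 2%N 0%N s| <= C * (brk k ^+ 3 * om n k) by apply: bI => //; right.
  have i6 : `|I 2%N 2%N 1%N s| <= C * (brk k ^+ 3 * om n k) by apply: bI => //; right.
  have i7 : `|I 1%N 2%N 2%N s| <= C * (brk k ^+ 3 * om n k) by apply: bI => //; right.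
  have i8 : `|I 0%N 2%N 3%N s| <= C * (brk k ^+ 3 * om n k) by apply: bI => //; right.
  move: i1 i2 i3 i4 i5 i6 i7 i8; clear.
  move: (C * _) => Q.
  move: (I 4%N 1%N 0%N s) (I 3%N 1%N 1%N s) (I 2%N 1%N 2%N s) (I 1%N 1%N 3%N s)
    (I 3%N 2%N 0%N s) (I 2%N 2%N 1%N s) (I 1%N 2%N 2%N s) (I 0%N 2%N 3%N s) => a1 a2 a3 a4 a5 a6 a7 a8.
  rewrite !ler_norml => /andP[? ?] /andP[? ?] /andP[? ?] /andP[? ?] /andP[? ?] /andP[? ?] /andP[? ?] /andP[? ?].
  by apply/andP; split; lra.
rewrite [leRHS]mulrDl lerD//.
  have h1 : `|hart k (fun x => z x * w x (- b') ^+ 1)| <= C.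
    apply: (@le_trans _ _ (C * om n k)).
      by apply: (hC 0%N 1%N) => //; left.
    by rewrite ler_piMr// om_le1.
  rewrite -mulrA ler_pM ?expR_ge0//.
  have dt : d <= t - - b' := dist t ht.
  have dt0 : 0 < t - - b' by exact: lt_le_trans dt.
  apply: (@le_trans _ _ (expR (- (K * d)))).
    by rewrite ler_expR lerN2 ler_wpM2l// ltW.
  apply: (le_trans (exp_decay n.+1 d0 K0)).
  apply: (@le_trans _ _ (E * (brk k ^+ n.+2)^-1)); last first.
    apply: ler_pM => //; first by rewrite invr_ge0 exprn_ge0// ltW// brk_gt0.
      by rewrite lerDr.
    exact: om_ge.
  rewrite /E -mulrA ler_wpM2l//.
  have bk : 0 < brk k :> R := brk_gt0 k.
  have pk : 0 < (`|k|%N)%:R :> R by exact: lt_le_trans kge1.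
  have -> : (2 / d) ^+ n.+2 * (brk k ^+ n.+2)^-1 = (d * (brk k / 2)) ^- n.+2.
    rewrite -exprVn -exprMn -exprVn; congr (_ ^+ _); field.
    by rewrite !gt_eqF.
  rewrite lef_pV2 ?posrE ?exprn_gt0 ?mulr_gt0 ?divr_gt0//.
  apply: lerXn2r; rewrite ?nnegrE ?mulr_ge0 ?(ltW d0) ?(ltW K0) ?divr_ge0 ?(ltW bk)//.
  rewrite ler_wpM2l ?(ltW d0)//; apply: le_trans kK.
  by rewrite ler_pdivrMr// mulrC.
rewrite ler_pdivrMr// -(omD gam n 1) // addn1.
have bk : brk k ^+ 4 <= 16 * K.
  have -> : 16 * K = (2 * (`|k|%N)%:R) ^+ 4 by rewrite /K exprMn; congr (_ * _); ring.
  by apply: lerXn2r; rewrite ?nnegrE ?(ltW (brk_gt0 _))// mulr_ge0.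
have -> : 23 * (C * (brk k ^+ 3 * (brk k ^+ 1 * om n.+1 k))) = 23 * C * om n.+1 k * brk k ^+ 4 by ring.
have -> : 16 * (23 * C) * om n.+1 k * K = 23 * C * om n.+1 k * (16 * K) by ring.
by rewrite ler_wpM2l// !mulr_ge0// om_ge0.
Qed.

Lemma decay_all n : decay 1 n.
Proof.
suff [] : decay 1 n /\ decay 2 n by [].
elim: n => [|n [IH1 IH2]]; first by split; exact: decay0.
have h := decay_step IH1 IH2; split => //; exact: decay_sqr.
Qed.

End Core.

(** * Differential polynomials and interior smoothing *)

Section DiffPoly.
Context {R : realType}.
Implicit Types (i j n m : nat) (x t : R).

(** Differential polynomials in one unknown; [DVar i] stands for its [i]-th
    x-derivative. *)
Inductive dpoly := DVar of nat | DCst of R | DAdd of dpoly & dpoly | DMul of dpoly & dpoly.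

Fixpoint dx1 (p : dpoly) : dpoly := match p with
  | DVar i => DVar i.+1
  | DCst _ => DCst 0
  | DAdd p q => DAdd (dx1 p) (dx1 q)
  | DMul p q => DAdd (DMul (dx1 p) q) (DMul p (dx1 q))
  end.

Fixpoint ev (W : nat -> R -> R -> R) (p : dpoly) x t : R := match p with
  | DVar i => W i x t
  | DCst c => c
  | DAdd p q => ev W p x t + ev W q x t
  | DMul p q => ev W p x t * ev W q x t
  end.

Definition dsq := DMul (DVar 0) (DVar 0).
(** Minus the time derivative of the [i]-th x-derivative of a solution of
    [w_t + w_xxxx + (w^2)_xxx = 0]. *)
Definition dev i := DAdd (DVar (i + 4)) (iter (i + 3) dx1 dsq).

Lemma ev_jcont W p : (forall i, jcont (W i)) -> jcont (ev W p).
Proof.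
move=> cW; elim: p => [i|c|p IHp q IHq|p IHp q IHq] /=.
- exact: cW.
- exact: jcont_cst.
- exact: jcontD.
- exact: jcontM.
Qed.

Lemma ev_drv W p t : (forall i t, drv (fun x => W i x t) (fun x => W i.+1 x t)) ->
  drv (fun x => ev W p x t) (fun x => ev W (dx1 p) x t).
Proof.
move=> dW; elim: p => [i|c|p IHp q IHq|p IHp q IHq] /=.
- exact: dW.
- exact: drv_cst.
- exact: drvD.
- exact: drvM.
Qed.

End DiffPoly.

Lemma J_parts_iter {R : realType} (a b : R) (y : R -> R) m (U : nat -> R -> R) :
  a <= b -> tst a b y -> (forall i, drv (U i) (U i.+1)) ->
  J a b (fun x => U 0%N x * Dn m y x) = (-1) ^+ m * J a b (fun x => U m x * y x).
Proof.
move=> ab ty; have sy := tst_smooth ty.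
elim: m U => [|m IHm] U dU; first by rewrite expr0 mul1r.
have [dy sdy] := Dn_drv m sy.
have [_ sdy1] := Dn_drv m.+1 sy.
have cU k : continuous (U k) := drv_continuous (dU k).
have [e1 e2] := supp_end (tst_supp (tst_Dn m ty)) (smooth_cont sdy).
have -> : J a b (fun x => U 0%N x * Dn m.+1 y x) = J a b (fun x => Dn m.+1 y x * U 0%N x).
  by apply: J_eq => x0 _; rewrite mulrC.
rewrite (J_parts ab (smooth_cont sdy1) (cU 1%N) dy (dU 0%N)) e1 e2 !mul0r subrr sub0r.
rewrite exprS -mulrA -(IHm (fun k => U k.+1) (fun k => dU k.+1)) mulN1r; congr (- _).
by apply: J_eq => x0 _; rewrite mulrC.
Qed.

Section Clamp.
Context {R : realType}.
Implicit Types a b x y : R.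

Definition clamp a b x : R := Num.max a (Num.min x b).

Lemma clamp_in a b x : a <= b -> a <= clamp a b x <= b.
Proof. by move=> ab; rewrite /clamp le_max lexx/= ge_max ab ge_min lexx orbT. Qed.

Lemma clamp_id a b x : a <= x <= b -> clamp a b x = x.
Proof. by move=> /andP[ax xb]; rewrite /clamp min_l// max_r. Qed.

Lemma clamp_lip a b x y : `|clamp a b x - clamp a b y| <= `|x - y|.
Proof.
wlog xy : x y / x <= y.
  by move=> h; have [/h//|/ltW/h] := leP x y; rewrite distrC (distrC y).
rewrite distrC (distrC x) (ger0_norm (_ : 0 <= y - x)) ?subr_ge0//.
rewrite /clamp; set m := Num.min x b; set m' := Num.min y b.
have m1 : m <= m' by rewrite le_min !ge_min xy lexx orbT.
have m2 : m' <= m + (y - x).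
  by rewrite /m /m'; case: (leP x b) => ?; rewrite ge_min; apply/orP; [left|right]; lra.
have M1 : a <= Num.max a m by rewrite le_max lexx.
have M2 : m <= Num.max a m by rewrite le_max lexx orbT.
have M3 : Num.max a m <= Num.max a m' by rewrite ge_max !le_max lexx m1 orbT.
have M4 : Num.max a m' <= Num.max a m + (y - x).
  by rewrite ge_max; apply/andP; split; lra.
by rewrite ler_norml; apply/andP; split; lra.
Qed.

Lemma lip_cont (f : R -> R) : (forall x y, `|f x - f y| <= `|x - y|) -> continuous f.
Proof.
move=> fl x; apply/cvgrPdist_lt => e e0; apply/nbhs_ballP; exists e => //= y.
by rewrite /ball/=; exact: le_lt_trans.
Qed.

Lemma clamp_cont a b : continuous (clamp a b).
Proof. by apply: lip_cont => x y; exact: clamp_lip. Qed.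

End Clamp.

Section Regularity.
Context {R : realType}.
Variables (gam r0 b0 : R) (w : R -> R -> R) (H M : R).
Hypotheses (gam0 : 0 < gam) (gam1 : gam <= 1).
Hypotheses (r00 : 0 < r0) (r01 : r0 <= 2^-1) (b00 : 0 < b0).
Hypothesis cw : jcont w.
Hypothesis wM : forall x t, `|w x t| <= M.
Hypothesis wH : forall x y t, `|w x t - w y t| <= H * `|x - y| `^ gam.
Hypothesis wE : forall f psi, tst (- r0) r0 f -> tst (- b0) 0 psi ->
  J (- b0) 0 (fun t => J (- r0) r0 (fun x =>
    w x t * (f x * D psi t - Dn 4 f x * psi t) + w x t ^+ 2 * (Dn 3 f x * psi t))) = 0.
Variables (r1 b1 : R).
Hypotheses (r10 : 0 < r1) (r11 : r1 < r0) (b10 : 0 < b1) (b11 : b1 < b0).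
Local Notation om := (@om R gam).

(** [W i] is the [i]-th derivative of the Hartley series of a localisation of [w]; the
    decay of all orders makes it converge, and the time is clamped so that it is defined
    everywhere.  The evolution law is first obtained against test functions, from the weak
    equation and repeated integration by parts, and then holds pointwise by continuity. *)
Lemma interior_smoothing : exists W : nat -> R -> R -> R, [/\ forall i, jcont (W i),
  forall i, exists2 L, 0 < L & forall x t, `|W i x t| <= L,
  forall i t, drv (fun x => W i x t) (fun x => W i.+1 x t),
  forall x t, - r1 <= x <= r1 -> - b1 <= t <= 0 -> W 0%N x t = w x t &
  forall i x s t, - r1 < x < r1 -> - b1 <= s -> s <= t -> t <= 0 ->
    W i x t - W i x s = - J s t (ev W (dev i) x)].
Proof.
move: (r00) (r01) (b00) (r10) (r11) (b10) (b11) => r00' r01' b00' r10' r11' b10' b11'.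
have PA := decay_all gam0 gam1 r00 r01 b00 cw wM wH wE.
have rr0 : - r0 <= r0 by lra.
have rr1 : - r1 <= r1 by lra.
have b1l : - b1 <= 0 by lra.
have pi2 := @pi_ge2 R.
have pp : 0 < 2 * pi :> R by lra.
have rr01 : - r0 < - r1 by lra.
have [rle1 rle2] : - r0 <= - r1 /\ r1 <= r0 by split; exact: ltW.
have tsub q : - b1 <= q <= 0 -> - b0 <= q <= 0 by move=> /andP[? ?]; apply/andP; split; lra.
have xsub x : - r1 <= x <= r1 -> `|x| <= 2^-1.
  by rewrite ler_norml => /andP[? ?]; apply/andP; split; lra.
(* the localisation is the identity on the smaller rectangle *)
have [z tz z1] := cutoff_exists rr01 rr1 r11.
pose cl := clamp (- b1) 0.
have ccl : continuous cl := clamp_cont (a := - b1) (b := 0).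
have hcl t : - b1 <= cl t <= 0 by apply: clamp_in.
pose a (j : int) t := hart j (fun x => z x * w x t) / (2 * pi).
have jzw : jcont (fun x t => z x * w x t) by apply: jcontM => //; exact: jcont_fx (tst_cont tz).
have ca j : continuous (a j).
  rewrite /a; under eq_fun do rewrite mulrC; apply: contZ.
  apply: J_param_cont; first lra.
  by apply: jcontM => //; exact: jcont_fx (@cas_cont _ j).
pose u i (j : int) x t := a j (cl t) * dcas i j x.
have ub n : exists2 A, 0 <= A & forall j t, `|a j (cl t)| <= A * om n j.
  have [C hC] := PA n z tz b1 b10 b11.
  have hC' j t : `|hart j (fun x => z x * w x (cl t))| <= C * om n j.
    have -> : (fun x => z x * w x (cl t)) = (fun x => z x * w x (cl t) ^+ 1) by apply/funext => x; rewrite expr1.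
    exact: hC.
  have C0 : 0 <= C := om_bound_ge0 (hC' ^~ 0).
  exists (C / (2 * pi)); first by rewrite divr_ge0// ltW.
  by move=> j t; rewrite normrM normfV (gtr0_norm pp) mulrAC ler_wpM2r// invr_ge0 ltW.
have uB i : exists2 A, 0 <= A & forall j x t, `|u i j x t| <= A * om 1 j.
  have [A A0 hA] := ub (1 + i)%N; exists (2 * A); first by rewrite mulr_ge0.
  move=> j x t; rewrite normrM.
  apply: (@le_trans _ _ (A * om (1 + i) j * (2 * brk j ^+ i))).
    rewrite ler_pM//; apply: (le_trans (dcas_le _ _ _)); rewrite ler_wpM2l//.
    by apply: lerXn2r; rewrite ?nnegrE ?(ltW (brk_gt0 _))// /brk ler_nat.
  by rewrite -(omD gam 1 i) le_eqVlt; apply/orP; left; apply/eqP; ring.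
pose W i x t := int_series (fun j => u i j x t).
exists W.
have jW i : jcont (W i).
  have [A A0 hA] := uB i.
  apply: (@int_series_cont _ _ gam0 _ (fun j (p : R * R) => u i j p.1 p.2) A) => //.
  move=> j; apply: (@jcontM _ (fun _ t => a j (cl t)) (fun x _ => dcas i j x)).
    by apply: jcont_ft; apply: cont_comp.
  by apply: jcont_fx; exact: drv_continuous (@dcas_drv _ i j).
have dW i t : drv (fun x => W i x t) (fun x => W i.+1 x t).
  have [A0 A00 hA0] := uB i; have [A1 A10 hA1] := uB i.+1; have [A2 A20 hA2] := uB i.+2.
  pose A := A0 + A1 + A2.
  apply: (@int_series_drv _ _ gam0 (fun j x => u i j x t) (fun j x => u i.+1 j x t) (fun j x => u i.+2 j x t) A).
  - by move=> j; apply: drvZ; exact: dcas_drv.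
  - by move=> j; apply: drvZ; exact: dcas_drv.
  - by move=> j x; apply: (le_trans (hA0 _ _ _)); rewrite ler_wpM2r ?om_ge0// /A; lra.
  - by move=> j x; apply: (le_trans (hA1 _ _ _)); rewrite ler_wpM2r ?om_ge0// /A; lra.
  - by move=> j x; apply: (le_trans (hA2 _ _ _)); rewrite ler_wpM2r ?om_ge0// /A; lra.
have W0 x t : - r1 <= x <= r1 -> - b1 <= t <= 0 -> W 0%N x t = w x t.
  move=> hx ht; have [A A0 hA] := ub 1%N.
  have e := @hart_inversion _ gam gam0 (fun x => z x * w x t) (A * (2 * pi)) x.
  rewrite z1// mul1r in e; rewrite e.
  - by rewrite /W /u /cl clamp_id.
  - exact: jcont_x jzw.
  - move=> k; have := hA k t; rewrite /cl clamp_id// normrM normfV (gtr0_norm pp).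
    by rewrite ler_pdivrMr// mulrAC.
  - exact: xsub.
split=> //.
  move=> i; have [A A0 hA] := uB i; exists (A * @om_total R gam + 1).
    by rewrite ltr_wpDl// mulr_ge0// om_total_ge0.
  by move=> x t; apply: (le_trans (int_series_bound gam0 (fun j => hA j x t))); rewrite lerDl.
move=> i x s t hx hs hst ht.
have jE p : jcont (ev W p) by exact: ev_jcont.
pose h x := J s t (ev W (dev i) x).
have jh : continuous h.
  by apply: (@J_param_cont _ (fun t x => ev W (dev i) x t)) => //; exact: jcont_swap.
suff : W i x t - W i x s + h x = 0 by move=> /eqP; rewrite addr_eq0 => /eqP.
apply: (@fundamental_lemma _ (- r1) r1 (fun x => W i x t - W i x s + h x)) => //.
  by apply: contD => //; apply: contB; exact: jcont_x (jW i).
move=> y ty.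
have ty' : tst (- r0) r0 y := tst_sub rle1 rle2 ty.
have sy := tst_smooth ty.
have cy := tst_cont ty.
have parts m (U : nat -> R -> R) : (forall i, drv (U i) (U i.+1)) ->
    J (- r1) r1 (fun x => U 0%N x * Dn m y x) = (-1) ^+ m * J (- r1) r1 (fun x => U m x * y x).
  exact: J_parts_iter.
have [F dF FE] := weak_ode r00 b00 cw wE (tst_Dn i ty').
have AE q : - b1 <= q <= 0 -> F q = (-1) ^+ i * J (- r1) r1 (fun x => W i x q * y x).
  move=> hq; rewrite FE; last exact: tsub.
  rewrite -(parts i (fun k x => W k x q))//.
  rewrite (@J_supp _ (- r0) r0 (- r1) r1)//.
  - by apply: J_eq => x0 hx0; rewrite W0.
  - by apply: contM; [exact: jcont_x cw|exact: smoothDn_cont sy].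
  - by move=> x0 hx0; rewrite (tst_supp (tst_Dn i ty)) ?mulr0.
have BE q : - b1 <= q <= 0 -> flux r0 w (Dn i y) q = (-1) ^+ i * J (- r1) r1 (fun x => y x * ev W (dev i) x q).
  move=> hq; rewrite /flux.
  have DD m : Dn m (Dn i y) = Dn (i + m) y by rewrite /Dn -iterD addnC.
  rewrite !DD.
  have c4 := smoothDn_cont (i := i + 4) sy; have c3 := smoothDn_cont (i := i + 3) sy.
  have P4 := parts (i + 4)%N (fun k x => W k x q) (fun k => dW k q).
  have P3 := parts (i + 3)%N (fun k x => ev W (iter k dx1 dsq) x q)
    (fun k => ev_drv (iter k dx1 dsq) q dW).
  have cW4 : continuous (fun x => W (i + 4)%N x q) := jcont_x (jW _).
  have cN3 : continuous (fun x => ev W (iter (i + 3) dx1 dsq) x q) := jcont_x (jE _).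
  rewrite (@J_supp _ (- r0) r0 (- r1) r1)//; first last.
  - move=> x0 hx0.
    by rewrite (tst_supp (tst_Dn (i + 4) ty)) ?(tst_supp (tst_Dn (i + 3) ty))// !mulr0 subrr.
  - apply: contB; apply: contM => //; first exact: jcont_x cw.
    by apply: contX; exact: jcont_x cw.
  rewrite (@J_eq _ _ (fun x => W 0%N x q * Dn (i + 4) y x - ev W (iter 0 dx1 dsq) x q * Dn (i + 3) y x)); last first.
    by move=> x0 hx0; rewrite /= W0.
  rewrite J_sub//; last 2 first.
    by apply: contM => //; exact: jcont_x (jW 0%N).
    by apply: contM => //; exact: jcont_x (jE (iter 0 dx1 dsq)).
  rewrite P4 P3 !exprD.
  have -> : (-1) ^+ 4 = 1 :> R by rewrite -signr_odd.
  have -> : (-1) ^+ 3 = -1 :> R by rewrite -signr_odd.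
  have -> : J (- r1) r1 (fun x0 => y x0 * ev W (dev i) x0 q) =
     J (- r1) r1 (fun x0 => W (i + 4)%N x0 q * y x0) +
     J (- r1) r1 (fun x0 => ev W (iter (i + 3) dx1 dsq) x0 q * y x0).
    rewrite -J_add//; [|exact: contM..].
    by apply: J_eq => x0 _ /=; rewrite mulrC mulrDl.
  by move: (J _ _ _) (J _ _ _) => j1 j2; ring.
have cflux : continuous (flux r0 w (Dn i y)).
  apply: J_param_cont => //; apply: flux_jcont => //.
  by have [] := Dn_drv i sy.
have := J_FTC2 hst (contN cflux) dF.
have hs0 : - b1 <= s <= 0 by rewrite hs (le_trans hst).
have ht0 : - b1 <= t <= 0 by rewrite ht (le_trans hs).
rewrite (AE t ht0) (AE s hs0).
rewrite (@J_eq _ _ (fun q => - (-1) ^+ i * J (- r1) r1 (fun x => y x * ev W (dev i) x q))); last first.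
  by move=> q /andP[sq qt]; rewrite BE ?mulNr// (le_trans hs sq) (le_trans qt ht).
have jy : jcont (fun x q => y x * ev W (dev i) x q) by apply: jcontM => //; exact: jcont_fx.
rewrite J_scale; last exact: J_param_cont.
rewrite -(J_fubini jy rr1 hst) -mulrBr mulNr -mulrN => /(mulfI _) E.
have {}E := E (negbT (signr_eq0 _ i)).
have cWy q : continuous (fun x => W i x q * y x) by apply: contM => //; exact: jcont_x (jW i).
have chy : continuous (fun x => h x * y x) by exact: contM.
rewrite (@J_eq _ _ (fun x => (W i x t * y x - W i x s * y x) + h x * y x)); last first.
  by move=> x0 _; rewrite -mulrBl -mulrDl mulrC.
rewrite J_add//; last by exact: contB.
rewrite J_sub// -E addrC; apply/eqP; rewrite subr_eq0; apply/eqP.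
apply: J_eq => x0 _; rewrite /h mulrC -J_scale//.
exact: jcont_t (jE (dev i)).
Qed.

End Regularity.

(** * Smoothness on products of intervals *)

Section Classical.
Context {R : realType}.
Implicit Types (A : set (R * R)) (f g h : R * R -> R) (x y t : R) (z : R * R).

(** A derivative of an extension [G] computes the difference quotients that stay
    inside [X], including one-sided ones at end points. *)
Lemma quot_within (X : set R) (f G : R -> R) x (l : R) : is_derive x 1 G l -> X x ->
  (forall y, X y -> f y = G y) ->
  (f y - f x) / (y - x) @[y --> within X x^'] --> l.
Proof.
move=> dG Xx fG.
have cv : h^-1 *: (G (h *: (1:R) + x) - G x) @[h --> 0^'] --> l.
  have := @ex_derive _ _ _ _ _ _ _ dG; rewrite /derivable => cv0.
  by rewrite -(@derive_val _ _ _ _ _ _ _ dG).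
apply/cvgrPdist_lt => e e0.
have /cvgrPdist_lt /(_ e e0) /nbhs_ballP[d /= d0 hd] := cv.
apply/nbhs_ballP; exists d => //= y; rewrite /ball/= => xy yx Xy.
have yx0 : y - x != 0 by rewrite subr_eq0.
have := hd (y - x); rewrite /ball/= sub0r normrN distrC => /(_ xy yx0).
by rewrite /GRing.scale/= mulr1 subrK !fG// mulrC.
Qed.

Lemma proper_within (X : set R) x : (forall e, 0 < e -> exists y, [/\ X y, y != x & `|x - y| < e]) ->
  ProperFilter (within X x^').
Proof.
move=> H; apply: Build_ProperFilter_ex.
move=> P /nbhs_ballP[d /= d0 hd].
by have [y [Xy yx xy]] := H d d0; exists y; apply: hd.
Qed.

(** Without this the limits that define [dx] and [dt] would not be unique. *)
Definition proper_dir A := (forall z, A z -> ProperFilter (near_x A z)) /\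
  (forall z, A z -> ProperFilter (near_t A z)).

(** A class of functions that is closed under both partial derivatives consists of
    smooth functions.  The induction is on all the functions that agree on [A] with one of
    the class, since [dx] and [dt] produce values outside [A] on which nothing is known. *)
Lemma Cinfty_class A (P : (R * R -> R) -> Prop) : proper_dir A ->
  (forall f, P f -> {within A, continuous f}) ->
  (forall f, P f -> exists2 g, P g & forall z, A z -> quot_x f z y @[y --> near_x A z] --> g z) ->
  (forall f, P f -> exists2 g, P g & forall z, A z -> quot_t f z s @[s --> near_t A z] --> g z) ->
  forall f, P f -> Cinfty A f.
Proof.
move=> [px pt] hc hx ht f Pf n.
suff : forall h, (forall z, A z -> h z = f z) -> Ck A n h by apply.
elim: n f Pf => [|n IH] f Pf h hf; have ch : {within A, continuous h}.
- by apply: (subspace_eq_continuous _ (hc f Pf)) => z; rewrite inE => /hf.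
- by split.
- by apply: (subspace_eq_continuous _ (hc f Pf)) => z; rewrite inE => /hf.
have [g Pg hg] := hx f Pf; have [k Pk hk] := ht f Pf.
have cx z : A z -> quot_x h z y @[y --> near_x A z] --> g z.
  move=> Az; have Fx := px z Az; apply: cvg_trans (hg z Az); apply: near_eq_cvg.
  by apply: (@filterE _ z.1^') => y Ay; rewrite /quot_x !hf//; case: (z) Az.
have ct z : A z -> quot_t h z y @[y --> near_t A z] --> k z.
  move=> Az; have Ft := pt z Az; apply: cvg_trans (hk z Az); apply: near_eq_cvg.
  by apply: (@filterE _ z.2^') => y Ay; rewrite /quot_t !hf//; case: (z) Az.
split => //; split.
- by move=> z Az; apply/cvg_ex; exists (g z); exact: cx.
- by move=> z Az; apply/cvg_ex; exists (k z); exact: ct.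
- apply: (IH g Pg) => z Az; have Fx := px z Az.
  by apply: cvg_lim => //; exact: cx.
- apply: (IH k Pk) => z Az; have Ft := pt z Az.
  by apply: cvg_lim => //; exact: ct.
Qed.

Lemma approach (a b x : R) : a < b -> a <= x <= b ->
  forall e, 0 < e -> exists y, [/\ a < y < b, y != x & `|x - y| < e].
Proof.
move=> ab /andP[ax xb] e e0.
(* move towards the farther end of the interval *)
have [xm|xm] := ltP x ((a + b) / 2).
  pose d := Num.min e (b - x) / 2.
  have m0 : 0 < Num.min e (b - x) by rewrite lt_min e0/=; lra.
  have me : Num.min e (b - x) <= e by rewrite ge_min lexx.
  have mb : Num.min e (b - x) <= b - x by rewrite ge_min lexx orbT.
  have d0 : 0 < d by rewrite /d; lra.
  exists (x + d); split.
  - by apply/andP; split; rewrite /d; lra.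
  - by rewrite gt_eqF// ltrDl.
  - by rewrite opprD addNKr normrN gtr0_norm// /d; lra.
pose d := Num.min e (x - a) / 2.
have m0 : 0 < Num.min e (x - a) by rewrite lt_min e0/=; lra.
have me : Num.min e (x - a) <= e by rewrite ge_min lexx.
have mb : Num.min e (x - a) <= x - a by rewrite ge_min lexx orbT.
have d0 : 0 < d by rewrite /d; lra.
exists (x - d); split.
- by apply/andP; split; rewrite /d; lra.
- by rewrite lt_eqF// ltrBlDr ltrDl.
- by rewrite opprB addrC subrK gtr0_norm// /d; lra.
Qed.

Lemma near_xE (X T : set R) z : T z.2 -> near_x (X `*` T) z = within X z.1^'.
Proof.
move=> Tz; rewrite /near_x (_ : [set y | _] = X)//.
by apply/seteqP; split => [y []//|y Xy]; split.
Qed.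

Lemma near_tE (X T : set R) z : X z.1 -> near_t (X `*` T) z = within T z.2^'.
Proof.
move=> Xz; rewrite /near_t (_ : [set s | _] = T)//.
by apply/seteqP; split => [y []//|y Xy]; split.
Qed.

Lemma proper_oo (a b x : R) (X : set R) : a < b -> a <= x <= b -> `]a, b[ `<=` X ->
  ProperFilter (within X x^').
Proof.
move=> ab axb sub; apply: proper_within => e e0.
have [y [h1 h2 h3]] := approach ab axb e0; exists y; split => //.
by apply: sub; rewrite /= in_itv.
Qed.

Lemma proper_dir_Q1 : proper_dir (@Q1_open R).
Proof.
split=> -[x t] [/= hx ht].
  rewrite near_xE//; apply: (@proper_oo (-1) 1); [lra| |by []].
  by move: hx; rewrite in_itv/= => /andP[? ?]; apply/andP; split; lra.
rewrite near_tE//; apply: (@proper_oo (-1) 0); [lra| |by []].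
by move: ht; rewrite in_itv/= => /andP[? ?]; apply/andP; split; lra.
Qed.

Lemma proper_dir_Q (r : R) : 0 < r -> proper_dir (@Q R r).
Proof.
move=> r0; have r4 : 0 < r ^+ 4 by rewrite exprn_gt0.
split=> -[x t] [/= hx ht].
  rewrite /Q /cyl near_xE//; apply: (@proper_oo (0 - r) (0 + r)); [lra| |by []].
  by move: hx; rewrite in_itv/= => /andP[? ?]; apply/andP; split; lra.
rewrite /Q /cyl near_tE//; apply: (@proper_oo (0 - r ^+ 4) 0); [lra| |].
  by move: ht; rewrite in_itv/= => /andP[? ?]; apply/andP; split; lra.
by move=> y /=; rewrite !in_itv/= => /andP[-> /ltW ->].
Qed.

Definition tens (f g : R -> R) : R * R -> R := fun z => f z.1 * g z.2.

Lemma tens_cont (f g : R -> R) : continuous f -> continuous g -> continuous (tens f g).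
Proof.
move=> cf cg; apply: contM; apply: cont_comp => // z; [exact: cvg_fst|exact: cvg_snd].
Qed.

Lemma tens_quot_x (f g : R -> R) h z : smooth f -> Q1_open z ->
  (forall z, Q1_open z -> h z = tens f g z) ->
  quot_x h z y @[y --> near_x Q1_open z] --> tens (D f) g z.
Proof.
move=> sf Qz hE; have [df _] := smooth_drv sf.
have := Qz; case: z Qz => x t Qz [/= hx ht]; rewrite near_xE//.
apply: (@quot_within _ (fun y => h (y, t)) (fun y => f y * g t)) => //.
  have := drvM df (drv_cst (g t)) x; rewrite mulr0 addr0; exact.
by move=> y hy; rewrite hE//; split.
Qed.

Lemma tens_quot_t (f g : R -> R) h z : smooth g -> Q1_open z ->
  (forall z, Q1_open z -> h z = tens f g z) ->
  quot_t h z y @[y --> near_t Q1_open z] --> tens f (D g) z.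
Proof.
move=> sg Qz hE; have [dg _] := smooth_drv sg.
have := Qz; case: z Qz => x t Qz [/= hx ht]; rewrite near_tE//.
apply: (@quot_within _ (fun s => h (x, s)) (fun s => f x * g s)) => //.
  by have := drvZ (f x) dg t; exact.
by move=> y hy; rewrite hE//; split.
Qed.

(** Tensors of smooth functions are closed under both derivatives. *)
Lemma tens_Cinfty (f g : R -> R) : smooth f -> smooth g -> Cinfty Q1_open (tens f g).
Proof.
move=> sf sg.
apply: (@Cinfty_class _ (fun h => exists u v, [/\ smooth u, smooth v & h = tens u v]) proper_dir_Q1 _ _ _ (tens f g)).
- move=> h [u [v [su sv ->]]]; apply: continuous_subspaceT.
  by apply: tens_cont; exact: smooth_cont.
- move=> h [u [v [su sv ->]]]; have [du sdu] := smooth_drv su.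
  by exists (tens (D u) v); [exists (D u), v|move=> z Qz; exact: tens_quot_x].
- move=> h [u [v [su sv ->]]]; have [dv sdv] := smooth_drv sv.
  by exists (tens u (D v)); [exists u, (D v)|move=> z Qz; exact: tens_quot_t].
- by exists f, g.
Qed.

Lemma tens_dx k (f g : R -> R) z : smooth f -> Q1_open z ->
  iter k (dx Q1_open) (tens f g) z = tens (Dn k f) g z.
Proof.
move=> sf; elim: k z => [|k IH] z Qz //=.
have Fx := proper_dir_Q1.1 z Qz.
by apply: cvg_lim => //; apply: tens_quot_x => //; have [] := Dn_drv k sf.
Qed.

Lemma tens_dt (f g : R -> R) z : smooth g -> Q1_open z ->
  dt Q1_open (tens f g) z = tens f (D g) z.
Proof.
move=> sg Qz; have Ft := proper_dir_Q1.2 z Qz.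
by apply: cvg_lim => //; exact: tens_quot_t.
Qed.

Lemma tens_Cinfty0 (f g : R -> R) (p q c d : R) : smooth f -> smooth g ->
  -1 < p -> q < 1 -> -1 < c -> d < 0 -> supp p q f -> supp c d g ->
  Cinfty0 Q1_open (tens f g).
Proof.
move=> sf sg p1 q1 c1 d0 hf hg; split; first exact: tens_Cinfty.
exists (box p q c d); split; first exact: box_compact.
- move=> [x t] [/=]; rewrite !in_itv/= => /andP[? ?] /andP[? ?].
  by split; rewrite /= in_itv/=; apply/andP; split; lra.
- move=> [x t] _ nK; rewrite /tens/=.
  have [h1|h1] := boolP (p <= x <= q); last by rewrite hf ?mul0r.
  have [h2|h2] := boolP (c <= t <= d); last by rewrite hg ?mulr0.
  by exfalso; apply: nK; split; rewrite /= in_itv.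
Qed.

End Classical.

(** * Functions orthogonal to smooth tensors *)

Section NullTest.
Context {R : realType}.
Local Notation RR := (measurableTypeR R * measurableTypeR R)%type.
Implicit Types (f g psi : R -> R) (a b c d e x t : R).

Definition open_itvs : set (set R) := [set A | exists a b, A = `]a, b[%classic].
Definition open_rects : set (set RR) := [set C | exists2 A, open_itvs A & exists2 B, open_itvs B & C = A `*` B].

(** Strips are countable unions of bounded rectangles. *)
Lemma open_rects_generate : @measurable _ RR = <<s open_rects >>.
Proof.
have mR : @measurable _ (measurableTypeR R) = <<s open_itvs >> by exact: measurable_realfun.RGenOpens.measurableE.
have big (A : set R) : A = \bigcup_n (A `&` `]- n%:R, n%:R[).
  apply/seteqP; split => [x Ax|x [n _ []]//].
  exists (Num.truncn `|x|).+1 => //; split => //=.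
  by rewrite in_itv/= -ltr_norml truncnS_gt.
apply/seteqP; split; last first.
  apply: smallest_sub; first exact: sigma_algebra_measurable.
  move=> _ [_ [a [b ->]] [_ [c [d ->]] ->]].
  by apply: measurableX; exact: measurable_itv.
apply: smallest_sub; first exact: smallest_sigma_algebra.
rewrite subUset; split.
- rewrite mR -g_sigma_preimageE; apply: smallest_sub; first exact: smallest_sigma_algebra.
  move=> _ [_ [a [b ->]] <-]; rewrite setTI.
  have -> : fst @^-1` `]a, b[ = \bigcup_n ((`]a, b[ : set R) `*` (`](- n%:R : R), n%:R[ : set R)) :> set RR.
    apply/seteqP; split => [[x t] /= hx|[x t] [n _ []]//].
    have : [set: R] t by []; rewrite {1}(big setT) => -[n _ [_ ht]].
    by exists n.
  have [_ _ hU] := @smallest_sigma_algebra RR setT open_rects; apply: hU => n.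
  apply: sub_sigma_algebra.
  by exists `]a, b[%classic; [exists a, b|exists `]- n%:R, n%:R[%classic => //; exists (- n%:R), n%:R].
- rewrite mR -g_sigma_preimageE; apply: smallest_sub; first exact: smallest_sigma_algebra.
  move=> _ [_ [a [b ->]] <-]; rewrite setTI.
  have -> : snd @^-1` `]a, b[ = \bigcup_n ((`](- n%:R : R), n%:R[ : set R) `*` (`]a, b[ : set R)) :> set RR.
    apply/seteqP; split => [[x t] /= hx|[x t] [n _ []]//].
    have : [set: R] x by []; rewrite {1}(big setT) => -[n _ [_ ht]].
    by exists n.
  have [_ _ hU] := @smallest_sigma_algebra RR setT open_rects; apply: hU => n.
  apply: sub_sigma_algebra.
  by exists `]- n%:R, n%:R[%classic; [exists (- n%:R), n%:R|exists `]a, b[%classic => //; exists a, b].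
Qed.

Lemma open_itvsI A B : open_itvs A -> open_itvs B -> open_itvs (A `&` B).
Proof.
move=> [a [b ->]] [c [d ->]]; exists (Num.max a c), (Num.min b d).
apply/seteqP; split => x; rewrite /= !in_itv/= ?gt_max ?lt_min.
  by move=> [/andP[-> ->] /andP[-> ->]].
by move=> /andP[/andP[-> ->] /andP[-> ->]].
Qed.

Lemma open_rectsI : setI_closed open_rects.
Proof.
move=> _ _ [A oA [B oB ->]] [A' oA' [B' oB' ->]].
exists (A `&` A'); first exact: open_itvsI.
by exists (B `&` B'); [exact: open_itvsI|rewrite setXI].
Qed.

(** The polynomials [1 - (1 - y)^n] take the bump to the indicator of the
    interval where it is positive, with values in [[0, 1]]. *)
Definition plateau a b n x : R := 1 - (1 - hump a b x) ^+ n.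

Lemma plateau_smooth a b n : smooth (plateau a b n).
Proof.
apply: smoothB; first exact: smooth_cst.
by apply: smoothX; apply: smoothB; [exact: smooth_cst|exact: hump_smooth].
Qed.

Lemma plateau_supp a b n : supp a b (plateau a b n).
Proof. by move=> x hx; rewrite /plateau hump_supp// subr0 expr1n subrr. Qed.

Lemma plateau01 a b n x : 0 <= plateau a b n x <= 1.
Proof.
have h0 : 0 <= 1 - hump a b x by rewrite subr_ge0 hump_le1.
have h1 : 1 - hump a b x <= 1 by rewrite gerBl hump_ge0.
have e1 := exprn_ile1 n h0 h1; have e0 := exprn_ge0 n h0.
by rewrite /plateau; apply/andP; split; lra.
Qed.

Lemma plateau_cvg a b x : plateau a b n x @[n --> \oo] --> (if a < x < b then 1 else 0 : R).
Proof.
case: ifPn => h; last first.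
  have -> : (fun n => plateau a b n x) = (fun=> 0).
    by apply/funext => n; rewrite /plateau hump_out// subr0 expr1n subrr.
  exact: cvg_cst.
rewrite -[X in _ --> X]subr0; apply: cvgB; first exact: cvg_cst.
apply: cvg_expr; have := hump_gt0 h; have := hump_le1 a b x.
by rewrite ltr_norml => ? ?; apply/andP; split; lra.
Qed.

Lemma int_restrict (A B : set RR) (F G : RR -> \bar R) : B `<=` A ->
  (forall z, B z -> F z = G z) -> (forall z, A z -> ~ B z -> F z = 0%E) ->
  (\int[leb2]_(z in A) F z = \int[leb2]_(z in B) G z)%E.
Proof.
move=> BA FG F0; rewrite integral_mkcond [RHS]integral_mkcond.
apply: eq_integral => z _; rewrite !patchE.
have [/set_mem Bz|/negP nB] := boolP (z \in B).
  by rewrite ifT ?FG// inE; exact: BA.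
case: ifPn => // /set_mem Az; apply: F0 => // Bz; apply: nB; exact: mem_set.
Qed.

(** By dominated convergence along the plateaus, [F] has zero integral over
    rectangles; these form a pi-system that generates the measurable sets. *)
Lemma ae_zero a b c d (F : RR -> R) :
  let U := `]a, b[ `*` `]c, d[ : set RR in
  leb2.-integrable U (EFin \o F) ->
  (forall f psi, smooth f -> smooth psi -> supp a b f -> supp c d psi ->
     \int[leb2]_(z in U) (F z * tens f psi z)%:E = 0)%E ->
  ae_eq leb2 U (EFin \o F) (cst 0%E).
Proof.
move=> U iF H.
have mU : measurable U by apply: measurableX; exact: measurable_itv.
have iFE (E : set RR) : measurable E -> leb2.-integrable (E `&` U) (EFin \o F).
  move=> mE; apply: integrableS iF => //; exact: measurableI.
(* integrals over rectangles are limits of pairings with plateaus *)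
have key p q r s : (\int[leb2]_(z in (`]p, q[ `*` `]r, s[) `&` U) (F z)%:E = 0)%E.
  pose p' := Num.max p a; pose q' := Num.min q b; pose r' := Num.max r c; pose s' := Num.min s d.
  pose Pn n := tens (plateau p' q' n) (plateau r' s' n).
  pose G z := if (p' < z.1 < q') && (r' < z.2 < s') then F z else 0.
  have mF := measurable_int _ iF.
  have cP n : continuous (Pn n) by apply: tens_cont; apply: smooth_cont; exact: plateau_smooth.
  have mP n : measurable_fun U (Pn n : RR -> measurableTypeR R).
    exact: (@jcont_measurable R (fun x t => Pn n (x, t)) U (cP n) mU).
  have Pn0 n : (\int[leb2]_(z in U) (F z * Pn n z)%:E = 0)%E.
    apply: H; [exact: plateau_smooth|exact: plateau_smooth| |].
      by apply: (supp_sub _ _ (@plateau_supp _ _ _)); rewrite ?le_max ?ge_min ?lexx ?orbT.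
    by apply: (supp_sub _ _ (@plateau_supp _ _ _)); rewrite ?le_max ?ge_min ?lexx ?orbT.
  have cvF z : (F z * Pn n z)%:E @[n --> \oo] --> (G z)%:E.
    apply: cvg_EFin; first exact: nearW.
    have -> : G z = F z * ((if p' < z.1 < q' then 1 else 0) * (if r' < z.2 < s' then 1 else 0)).
      by rewrite /G; case: (p' < _ < _); case: (r' < _ < _); rewrite /= ?mulr0 ?mul0r ?mulr1 ?mulr0.
    by apply: cvgM; [exact: cvg_cst|apply: cvgM; exact: plateau_cvg].
  have mF' : measurable_fun U (F : RR -> measurableTypeR R) by exact/measurable_EFinP.
  have mFP n := (measurable_EFinP _ _).2 (measurable_funM mF' (mP n)).
  have mG : measurable_fun U ((fun z => (G z)%:E) : RR -> \bar R).
    by apply: emeasurable_fun_cvg mFP _ => z _; exact: cvF.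
  have [] := @dominated_convergence _ _ _ leb2 U mU _ _ (fun z => `|F z|%:E) mFP mG.
    - by apply: aeW => z _; exact: cvF.
    - exact: (integrable_abse iF).
    - apply: aeW => z n _; rewrite lee_fin normrM ler_piMr// /Pn /tens normrM.
      have /andP[h0 h1] := plateau01 p' q' n z.1; have /andP[k0 k1] := plateau01 r' s' n z.2.
      by rewrite !ger0_norm// mulr_ile1.
  move=> _ _; rewrite (_ : (fun n => _) = fun=> 0%E); last by apply/funext => n; exact: Pn0.
  move=> /(cvg_unique (@ereal_hausdorff R) (cvg_cst _)) h0.
  rewrite -[RHS]/(0%E) [in RHS]h0; apply/esym/int_restrict; first by move=> z [].
    move=> [x t] [[/= hp hr] [/= ha hc]]; rewrite /G/= !gt_max !lt_min.
    by move: hp hr ha hc; rewrite !in_itv/= => /andP[-> ->] /andP[-> ->] /andP[-> ->] /andP[-> ->].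
  move=> [x t] [/= ha hc] nB; rewrite /G/= !gt_max !lt_min; case: ifP => // /andP[].
  move=> /andP[/andP[p1 _] /andP[p2 _]] /andP[/andP[p3 _] /andP[p4 _]]; exfalso; apply: nB.
  by split; [split; rewrite /= in_itv/= ?p1 ?p2 ?p3 ?p4|split].
have main (E : set RR) : measurable E -> (\int[leb2]_(z in E `&` U) (F z)%:E = 0)%E.
  move=> mE; have := mE; rewrite {1}open_rects_generate.
  apply: (@dynkin_induction _ RR open_rects (fun E => (\int[leb2]_(z in E `&` U) (F z)%:E = 0)%E)).
  - exact: open_rects_generate.
  - exact: open_rectsI.
  - by rewrite setTI -(setIid U); exact: key.
  - by move=> _ [_ [p [q ->]] [_ [r [s ->]] ->]]; exact: key.
  - move=> S mS S0.
    have e : U = (S `&` U) `|` (~` S `&` U) by rewrite -setIUl setUv setTI.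
    have mS' : measurable (~` S) by exact: measurableC.
    have U0 : (\int[leb2]_(z in U) (F z)%:E = 0)%E by rewrite -(setIid U); exact: key.
    have : (\int[leb2]_(z in (S `&` U) `|` (~` S `&` U)) (F z)%:E = 0)%E by rewrite -e.
    rewrite integral_setU//.
    + by rewrite S0 add0e.
    + exact: measurableI.
    + exact: measurableI.
    + by rewrite -e; exact: (measurable_int _ iF).
    + by apply/disj_setPS => z [[Sz _] [nSz _]]; exact: nSz.
  - move=> G mG tG G0; rewrite setI_bigcupl integral_bigcup//.
    + by rewrite eseries0// => n _ _; exact: G0.
    + exact: trivIset_setIr.
    + by move=> n; exact: measurableI.
    + rewrite -setI_bigcupl; apply: iFE; exact: bigcup_measurable.
apply: integral_ae_eq => //.
move=> E EU mE; rewrite integral0 -(setIidl EU); exact: main.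
Qed.

End NullTest.

(** * The equation tested against tensors *)

Section Tensors.
Context {R : realType}.
Local Notation RR := (measurableTypeR R * measurableTypeR R)%type.
Implicit Types (f psi : R -> R) (h : R * R -> R) (w : R -> R -> R).

Lemma Q1_open_measurable : measurable (@Q1_open R : set RR).
Proof. by apply: measurableX; exact: measurable_itv. Qed.

(** The support is compact in the open cylinder: this is what turns the tensor
    into a legitimate test function and makes locally integrable functions integrable
    against it. *)
Definition inside p q c d f psi :=
  [/\ -1 < p, p <= q, q < 1 & [/\ -1 < c, c <= d, d < 0 & supp p q f /\ supp c d psi]] : Prop.

Lemma inside_box p q c d f psi : @inside p q c d f psi -> box p q c d `<=` Q1_open.
Proof.
move=> [p1 pq q1 [c1 cd d0 _]] [x t] [/=]; rewrite !in_itv/= => /andP[? ?] /andP[? ?].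
by split; rewrite /= in_itv/=; apply/andP; split; lra.
Qed.

Lemma inside_out p q c d f psi z : @inside p q c d f psi -> ~ box p q c d z -> tens f psi z = 0.
Proof.
move=> [_ _ _ [_ _ _ [sf sp]]] nB; rewrite /tens.
have [h1|h1] := boolP (p <= z.1 <= q); last by rewrite sf// mul0r.
have [h2|h2] := boolP (c <= z.2 <= d); last by rewrite sp// mulr0.
by exfalso; apply: nB; split; rewrite /= in_itv.
Qed.

Lemma tens_bounded p q c d f psi : continuous f -> continuous psi -> @inside p q c d f psi ->
  exists2 M, 0 < M & forall z, `|tens f psi z| <= M.
Proof.
move=> cf cp ins.
have [M M0 hM] := @jcont_bounded _ (fun x t => tens f psi (x, t)) p q c d (tens_cont cf cp).
exists M => // z; have [[h1 h2]|nB] := pselect (box p q c d z).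
  by case: z h1 h2 => x t; rewrite /= !in_itv/= => *; exact: hM.
by rewrite (inside_out ins nB) normr0 ltW.
Qed.

Lemma tens_integrable p q c d f psi h : L1loc Q1_open h -> continuous f -> continuous psi ->
  @inside p q c d f psi ->
  leb2.-integrable (Q1_open : set RR) (fun z => (h z * tens f psi z)%:E).
Proof.
move=> hl cf cp ins.
have ib := hl _ (@box_compact _ p q c d) (inside_box ins).
have mB := @box_measurable R p q c d.
have [M M0 hM] := tens_bounded cf cp ins.
have iB : leb2.-integrable (box p q c d : set RR) (fun z => (h z * tens f psi z)%:E).
  have mt : measurable_fun (box p q c d : set RR) (tens f psi : RR -> measurableTypeR R).
    exact: (@jcont_measurable _ (fun x t => tens f psi (x, t)) _ (tens_cont cf cp) mB).
  have := @integrableMl _ RR R leb2 (box p q c d) mB (fun z => (h z)%:E) (tens f psi) ib mt.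
  apply; exists M; split; [exact: num_real|move=> N MN z _; exact: le_trans (hM z) (ltW MN)].
apply/integrable_mkcond; first exact: Q1_open_measurable.
move/integrable_mkcond : iB => /(_ mB); congr (_.-integrable _ _).
apply/funext => z; rewrite !patchE.
case: ifPn => [/set_mem Bz|/negP nB]; first by rewrite ifT// inE; exact: inside_box ins _ Bz.
by case: ifP => // _; rewrite (inside_out ins) ?mulr0// => Bz; apply: nB; exact: mem_set.
Qed.

Lemma tens_int w p q c d f psi : jcont w -> continuous f -> continuous psi -> @inside p q c d f psi ->
  (\int[leb2]_(z in (Q1_open : set RR)) (w z.1 z.2 * tens f psi z)%:E)%E =
  (J c d (fun t => J p q (fun x => w x t * (f x * psi t))))%:E.
Proof.
move=> cw cf cp ins; have [_ pq _ [_ cd _ _]] := ins.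
have cj : jcont (fun x t => w x t * (f x * psi t)).
  by apply: jcontM => //; exact: (tens_cont cf cp).
rewrite -(J_fubini cj pq cd) -(box_integral cj pq cd).1.
apply: int_restrict; [exact: inside_box ins|by []|].
by move=> z _ nB; rewrite (inside_out ins nB) mulr0.
Qed.

Lemma jcont_L1loc w : jcont w -> L1loc Q1_open (fun z => w z.1 z.2).
Proof.
move=> cw K cK KQ.
have mK : measurable (K : set RR).
  rewrite -(setCK K); apply: measurableC; apply: open2_measurable.
  by apply: closed_openC; apply: compact_closed => //; exact: norm_hausdorff.
apply: (integrableS (@box_measurable R (-1) 1 (-1) 0)) => //.
  by move=> z /KQ[]/=; rewrite !in_itv/= => /andP[? ?] /andP[? ?]; split; rewrite /= in_itv/= !ltW.
by apply: box_integrable => //; lra.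
Qed.

End Tensors.
Lemma Dn_D (R : realType) n (f : R -> R) : Dn n (D f) = Dn n.+1 f.
Proof. by rewrite /Dn -iterSr. Qed.

Section WeakForm.
Context {R : realType}.
Local Notation RR := (measurableTypeR R * measurableTypeR R)%type.
Local Notation mu := (@lebesgue_measure R).
Variables (gam K : R) (v vx vxx g : R * R -> R).
Hypotheses (gam0 : 0 < gam) (K0 : 0 < K).
Hypothesis hv : suitable_weak_solution v vx vxx.
Hypothesis hg : ae_eq_on (Q 2^-1) g vx.
Hypothesis gH : holder_on (Q 2^-1) K gam g.
Implicit Types (f psi : R -> R) (x y s t : R).
Variables (r0 b0 : R).
Hypotheses (r00 : 0 < r0) (r01 : r0 < 2^-1) (b00 : 0 < b0) (b01 : b0 < 16^-1).

Let rr : - r0 <= r0. Proof. by rewrite ge0_cp ?ltW. Qed.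
Let bb : - b0 <= 0. Proof. by rewrite oppr_le0 ltW. Qed.

(** Clamping the arguments extends the Hoelder representative to the whole plane
    with the same modulus of continuity. *)
Definition slope x t := g (clamp (- r0) r0 x, clamp (- b0) 0 t).

Lemma slope_id x t : - r0 <= x <= r0 -> - b0 <= t <= 0 -> slope x t = g (x, t).
Proof. by move=> hx ht; rewrite /slope !clamp_id. Qed.

Lemma in_Qhalf x t : - r0 <= x <= r0 -> - b0 <= t <= 0 -> Q 2^-1 (x, t).
Proof.
have e4 : 2^-1 ^+ 4 = 16^-1 :> R by rewrite exprVn -natrX.
move: (r01) (b01) => ? ?.
move=> /andP[? ?] /andP[? ?]; split; rewrite /= in_itv/= ?e4; apply/andP; split; lra.
Qed.

Lemma slope_holder x t y s :
  `|slope x t - slope y s| <= K * (`|x - y| + `|t - s| `^ 4^-1) `^ gam.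
Proof.
have cx z : - r0 <= clamp (- r0) r0 z <= r0 by apply: clamp_in.
have ct z : - b0 <= clamp (- b0) 0 z <= 0 by apply: clamp_in.
apply: le_trans (gH (in_Qhalf (cx x) (ct t)) (in_Qhalf (cx y) (ct s))) _.
apply: ler_wpM2l; first exact: ltW.
apply: ge0_ler_powR; rewrite ?nnegrE ?addr_ge0 ?powR_ge0//; first exact: ltW.
apply: lerD; first exact: clamp_lip.
by apply: ge0_ler_powR; rewrite ?nnegrE//; exact: clamp_lip.
Qed.

Lemma slope_jcont : jcont slope.
Proof.
apply/jcontP => x t e e0.
(* [m] solves [K * m ^ gam = e / 2]; half of it is allotted to space and half to time *)
pose m := (e / (2 * K)) `^ gam^-1.
have eK : 0 < e / (2 * K) by rewrite divr_gt0// mulr_gt0.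
have m0 : 0 < m by rewrite powR_gt0.
have m20 : 0 < m / 2 by rewrite divr_gt0.
exists (Num.min (m / 2) ((m / 2) ^+ 4)); first by rewrite lt_min m20 exprn_gt0.
move=> y s; rewrite !lt_min => /andP[xy _] /andP[_ ts].
apply: le_lt_trans (slope_holder x t y s) _.
have h1 : `|t - s| `^ 4^-1 <= m / 2.
  have -> : m / 2 = ((m / 2) ^+ 4) `^ 4^-1.
    by rewrite -powR_mulrn ?(ltW m20)// -powRrM divff ?powRr1 ?(ltW m20).
  by rewrite ge0_ler_powR ?nnegrE ?exprn_ge0 ?(ltW m20)// ltW.
have h2 : (`|x - y| + `|t - s| `^ 4^-1) `^ gam <= m `^ gam.
  rewrite ge0_ler_powR ?nnegrE ?(ltW gam0) ?addr_ge0 ?powR_ge0 ?(ltW m0)//.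
  by move: (ltW xy) h1; lra.
apply: (@le_lt_trans _ _ (K * (e / (2 * K)))).
  rewrite ler_wpM2l ?(ltW K0)//; apply: le_trans h2 _.
  by rewrite /m -powRrM mulVf ?gt_eqF// powRr1// ltW.
have -> : K * (e / (2 * K)) = e / 2 by field; rewrite gt_eqF.
by lra.
Qed.

Lemma slope_bounded : exists M, forall x t, `|slope x t| <= M.
Proof.
have [M M0 hM] := @jcont_bounded _ slope (- r0) r0 (- b0) 0 slope_jcont.
exists M => x t.
have cx : - r0 <= clamp (- r0) r0 x <= r0 by apply: clamp_in.
have ct : - b0 <= clamp (- b0) 0 t <= 0 by apply: clamp_in.
by have := hM _ _ cx ct; rewrite slope_id.
Qed.

Lemma slope_holder_x x y t : `|slope x t - slope y t| <= K * `|x - y| `^ gam.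
Proof.
have := slope_holder x t y t; rewrite subrr normr0 powR0 ?addr0//.
Qed.

Lemma tst_inside f psi : tst (- r0) r0 f -> tst (- b0) 0 psi -> exists p q c d,
  [/\ inside p q c d f psi, - r0 < p, q < r0, - b0 < c & d < 0].
Proof.
move=> [_ [p [q [? ? ? sf]]]] [_ [c [d [? ? ? sp]]]].
exists p, q, c, d; split => //; move: (r01) (b01) => ? ?; split; [lra|exact: ltW|lra|].
by split; [lra|exact: ltW|lra|].
Qed.

Definition pair f psi := (\int[leb2]_(z in (Q1_open : set RR)) (v z * tens f psi z))%R.

Lemma Q1_openW : Q1_open `<=` @Q R 1.
Proof.
move=> [x t] [/=]; rewrite !in_itv/= => /andP[? ?] /andP[? ?].
by split; rewrite /= in_itv/= ?expr1n; apply/andP; split; lra.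
Qed.

Lemma v_L1loc : L1loc Q1_open v. Proof. by have [] := sws_vx hv. Qed.

Lemma vx_ae : ae_eq_on (box (- r0) r0 (- b0) 0) vx (fun z => slope z.1 z.2).
Proof.
move: hg; rewrite /ae_eq_on; apply: filterS => -[x t] h [/=].
rewrite !in_itv/= => hx ht; rewrite slope_id// h//; exact: in_Qhalf.
Qed.

Lemma pair_int f psi : tst (- r0) r0 f -> tst (- b0) 0 psi ->
  (\int[leb2]_(z in (Q1_open : set RR)) (v z * tens f psi z)%:E)%E = (pair f psi)%:E.
Proof.
move=> tf tp; have [p [q [c [d [ins _ _ _ _]]]]] := tst_inside tf tp.
rewrite /pair /Rintegral fineK//; apply: integrable_fin_num; first exact: Q1_open_measurable.
exact: tens_integrable v_L1loc (tst_cont tf) (tst_cont tp) ins.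
Qed.

Lemma slope_int w f psi : jcont w -> tst (- r0) r0 f -> tst (- b0) 0 psi ->
  (\int[leb2]_(z in (Q1_open : set RR)) (w z.1 z.2 * tens f psi z)%:E)%E =
  (J (- b0) 0 (fun t => J (- r0) r0 (fun x => w x t * (f x * psi t))))%:E.
Proof.
move=> cw tf tp; have [p [q [c [d [ins p1 q1 c1 d1]]]]] := tst_inside tf tp.
have [_ pq _ [_ cd _ [sf sp]]] := ins.
have cf := tst_cont tf; have cp := tst_cont tp.
apply: etrans (tens_int cw cf cp ins) _; apply: (f_equal EFin).
have cj : jcont (fun x t => w x t * (f x * psi t)).
  by apply: jcontM => //; exact: (tens_cont cf cp).
transitivity (J c d (fun t => J (- r0) r0 (fun x => w x t * (f x * psi t)))).
  apply: J_eq => t _.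
  have ct : continuous (fun x => w x t * (f x * psi t)) := jcont_x cj.
  have st : supp p q (fun x => w x t * (f x * psi t)) by move=> x hx; rewrite sf// mul0r mulr0.
  by rewrite (J_supp ct st (ltW p1) pq (ltW q1)).
have ct := J_param_cont rr cj.
have st : supp c d (fun t => J (- r0) r0 (fun x => w x t * (f x * psi t))).
  by move=> t ht; apply: J_eq0 => x _; rewrite sp// !mulr0.
by rewrite (J_supp ct st (ltW c1) cd (ltW d1)).
Qed.

Lemma Q1_measurable : measurable (@Q R 1 : set RR).
Proof. by apply: measurableX; exact: measurable_itv. Qed.

Lemma tens_measurable f psi : continuous f -> continuous psi ->
  measurable_fun (Q1_open : set RR) (tens f psi : RR -> measurableTypeR R).
Proof.
move=> cf cp.
exact: (@jcont_measurable _ (fun x t => tens f psi (x, t)) _ (tens_cont cf cp) (@Q1_open_measurable R)).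
Qed.

(** The weak derivative of [v] is almost everywhere the slope on the support of the
    tensor. *)
Lemma pair_dx f psi : tst (- r0) r0 f -> tst (- b0) 0 psi ->
  pair (D f) psi = - J (- b0) 0 (fun t => J (- r0) r0 (fun x => slope x t * (f x * psi t))).
Proof.
move=> tf tp; have [p [q [c [d [ins p1 q1 c1 d1]]]]] := tst_inside tf tp.
have [p1' pq q1' [c1' cd d1' [sf sp]]] := ins.
have [_ hl mvx /(_ (tens f psi))] := sws_vx hv.
have mO := @Q1_open_measurable R.
have t0 := tens_Cinfty0 (tst_smooth tf) (tst_smooth tp) p1' q1' c1' d1' sf sp.
move=> /(_ t0) h.
apply: EFin_inj; rewrite -(pair_int (tst_drv tf) tp).
transitivity (\int[leb2]_(z in (Q1_open : set RR)) (- (vx z * tens f psi z))%:E)%E.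
  rewrite [RHS](_ : _ = \int[leb2]_(z in (Q1_open : set RR)) ((-1) ^+ 1 * (vx z * tens f psi z))%:E)%E; last first.
    by apply: eq_integral => z _; rewrite expr1 mulN1r.
  rewrite -h; apply: eq_integral => z /set_mem Qz; congr (_ * _)%:E.
  by rewrite (tens_dx 1 psi (tst_smooth tf) Qz).
have il := tens_integrable hl (tst_cont tf) (tst_cont tp) ins.
have iss := tens_integrable (jcont_L1loc slope_jcont) (tst_cont tf) (tst_cont tp) ins.
transitivity (- \int[leb2]_(z in (Q1_open : set RR)) (vx z * tens f psi z)%:E)%E.
  by rewrite -(integralN (integrable_add_def mO il)); apply: eq_integral.
rewrite EFinN -(slope_int slope_jcont tf tp); congr (- _)%E.
apply: (ae_eq_integral _ _ mO (measurable_int _ il) (measurable_int _ iss)).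
apply: filterS vx_ae => z h1 Oz.
  have [Bz|nB] := pselect (box p q c d z); last first.
    by rewrite (inside_out ins nB) !mulr0.
  rewrite h1//; move: Bz => [/=]; rewrite !in_itv/= => /andP[? ?] /andP[? ?].
  by split; rewrite /= in_itv/=; apply/andP; split; lra.
Qed.

Lemma pair_dt f psi : tst (- r0) r0 f -> tst (- b0) 0 psi ->
  pair f (D psi) = pair (Dn 4 f) psi +
    J (- b0) 0 (fun t => J (- r0) r0 (fun x => slope x t ^+ 2 * (Dn 2 f x * psi t))).
Proof.
move=> tf tp; have alg (a1 a2 a3 : R) : a1 - a2 - a3 = 0 -> a1 = a2 + a3 by move=> ?; lra.
have [p [q [c [d [ins p1 q1 c1 d1]]]]] := tst_inside tf tp.
have [p1' pq q1' [c1' cd d1' [sf sp]]] := ins.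
have [_ hl mvx _] := sws_vx hv.
have mO := @Q1_open_measurable R.
have t0 := tens_Cinfty0 (tst_smooth tf) (tst_smooth tp) p1' q1' c1' d1' sf sp.
have inside_D : inside p q c d f (D psi).
  by split => //; split => //; split => //; exact: supp_drv sp (smooth_drv (tst_smooth tp)).1.
have inside_Dn n : inside p q c d (Dn n f) psi.
  split => //; split => //; split => //; elim: n => [//|n IH].
  by apply: supp_drv IH _; have [] := Dn_drv n (tst_smooth tf).
have := sws_equation hv t0.
have cf := tst_cont tf; have cp := tst_cont tp.
have ctf2 := tst_cont (tst_Dn 2 tf); have ctp := tst_cont (tst_drv tp).
have i1 := tens_integrable v_L1loc cf ctp inside_D.
have i2 := tens_integrable v_L1loc (tst_cont (tst_Dn 4 tf)) cp (inside_Dn 4).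
have i3 := tens_integrable (jcont_L1loc (jcontX (n := 2) slope_jcont)) ctf2 cp (inside_Dn 2).
have i12 := integrableB mO i1 i2.
have -> : (\int[leb2]_(z in (Q1_open : set RR))
   (v z * (dt Q1_open (tens f psi) z - iter 4 (dx Q1_open) (tens f psi) z)
        - vx z ^+ 2 * iter 2 (dx Q1_open) (tens f psi) z)%:E =
  \int[leb2]_(z in (Q1_open : set RR))
   (v z * (tens f (D psi) z - tens (Dn 4 f) psi z)
        - vx z ^+ 2 * tens (Dn 2 f) psi z)%:E)%E.
  apply: eq_integral => z /set_mem Qz.
  by rewrite (tens_dt f (tst_smooth tp) Qz) (tens_dx 4 psi (tst_smooth tf) Qz) (tens_dx 2 psi (tst_smooth tf) Qz).
have mv := measurable_funS Q1_measurable (@Q1_openW) (sws_v_L2oo hv).1.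
have mvx' := measurable_funS Q1_measurable (@Q1_openW) mvx.
have mt1 := measurable_funB (tens_measurable cf ctp) (tens_measurable (tst_cont (tst_Dn 4 tf)) cp).
have m1 := (measurable_EFinP _ _).2 (measurable_funB (measurable_funM mv mt1)
  (measurable_funM (measurable_funX 2 mvx') (tens_measurable ctf2 cp))).
have m2 := measurable_int _ (integrableB mO i12 i3).
have ae : ae_eq leb2 (Q1_open : set RR) (EFin \o (v \* (tens f (D psi) \- tens (Dn 4 f) psi) \- (fun z => vx z ^+ 2) \* tens (Dn 2 f) psi))
  (fun z => ((v z * tens f (D psi) z)%:E - (v z * tens (Dn 4 f) psi z)%:E - (slope z.1 z.2 ^+ 2 * tens (Dn 2 f) psi z)%:E)%E).
  apply: filterS vx_ae => z h1 Oz.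
  suff : v z * (tens f (D psi) z - tens (Dn 4 f) psi z) - vx z ^+ 2 * tens (Dn 2 f) psi z =
    v z * tens f (D psi) z - v z * tens (Dn 4 f) psi z - slope z.1 z.2 ^+ 2 * tens (Dn 2 f) psi z.
    by move=> E; exact: (congr1 EFin E).
  rewrite mulrBr; congr (_ - _).
  have [Bz|nB] := pselect (box p q c d z); last by rewrite (inside_out (inside_Dn 2) nB) !mulr0.
  rewrite h1//; move: Bz => [/=]; rewrite !in_itv/= => /andP[? ?] /andP[? ?].
  by split; rewrite /= in_itv/=; apply/andP; split; lra.
move=> h; have := etrans (esym (ae_eq_integral _ _ mO m1 m2 ae)) h.
rewrite (integralB mO i12 i3) (integralB mO i1 i2).
have E1 := pair_int tf (tst_drv tp).
have E2 := pair_int (tst_Dn 4 tf) tp.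
have E3 := slope_int (jcontX (n := 2) slope_jcont) (tst_Dn 2 tf) tp.
move=> E; apply: alg; apply: EFin_inj; apply: etrans _ E.
pose sb (x y : \bar R) := (x - y)%E.
exact: (congr2 sb (congr2 sb (esym E1) (esym E2)) (esym E3)).
Qed.

(** The equation of [v] is tested with the x-derivative of [f], and the two pairings of [v]
    with x-derivatives are replaced by pairings of the slope. *)
Lemma slope_equation f psi : tst (- r0) r0 f -> tst (- b0) 0 psi ->
  J (- b0) 0 (fun t => J (- r0) r0 (fun x =>
    slope x t * (f x * D psi t - Dn 4 f x * psi t) + slope x t ^+ 2 * (Dn 3 f x * psi t))) = 0.
Proof.
move=> tf tp.
have alg (a1 a2 a3 : R) : - a1 = - a2 + a3 -> a1 - a2 + a3 = 0 by move=> ?; lra.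
have h := pair_dt (tst_drv tf) tp.
have e4 : Dn 4 (D f) = Dn 5 f := Dn_D 4 f.
have e2 : Dn 2 (D f) = Dn 3 f := Dn_D 2 f.
rewrite e4 e2 (pair_dx tf (tst_drv tp)) (pair_dx (tst_Dn 4 tf) tp) in h.
have cs := slope_jcont.
have cj (w : R -> R -> R) (u y : R -> R) : jcont w -> continuous u -> continuous y ->
    jcont (fun x t => w x t * (u x * y t)).
  by move=> cw cu cy; apply: jcontM => //; exact: (tens_cont cu cy).
have c1 := cj _ _ _ cs (tst_cont tf) (tst_cont (tst_drv tp)).
have c2 := cj _ _ _ cs (tst_cont (tst_Dn 4 tf)) (tst_cont tp).
have c3 := cj _ _ _ (jcontX (n := 2) cs) (tst_cont (tst_Dn 3 tf)) (tst_cont tp).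
have -> : J (- b0) 0 (fun t => J (- r0) r0 (fun x =>
    slope x t * (f x * D psi t - Dn 4 f x * psi t) + slope x t ^+ 2 * (Dn 3 f x * psi t))) =
  J (- b0) 0 (fun t => J (- r0) r0 (fun x => slope x t * (f x * D psi t))
    - J (- r0) r0 (fun x => slope x t * (Dn 4 f x * psi t))
    + J (- r0) r0 (fun x => slope x t ^+ 2 * (Dn 3 f x * psi t))).
  apply: J_eq => t _.
  rewrite -J_sub//; [|exact: (jcont_x c1)|exact: (jcont_x c2)].
  rewrite -J_add//; [|exact: contB (jcont_x c1) (jcont_x c2)|exact: (jcont_x c3)].
  by apply: J_eq => x _; rewrite mulrBr.
have k1 := J_param_cont rr c1; have k2 := J_param_cont rr c2; have k3 := J_param_cont rr c3.
rewrite J_add// ?J_sub//; last exact: contB k1 k2.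
exact: alg h.
Qed.

End WeakForm.

(** * The potential of the slope *)

Section Potential.
Context {R : realType}.
Implicit Types (i j n : nat) (x y s t : R) (f psi : R -> R).
Variables (W : nat -> R -> R -> R) (r1 b1 L : R).
Hypotheses (r10 : 0 < r1) (b10 : 0 < b1).
Hypothesis cW : forall i, jcont (W i).
Hypothesis W0b : forall x t, `|W 0%N x t| <= L.
Hypothesis dW : forall i t, drv (fun x => W i x t) (fun x => W i.+1 x t).
Hypothesis tW : forall i x s t, - r1 < x < r1 -> - b1 <= s -> s <= t -> t <= 0 ->
  W i x t - W i x s = - J s t (ev W (dev i) x).

(** The flux [w_xxx + (w^2)_xx] of the conservation law, whose x-derivative is [dev 0]. *)
Definition fluxp : @dpoly R := DAdd (DVar 3) (iter 2 dx1 dsq).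

(** [V x t] is the primitive of [W 0] in [x] from the base point 0, corrected by a function of
    time alone which gives it the right time derivative at [x = 0].  At other points the time
    derivative follows by integrating the evolution law of [W 0] in [x]. *)
Lemma potential : exists V : R -> R -> R, [/\ jcont V,
  forall t, drv (fun x => V x t) (fun x => W 0%N x t) &
  forall x s t, - r1 < x < r1 -> - b1 <= s -> s <= t -> t <= 0 ->
    V x t - V x s = - J s t (ev W fluxp x)].
Proof.
move: (r10) (b10) => r10' b10'.
have cev p : jcont (ev W p) by apply: ev_jcont.
have [N dN] : exists N, drv N (ev W fluxp 0) by apply: prim_exists; exact: (jcont_t (cev fluxp)).
have /choice[P hP] : forall t, exists F : R -> R, drv F (fun x => W 0%N x t) /\ F 0 = 0.
  move=> t; have cWt : continuous (fun x => W 0%N x t) := jcont_x (@cW 0%N).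
  have [F dF] := prim_exists cWt.
  exists (fun x => F x - F 0); split; last by rewrite subrr.
  by have := drvB dF (drv_cst (F 0)); apply: drv_ext => // x; rewrite subr0.
have dP t := (hP t).1; have P0 t := (hP t).2.
have Pl t x y : `|P t x - P t y| <= L * `|x - y|.
  wlog xy : x y / x <= y => [h|].
    by have [/h//|/ltW/h] := leP x y; rewrite distrC (distrC y).
  have [z _] := drv_mvt (dP t) xy.
  by rewrite distrC (distrC x) => ->; rewrite normrM ler_wpM2r.
have Pt x : continuous (fun t => P t x).
  have [x0|/ltW x0] := leP 0 x.
    rewrite (_ : (fun t => _) = fun t => J 0 x (fun y => W 0%N y t)); first exact: J_param_cont.
    by apply/funext => t; rewrite (J_FTC2 x0 (jcont_x (@cW 0%N)) (dP t)) P0 subr0.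
  rewrite (_ : (fun t => _) = fun t => - J x 0 (fun y => W 0%N y t)); first by apply: contN; exact: J_param_cont.
  by apply/funext => t; rewrite (J_FTC2 x0 (jcont_x (@cW 0%N)) (dP t)) P0 sub0r opprK.
have L0 : 0 <= L := le_trans (normr_ge0 _) (W0b 0 0).
exists (fun x t => P t x - N t); split.
- apply: jcontB; last by apply: jcont_ft; exact: drv_continuous dN.
  apply/jcontP => x t e e0.
  have e20 : 0 < e / 2 by rewrite divr_gt0.
  have /cvgrPdist_lt /(_ _ e20) /nbhs_ballP[d /= d0 hd] := Pt x t.
  have k0 : 0 < e / 2 / (L + 1) by rewrite divr_gt0// ltr_wpDl.
  exists (Num.min d (e / 2 / (L + 1))); first by rewrite lt_min d0.
  move=> y s; rewrite !lt_min => /andP[_ xy] /andP[ts _].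
  have h1 := hd s ts.
  have h2 : L * `|x - y| <= e / 2.
    apply: (@le_trans _ _ ((L + 1) * (e / 2 / (L + 1)))); last by rewrite mulrCA divff ?mulr1// gt_eqF// ltr_wpDl.
    by apply: ler_pM => //; [rewrite lerDl|exact: ltW].
  have -> : P t x - P s y = (P t x - P s x) + (P s x - P s y) by rewrite addrA subrK.
  apply: le_lt_trans (ler_normD _ _) _.
  by have h3 := le_trans (Pl s x y) h2; rewrite [e]splitr; apply: ltr_leD.
- by move=> t; have := drvB (dP t) (drv_cst (N t)); apply: drv_ext => // x; rewrite subr0.
- move=> x s t hx bs st t0.
  (* the expression is constant in [x], and its value at 0 is compensated by [N] *)
  have key y z : - r1 < y -> z < r1 -> y <= z ->
      P t z - P s z + J s t (ev W fluxp z) = P t y - P s y + J s t (ev W fluxp y).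
    move=> ry zr yz.
    have cs u : continuous (ev W fluxp u) := jcont_t (cev fluxp).
    have e1 : (P t z - P t y) - (P s z - P s y) = J y z (fun u => W 0%N u t - W 0%N u s).
      rewrite J_sub//; [|exact: (jcont_x (@cW 0%N))|exact: (jcont_x (@cW 0%N))].
      by rewrite (J_FTC2 yz (jcont_x (@cW 0%N)) (dP t)) (J_FTC2 yz (jcont_x (@cW 0%N)) (dP s)).
    have e2 : J s t (ev W fluxp z) - J s t (ev W fluxp y) = J y z (fun u => J s t (ev W (dev 0) u)).
      rewrite -J_sub// (J_fubini (cev (dev 0%N)) yz st); apply: J_eq => tau _.
      by rewrite (J_FTC2 yz (jcont_x (cev (dev 0%N))) (ev_drv fluxp tau dW)).
    have e3 : J y z (fun u => W 0%N u t - W 0%N u s) = - J y z (fun u => J s t (ev W (dev 0) u)).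
      rewrite -[RHS]mulN1r -J_scale; last exact: (J_param_cont st (jcont_swap (cev (dev 0%N)))).
      apply: J_eq => u /andP[yu uz]; rewrite mulN1r; apply: tW => //.
      by rewrite (lt_le_trans ry yu) (le_lt_trans uz zr).
    by move: e1 e2; rewrite e3; move: (J y z _) (J s t _) (J s t _) => a1 a2 a3 h1 h2; lra.
  have h0 : P t x - P s x + J s t (ev W fluxp x) = J s t (ev W fluxp 0).
    have [x0|/ltW x0] := leP 0 x.
      by rewrite (key 0 x)// ?P0 ?subrr ?add0r//; [lra|case/andP: hx].
    by rewrite -(key x 0)// ?P0 ?subrr ?add0r//; case/andP: hx.
  move: h0; rewrite (J_FTC2 st (jcont_t (cev fluxp)) dN).
  by move: (J s t _) => a1 h1; lra.
Qed.

(** Differentiation in time, the evolution law being used for each variable. *)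
Fixpoint dt1 (p : @dpoly R) : dpoly := match p with
  | DVar i => DMul (DCst (-1)) (dev i)
  | DCst _ => DCst 0
  | DAdd p q => DAdd (dt1 p) (dt1 q)
  | DMul p q => DAdd (DMul (dt1 p) q) (DMul p (dt1 q))
  end.

(** The increments on the time interval determine a function that is
    differentiable at all times, so that one-sided derivatives at [t = 0] need no separate
    treatment. *)
Lemma time_extension (G : R -> R) (q : R -> R) : continuous q ->
  (forall s t, - b1 <= s -> s <= t -> t <= 0 -> G t - G s = - J s t q) ->
  exists2 F, drv F (fun t => - q t) & forall t, - b1 <= t <= 0 -> G t = F t.
Proof.
move=> cq h; have [Z dZ] := prim_exists cq.
exists (fun t => G (- b1) - (Z t - Z (- b1))).
  have := drvB (drv_cst (G (- b1))) (drvB dZ (drv_cst (Z (- b1)))).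
  by apply: drv_ext => // t; rewrite subr0 sub0r.
move=> t /andP[t1 t0]; have := h (- b1) t (lexx _) t1 t0.
by rewrite (J_FTC2 t1 cq dZ) => <-; rewrite subrKC.
Qed.

Lemma ev_dt p x : - r1 < x < r1 -> exists G g, drv G g /\
  forall t, - b1 <= t <= 0 -> ev W p x t = G t /\ ev W (dt1 p) x t = g t.
Proof.
move=> hx; elim: p => [i|c|p [G [g [dG hG]]] q [G' [g' [dG' hG']]]|p [G [g [dG hG]]] q [G' [g' [dG' hG']]]].
- have cq : continuous (ev W (dev i) x) by exact: (jcont_t (@ev_jcont R W _ cW)).
  have [F dF hF] := time_extension cq (fun s t => @tW i x s t hx).
  by exists F, (fun t => - ev W (dev i) x t); split => // t ht; split; [exact: hF|rewrite /= mulN1r].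
- by exists (fun=> c), (fun=> 0); split; [exact: drv_cst|].
- exists (fun t => G t + G' t), (fun t => g t + g' t); split; first exact: drvD.
  by move=> t ht /=; have [-> ->] := hG t ht; have [-> ->] := hG' t ht.
- exists (fun t => G t * G' t), (fun t => g t * G' t + G t * g' t); split; first exact: drvM.
  by move=> t ht /=; have [-> ->] := hG t ht; have [-> ->] := hG' t ht.
Qed.

(** The class of the differential polynomials in the [W i], together with the function
    itself, is closed under both derivatives. *)
Lemma ev_Cinfty V c (r : R) : 0 < r -> r < r1 -> r ^+ 4 <= b1 -> jcont V ->
  (forall t, drv (fun x => V x t) (fun x => W 0%N x t)) ->
  (forall x s t, - r1 < x < r1 -> - b1 <= s -> s <= t -> t <= 0 ->
    V x t - V x s = - J s t (ev W fluxp x)) ->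
  Cinfty (Q r) (fun z => V z.1 z.2 + c).
Proof.
move=> r0 rr1 rb cV dV tV.
pose u (z : R * R) := V z.1 z.2 + c.
pose cls (h : R * R -> R) := (exists p, h = fun z => ev W p z.1 z.2) \/ h = u.
have QE z : Q r z -> - r1 < z.1 < r1 /\ - b1 <= z.2 <= 0.
  by case=> /=; rewrite !in_itv/= => /andP[? ?] /andP[? ?]; split; apply/andP; split; lra.
apply: (@Cinfty_class _ (Q r) cls (proper_dir_Q r0) _ _ _ u); last by right.
- move=> h [[p ->]|->]; apply: continuous_subspaceT; first exact: ev_jcont.
  by apply: contD; [exact: cV|exact: cont_cst].
- move=> h [[p ->]|->].
    exists (fun z => ev W (dx1 p) z.1 z.2); first by left; exists (dx1 p).
    move=> [x t] Qz; have [hx ht] := Qz; rewrite near_xE//.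
    by apply: (@quot_within _ _ _ (fun x => ev W p x t)) => //; exact: (ev_drv p t dW).
  exists (fun z => ev W (DVar 0) z.1 z.2); first by left; exists (DVar 0).
  move=> [x t] Qz; have [hx ht] := Qz; rewrite near_xE//.
  apply: (@quot_within _ _ _ (fun x => V x t + c)) => //=.
  by have := drvD (dV t) (drv_cst c) x; rewrite addr0.
- move=> h [[p ->]|->].
    exists (fun z => ev W (dt1 p) z.1 z.2); first by left; exists (dt1 p).
    move=> [x t] Qz; have [hx ht] := Qz; have [hx1 ht1] := QE _ Qz; rewrite near_tE//.
    have [G [g [dG hG]]] := ev_dt p hx1.
    apply: (@quot_within _ _ _ G) => //=; first by rewrite (hG t ht1).2; exact: dG.
    by move=> s hs; have [_ hs1] := QE (x, s) (conj hx hs); exact: (hG s hs1).1.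
  exists (fun z => ev W (DMul (DCst (-1)) fluxp) z.1 z.2); first by left; exists (DMul (DCst (-1)) fluxp).
  move=> [x t] Qz; have [hx ht] := Qz; have [hx1 ht1] := QE _ Qz; rewrite near_tE//.
  have cq : continuous (ev W fluxp x) by exact: (jcont_t (@ev_jcont R W _ cW)).
  have [F dF hF] := time_extension cq (fun s t => @tV x s t hx1).
  apply: (@quot_within _ _ _ (fun t => F t + c)) => //=.
    by rewrite mulN1r; have := drvD dF (drv_cst c) t; rewrite addr0.
  by move=> s hs; have [_ hs1] := QE (x, s) (conj hx hs); rewrite /u/= (hF s hs1).
Qed.

End Potential.

(** * Identification of a function from its pairings *)

Section Identification.
Context {R : realType}.
Local Notation RR := (measurableTypeR R * measurableTypeR R)%type.
Implicit Types (n : nat) (a b x y s t : R) (f psi : R -> R).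

(** The remainder has integral zero. *)
Lemma tst_decomp a b rho f : a <= b -> tst a b rho -> J a b rho = 1 -> tst a b f ->
  exists2 F, tst a b F & f = fun x => J a b f * rho x + D F x.
Proof.
move=> ab trho r1 tf.
have [sg [p [q [ap pq qb sp]]]] := tstD tf (tstZ (- J a b f) trho).
have g0 : J p q (fun x => f x + - J a b f * rho x) = 0.
  have cr := tst_cont trho; have cf := tst_cont tf.
  rewrite -(J_supp (smooth_cont sg) sp (ltW ap) (ltW pq) (ltW qb)).
  by rewrite J_add// ?J_scale ?r1 ?mulr1 ?subrr//; exact: contZ.
have [F [sF suF dF]] := supp_prim sg sp (ltW pq) g0.
exists F; first by split => //; exists p, q.
by apply/funext => x; rewrite (drv_derive1 dF) mulNr addrC subrK.
Qed.

Lemma tst_unit a b : a < b -> exists2 rho, tst a b rho & J a b rho = 1.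
Proof.
move=> ab.
pose p := a + (b - a) / 3; pose q := b - (b - a) / 3.
have ap : a < p by rewrite /p; lra.
have pq : p < q by rewrite /p /q; lra.
have qb : q < b by rewrite /q; lra.
have th := tst_hump ap pq qb.
have h0 : 0 < J a b (hump p q) := J_hump_gt0 (ltW ap) pq (ltW qb).
exists (fun x => (J a b (hump p q))^-1 * hump p q x); first exact: tstZ.
by rewrite J_scale ?mulVf ?gt_eqF//; exact: tst_cont th.
Qed.

(** Decomposing both factors along a fixed test function, only the product of
    the two integrals survives. *)
Lemma tensor_constant (a b c d : R) (E : (R -> R) -> (R -> R) -> R) : a < b -> c < d ->
  (forall k f g psi, tst a b f -> tst a b g -> tst c d psi ->
     E (fun x => k * f x + g x) psi = k * E f psi + E g psi) ->
  (forall k f psi phi, tst a b f -> tst c d psi -> tst c d phi ->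
     E f (fun t => k * psi t + phi t) = k * E f psi + E f phi) ->
  (forall f psi, tst a b f -> tst c d psi -> E (D f) psi = 0) ->
  (forall f psi, tst a b f -> tst c d psi -> E f (D psi) = 0) ->
  exists K, forall f psi, tst a b f -> tst c d psi -> E f psi = K * (J a b f * J c d psi).
Proof.
move=> ab cd Ex Et Edx Edt.
have [rho trho r1] := tst_unit ab; have [sig tsig s1] := tst_unit cd.
exists (E rho sig) => f psi tf tp.
have [F tF fE] := tst_decomp (ltW ab) trho r1 tf.
have [G tG pE] := tst_decomp (ltW cd) tsig s1 tp.
rewrite {1}fE Ex// ?Edx//; last exact: tst_drv.
rewrite {1}pE Et// ?Edt//; last exact: tst_drv.
by rewrite !addr0 [RHS]mulrC mulrA.
Qed.

Lemma line_null a b c : (@leb2 R) (`[a, b] `*` [set c] : set RR) = 0%E.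
Proof.
rewrite /leb2 /= product_measure1E//.
transitivity (lebesgue_measure `[a, b] * lebesgue_measure [set c])%E => //.
by rewrite lebesgue_measure_set1 mule0.
Qed.

End Identification.
Section Identify.
Context {R : realType}.
Local Notation RR := (measurableTypeR R * measurableTypeR R)%type.
Implicit Types (n m : nat) (a b x y s t : R) (f psi : R -> R) (w : R -> R -> R).

Definition JJ r b w f psi : R :=
  J (- b) 0 (fun t => J (- r) r (fun x => w x t * (f x * psi t))).

Variables (r b : R).
Hypotheses (r0 : 0 < r) (r12 : r < 2^-1) (b0 : 0 < b) (b16 : b < 16^-1).

Let rr : - r <= r. Proof. by rewrite ge0_cp ?ltW. Qed.
Let bb : - b <= 0. Proof. by rewrite oppr_le0 ltW. Qed.

Lemma JJ_jcont w f psi : jcont w -> continuous f -> continuous psi ->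
  jcont (fun x t => w x t * (f x * psi t)).
Proof. by move=> cw cf cp; apply: jcontM => //; exact: (tens_cont cf cp). Qed.

Lemma JJ_swap w f psi : jcont w -> continuous f -> continuous psi ->
  JJ r b w f psi = J (- r) r (fun x => J (- b) 0 (fun t => w x t * (f x * psi t))).
Proof. by move=> cw cf cp; rewrite (J_fubini (JJ_jcont cw cf cp)). Qed.

Lemma JJ_eq w w' f psi : (forall x t, - r <= x <= r -> - b <= t <= 0 -> w x t = w' x t) ->
  JJ r b w f psi = JJ r b w' f psi.
Proof. by move=> h; apply: J_eq => t ht; apply: J_eq => x hx; rewrite h. Qed.

Lemma JJ_linx k w f g psi : jcont w -> tst (- r) r f -> tst (- r) r g -> tst (- b) 0 psi ->
  JJ r b w (fun x => k * f x + g x) psi = k * JJ r b w f psi + JJ r b w g psi.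
Proof.
move=> cw /tst_cont cf /tst_cont cg /tst_cont cp.
have jf := JJ_jcont cw cf cp; have jg := JJ_jcont cw cg cp.
rewrite /JJ -J_scale; last exact: J_param_cont.
rewrite -J_add//; [|exact: contZ (J_param_cont rr jf)|exact: J_param_cont].
apply: J_eq => t _; rewrite -J_scale; last exact: (jcont_x jf).
rewrite -J_add//; [|exact: contZ (jcont_x jf)|exact: (jcont_x jg)].
by apply: J_eq => x _; ring.
Qed.

Lemma JJ_lint k w f psi phi : jcont w -> tst (- r) r f -> tst (- b) 0 psi -> tst (- b) 0 phi ->
  JJ r b w f (fun t => k * psi t + phi t) = k * JJ r b w f psi + JJ r b w f phi.
Proof.
move=> cw /tst_cont cf /tst_cont cg /tst_cont cp.
have jf := JJ_jcont cw cf cg; have jg := JJ_jcont cw cf cp.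
rewrite /JJ -J_scale; last exact: J_param_cont.
rewrite -J_add//; [|exact: contZ (J_param_cont rr jf)|exact: J_param_cont].
apply: J_eq => t _; rewrite -J_scale; last exact: (jcont_x jf).
rewrite -J_add//; [|exact: contZ (jcont_x jf)|exact: (jcont_x jg)].
by apply: J_eq => x _; ring.
Qed.

Lemma JJ_parts (U : nat -> R -> R -> R) m f psi : (forall i, jcont (U i)) ->
  (forall i t, drv (fun x => U i x t) (fun x => U i.+1 x t)) ->
  tst (- r) r f -> continuous psi ->
  JJ r b (U 0%N) (Dn m f) psi = (-1) ^+ m * JJ r b (U m) f psi.
Proof.
move=> cU dU tf cp; have cf := tst_cont tf; have cfm := tst_cont (tst_Dn m tf).
rewrite /JJ -J_scale; last exact: (J_param_cont rr (JJ_jcont (cU m) cf cp)).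
have key (w : R -> R -> R) (g : R -> R) t : continuous (fun x => w x t) -> continuous g ->
    J (- r) r (fun x => w x t * (g x * psi t)) = psi t * J (- r) r (fun x => w x t * g x).
  move=> cw cg; rewrite -J_scale; last exact: contM.
  by apply: J_eq => x _; ring.
apply: J_eq => t _; rewrite !key//; try exact: (jcont_x (cU _)).
by rewrite (@J_parts_iter R (- r) r f m (fun i x => U i x t) rr tf (fun i => dU i t)) mulrCA.
Qed.

(** Exchanging the integrals, one integrates by parts in time at fixed [x]. *)
Lemma JJ_dt (V q : R -> R -> R) f psi : jcont V -> jcont q ->
  (forall x s t, - r < x < r -> - b <= s -> s <= t -> t <= 0 -> V x t - V x s = - J s t (q x)) ->
  tst (- r) r f -> tst (- b) 0 psi -> JJ r b V f (D psi) = JJ r b q f psi.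
Proof.
move=> cV cq tV tf tp; have cf := tst_cont tf; have cp := tst_cont tp.
have cdp := tst_cont (tst_drv tp); have dp := (smooth_drv (tst_smooth tp)).1.
rewrite (JJ_swap cV cf cdp) (JJ_swap cq cf cp).
apply: J_eq => x /andP[x1 x2].
have [f1 f2] := supp_end (tst_supp tf) cf.
have [p1 p2] := supp_end (tst_supp tp) cp.
have [fx0|fx0] := eqVneq (f x) 0.
  by rewrite !J_eq0// => t _; rewrite fx0 mul0r mulr0.
have hx : - r < x < r.
  apply/andP; split; rewrite lt_neqAle ?x1 ?x2 andbT; apply: contra_neq fx0.
    by move=> <-.
  by move=> ->.
have cqx : continuous (q x) := jcont_t cq.
have [F dF hF] := time_extension cqx (fun s t => @tV x s t hx).
transitivity (f x * J (- b) 0 (fun t => D psi t * F t)).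
  rewrite -J_scale; last exact: contM cdp (drv_continuous dF).
  by apply: J_eq => t ht; rewrite hF//; ring.
rewrite (J_parts bb cdp (contN cqx) dp dF) p1 p2 !mul0r subrr sub0r mulrN -mulNr.
rewrite -J_scale; last exact: contM cp (contN cqx).
by apply: J_eq => t _; ring.
Qed.

Section Pairing.
Variables v vx vxx : R * R -> R.
Hypothesis hv : suitable_weak_solution v vx vxx.

Lemma pair_integrable f psi : tst (- r) r f -> tst (- b) 0 psi ->
  leb2.-integrable (Q1_open : set RR) (EFin \o (fun z => v z * tens f psi z)).
Proof.
move=> tf tp; have [p [q [c [d [ins _ _ _ _]]]]] := tst_inside r12 b16 tf tp.
exact: tens_integrable (v_L1loc hv) (tst_cont tf) (tst_cont tp) ins.
Qed.

Lemma pair_linx k f g psi : tst (- r) r f -> tst (- r) r g -> tst (- b) 0 psi ->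
  pair v (fun x => k * f x + g x) psi = k * pair v f psi + pair v g psi.
Proof.
move=> tf tg tp; have mO := @Q1_open_measurable R.
have i1 := pair_integrable tf tp; have i2 := pair_integrable tg tp.
have i3 : leb2.-integrable (Q1_open : set RR) (EFin \o (fun z => k * (v z * tens f psi z))).
  exact: (integrableZl mO k i1).
rewrite /pair -(RintegralZl k mO i1) -(RintegralD mO i3 i2).
by apply: eq_Rintegral => z _; rewrite /tens; ring.
Qed.

Lemma pair_lint k f psi phi : tst (- r) r f -> tst (- b) 0 psi -> tst (- b) 0 phi ->
  pair v f (fun t => k * psi t + phi t) = k * pair v f psi + pair v f phi.
Proof.
move=> tf tg tp; have mO := @Q1_open_measurable R.
have i1 := pair_integrable tf tg; have i2 := pair_integrable tf tp.
have i3 : leb2.-integrable (Q1_open : set RR) (EFin \o (fun z => k * (v z * tens f psi z))).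
  exact: (integrableZl mO k i1).
rewrite /pair -(RintegralZl k mO i1) -(RintegralD mO i3 i2).
by apply: eq_Rintegral => z _; rewrite /tens; ring.
Qed.

(** The open rectangles that stay away from the top [t = 0] exhaust the
    cylinder up to a horizontal segment, which is a null set. *)
Lemma ae_eq_of_pairings (V : R -> R -> R) (s h : R) : jcont V -> 0 < s -> s < r -> 0 < h -> h < b ->
  (forall f psi, tst (- r) r f -> tst (- b) 0 psi -> pair v f psi = JJ r b V f psi) ->
  {ae leb2, forall z : RR, (`]- s, s[ `*` `]- h, 0]) z -> V z.1 z.2 = v z}.
Proof.
move: (r12) (b16) => r12' b16' cV s0 sr h0 hb E.
(* the rectangles are cut at time [- e n], at a positive distance from the top *)
pose e n : R := h / n.+2%:R.
have e0 n : 0 < e n by rewrite divr_gt0.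
have eh n : e n < h by rewrite /e ltr_pdivrMr// ltr_pMr// ltr1n.
pose U n : set RR := `]- s, s[ `*` `]- h, - e n[.
pose F (z : RR) := v z - V z.1 z.2.
have mU n : measurable (U n) by apply: measurableX; exact: measurable_itv.
have ae0 n : ae_eq leb2 (U n) (EFin \o F) (cst 0%E).
  have bQ : box (- s) s (- h) (- e n) `<=` Q1_open.
    move=> [x t] [/=]; rewrite !in_itv/= => /andP[? ?] /andP[? ?].
    by have := e0 n => ?; split; rewrite /= in_itv/=; apply/andP; split; lra.
  apply: ae_zero.
    have he := eh n.
    have i1 := v_L1loc hv (@box_compact R (- s) s (- h) (- e n)) bQ.
    have i2 : leb2.-integrable (box (- s) s (- h) (- e n) : set RR) (fun z => (V z.1 z.2)%:E).
      by apply: box_integrable => //; lra.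
    have mB := @box_measurable R (- s) s (- h) (- e n).
    apply: (integrableS mB (mU n) _ (integrableB mB i1 i2)).
    move=> z [/=]; rewrite !in_itv/= => /andP[? ?] /andP[? ?].
    by split; rewrite /= in_itv/= !ltW.
  move=> f psi sf sp uf up.
  have tf : tst (- r) r f by split => //; exists (- s), s; split => //; lra.
  have tp : tst (- b) 0 psi.
    by have := e0 n; have := eh n => ? ?; split => //; exists (- h), (- e n); split => //; lra.
  have [f1 f2] := supp_end uf (smooth_cont sf).
  have [p1 p2] := supp_end up (smooth_cont sp).
  have t0 z : ~ U n z -> tens f psi z = 0.
    move=> nU; rewrite /tens; have [fx0|fx0] := eqVneq (f z.1) 0; first by rewrite fx0 mul0r.
    have [fp0|fp0] := eqVneq (psi z.2) 0; first by rewrite fp0 mulr0.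
    exfalso; apply: nU; split; rewrite /= in_itv/=.
      have : - s <= z.1 <= s by apply: contra_neqT fx0 => /uf.
      move=> /andP[x1 x2]; apply/andP; split; rewrite lt_neqAle ?x1 ?x2 andbT; apply: contra_neq fx0.
        by move=> <-.
      by move=> ->.
    have : - h <= z.2 <= - e n by apply: contra_neqT fp0 => /up.
    move=> /andP[x1 x2]; apply/andP; split; rewrite lt_neqAle ?x1 ?x2 andbT; apply: contra_neq fp0.
      by move=> <-.
    by move=> ->.
  have mO := @Q1_open_measurable R.
  have UQ : U n `<=` Q1_open.
    apply: subset_trans bQ => z [/=]; rewrite !in_itv/= => /andP[? ?] /andP[? ?].
    by split; rewrite /= in_itv/= !ltW.
  have [p [q [c [d [ins _ _ _ _]]]]] := tst_inside r12 b16 tf tp.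
  have i2 := tens_integrable (jcont_L1loc cV) (tst_cont tf) (tst_cont tp) ins.
  rewrite -(@int_restrict R Q1_open (U n) (fun z => ((v z * tens f psi z)%:E - (V z.1 z.2 * tens f psi z)%:E)%E) _ UQ).
  - have E1 := pair_int hv r12 b16 tf tp.
    have E2 := slope_int r0 r12 b16 cV tf tp.
    rewrite (integralB mO (pair_integrable tf tp) i2).
    have E3 := E f psi tf tp.
    apply: etrans (congr2 (fun x y : \bar R => (x - y)%E) E1 E2) _.
    by rewrite E3 -EFinB subrr.
  - by move=> z _; rewrite -EFinB -mulrBl.
  - by move=> z _ /t0 ->; rewrite !mulr0 subee.
have aeall := ae_foralln ae0.
have line : {ae leb2, forall z : RR, ~ (`[- s, s] `*` [set 0]) z}.
  have N : leb2.-negligible (`[- s, s] `*` [set 0] : set RR).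
    apply/negligibleP; last exact: line_null.
    by apply: measurableX; [exact: measurable_itv|exact: measurable_set1].
  by apply: negligibleS N => z /= /contrapT.
move: aeall line; apply: filterS2 => -[x t] hU hl [/=]; rewrite !in_itv/= => hx /andP[t1 t2].
have t0 : t < 0.
  rewrite lt_neqAle t2 andbT; apply/eqP => tE; apply: hl; split => //=.
  by rewrite in_itv/=; case/andP: hx => *; rewrite !ltW.
have [n hn] : exists n, t < - e n.
  exists (Num.truncn (h / - t)); rewrite ltrNr /e ltr_pdivrMr// mulrC -ltr_pdivrMr ?oppr_gt0//.
  by apply: lt_trans (truncnS_gt _) _; rewrite ltr_nat.
have : U n (x, t) by split; rewrite /= in_itv/= ?t1.
by move=> /(hU n) [/eqP]; rewrite /F subr_eq0 => /eqP.
Qed.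

End Pairing.
End Identify.

(** * Smoothness of suitable weak solutions *)

(** Both sides are the integral over the whole cylinder. *)
Lemma JJ_enlarge (R : realType) (r0 b0 r b : R) (w : R -> R -> R) (f psi : R -> R) : 0 < r -> r <= r0 -> r0 < 2^-1 ->
  b <= b0 -> b0 < 16^-1 -> jcont w -> tst (- r) r f -> tst (- b) 0 psi ->
  JJ r0 b0 w f psi = JJ r b w f psi.
Proof.
move=> r0' rr h1 bb h2 cw tf tp.
have r1 : 0 < r0 by lra.
have r2 : r < 2^-1 by lra.
have b2 : b < 16^-1 by lra.
have tf0 : tst (- r0) r0 f by apply: tst_sub tf; lra.
have tp0 : tst (- b0) 0 psi by apply: tst_sub tp; lra.
apply: EFin_inj; apply: etrans (esym (slope_int r1 h1 h2 cw tf0 tp0)) _.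
have := slope_int r0' r2 b2 cw tf tp.
exact.
Qed.

Lemma JJ_addw (R : realType) (r b : R) (w w' : R -> R -> R) (f psi : R -> R) : - r <= r -> - b <= 0 ->
  jcont w -> jcont w' -> continuous f -> continuous psi ->
  JJ r b (fun x t => w x t + w' x t) f psi = JJ r b w f psi + JJ r b w' f psi.
Proof.
move=> rr bb cw cw' cf cp.
have j1 := JJ_jcont cw cf cp; have j2 := JJ_jcont cw' cf cp.
rewrite /JJ -J_add//; [|exact: J_param_cont|exact: J_param_cont].
apply: J_eq => t _; rewrite -J_add//; [|exact: (jcont_x j1)|exact: (jcont_x j2)].
by apply: J_eq => x _; rewrite mulrDl.
Qed.

Lemma JJ_cstw (R : realType) (r b : R) (K : R) (f psi : R -> R) : continuous f -> continuous psi ->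
  JJ r b (fun _ _ => K) f psi = K * (J (- r) r f * J (- b) 0 psi).
Proof.
move=> cf cp; rewrite /JJ mulrA -J_scale//; apply: J_eq => t _.
rewrite -mulrA (mulrC (J _ _ _)) mulrA -J_scale//.
by apply: J_eq => x _; ring.
Qed.

Theorem corollary1p7 (R : realType) (gamma eps Cgamma : R)
  (hgamma0 : 0 < gamma) (hgamma1 : gamma < 1)
  (heps : 0 < eps) (hC : 0 < Cgamma)
  (hreg : forall w wx wxx : R * R -> R,
     suitable_weak_solution w wx wxx ->
     (\int[leb2]_(z in Q 1%R) (`|wx z| ^+ 3)%:E <= eps%:E)%E ->
     exists g : R * R -> R,
       ae_eq_on (Q 2^-1) g wx /\
       holder_on (Q 2^-1) (Cgamma * eps `^ 3^-1) gamma g)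
  (v vx vxx : R * R -> R)
  (hv : suitable_weak_solution v vx vxx)
  (hsmall : (\int[leb2]_(z in Q 1%R) (`|vx z| ^+ 3)%:E <= eps%:E)%E) :
  exists u : R * R -> R, ae_eq_on (Q 8^-1) u v /\ Cinfty (Q 8^-1) u.
Proof.
have [g [gv gH]] := hreg _ _ _ hv hsmall.
have K0 : 0 < Cgamma * eps `^ 3^-1 by rewrite mulr_gt0// powR_gt0.
pose s0 : R := 8^-1.
have [r0 [r1 [hr0 hr1 hr2 hr3]]] : exists r0 r1 : R, [/\ 0 < r1, r1 < r0, r0 < 2^-1 & s0 < r1].
  (* nested rectangles between [Q (1/8)] and [Q (1/2)] *)
  by exists (4^-1), (3 / 16); rewrite /s0; split; lra.
have [b0 [b1 [hb0 hb1 hb2 hb3]]] : exists b0 b1 : R, [/\ 0 < b1, b1 < b0, b0 < 16^-1 & s0 ^+ 4 < b1].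
  exists (32^-1), (64^-1); rewrite /s0 exprVn -natrX; split; lra.
have s00 : 0 < s0 by rewrite invr_gt0.
have s04 : 0 < s0 ^+ 4 by rewrite exprn_gt0.
have r00 : 0 < r0 by lra.
have b00 : 0 < b0 by lra.
have r1h : r1 < 2^-1 by lra.
have b1h : b1 < 16^-1 by lra.
have rr1 : - r1 < r1 by lra.
have bb1 : - b1 < 0 by lra.
have ssub f : tst (- r1) r1 f -> tst (- r0) r0 f by apply: tst_sub; lra.
have bsub f : tst (- b1) 0 f -> tst (- b0) 0 f by apply: tst_sub; lra.
pose w := slope g r0 b0.
have cw : jcont w := slope_jcont hgamma0 K0 gH r00 hr2 b00 hb2.
have [M wM] := slope_bounded hgamma0 K0 gH r00 hr2 b00 hb2.
have [W [cW bW dW Ww tW]] := interior_smoothing hgamma0 (ltW hgamma1) r00 (ltW hr2) b00 cw wM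
  (slope_holder_x hgamma0 K0 gH r00 hr2 b00 hb2)
  (slope_equation hgamma0 K0 hv gv gH r00 hr2 b00 hb2) hr0 hr1 hb0 hb1.
have [L _ W0L] := bW 0%N.
have [V [cV dV tV]] := potential hr0 hb0 cW W0L dW tW.
have cev p : jcont (ev W p) by apply: ev_jcont.
have Vdx f psi : tst (- r1) r1 f -> tst (- b1) 0 psi ->
    pair v (D f) psi = JJ r1 b1 V (D f) psi.
  move=> tf tp.
  rewrite (pair_dx hgamma0 K0 hv gv gH r00 hr2 b00 hb2 (ssub _ tf) (bsub _ tp)).
  have e1 := JJ_enlarge hr0 (ltW hr1) hr2 (ltW hb1) hb2 cw tf tp.
  have e2 : JJ r1 b1 w f psi = JJ r1 b1 (W 0%N) f psi by apply: JJ_eq => x t hx ht; rewrite Ww.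
  (* [V] followed by the [W j] is a chain of x-derivatives *)
  pose U k : R -> R -> R := if k is j.+1 then W j else V.
  have cU k : jcont (U k) by case: k.
  have dU k t : drv (fun x => U k x t) (fun x => U k.+1 x t) by case: k => [|k]; [exact: dV|exact: dW].
  have e3 := @JJ_parts _ r1 b1 hr0 U 1 f psi cU dU tf (tst_cont tp).
  rewrite expr1 mulN1r in e3.
  exact: etrans (congr1 -%R (etrans e1 e2)) (esym e3).
have Vdt f psi : tst (- r1) r1 f -> tst (- b1) 0 psi ->
    pair v f (D psi) = JJ r1 b1 V f (D psi).
  move=> tf tp; have cp := tst_cont tp.
  rewrite (pair_dt hgamma0 K0 hv gv gH r00 hr2 b00 hb2 (ssub _ tf) (bsub _ tp)).
  have rr1' := ltW rr1; have bb1' := ltW bb1.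
  rewrite (JJ_dt hr0 hb0 cV (cev fluxp) tV tf tp).
  have c3 : jcont (ev W (DVar 3)) := cev (DVar 3).
  have c2 : jcont (ev W (iter 2 dx1 dsq)) := cev (iter 2 dx1 dsq).
  apply: etrans _ (esym (JJ_addw rr1' bb1' c3 c2 (tst_cont tf) cp)).
  have cwX : jcont (fun x t => w x t ^+ 2) := jcontX (n := 2) cw.
  have e1 := JJ_enlarge hr0 (ltW hr1) hr2 (ltW hb1) hb2 cwX (tst_Dn 2 tf) tp.
  have e2 : JJ r1 b1 (fun x t => w x t ^+ 2) (Dn 2 f) psi = JJ r1 b1 (ev W dsq) (Dn 2 f) psi.
    by apply: JJ_eq => x t hx ht; rewrite /= Ww// expr2.
  pose U k : R -> R -> R := ev W (iter k dx1 dsq).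
  have e3 := @JJ_parts _ r1 b1 hr0 U 2 f psi (fun k => cev _) (fun k t => ev_drv (iter k dx1 dsq) t dW) tf cp.
  pose U' k : R -> R -> R := if k is j.+1 then W j else V.
  have cU k : jcont (U' k) by case: k.
  have dU k t : drv (fun x => U' k x t) (fun x => U' k.+1 x t) by case: k => [|k]; [exact: dV|exact: dW].
  have e4 := @JJ_parts _ r1 b1 hr0 U' 4 f psi cU dU tf cp.
  have e5 := Vdx _ _ (tst_Dn 3 tf) tp.
  rewrite expr2 mulrNN mul1r mul1r in e3.
  rewrite exprS exprS expr2 !mulN1r !opprK mul1r in e4.
  exact: (congr2 +%R (etrans e5 e4) (etrans (etrans e1 e2) e3)).
pose E f psi := pair v f psi - JJ r1 b1 V f psi.
have [K EK] : exists K, forall f psi, tst (- r1) r1 f -> tst (- b1) 0 psi ->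
    E f psi = K * (J (- r1) r1 f * J (- b1) 0 psi).
  apply: tensor_constant => //.
  - move=> k f1 f2 psi t1 t2 tp.
    by rewrite /E (pair_linx r1h b1h hv k t1 t2 tp) (JJ_linx hr0 hb0 k cV t1 t2 tp) opprD mulrBr addrACA.
  - move=> k f psi phi tf t1 t2.
    by rewrite /E (pair_lint r1h b1h hv k tf t1 t2) (JJ_lint hr0 hb0 k cV tf t1 t2) opprD mulrBr addrACA.
  - by move=> f psi tf tp; rewrite /E Vdx// subrr.
  - by move=> f psi tf tp; rewrite /E Vdt// subrr.
exists (fun z => V z.1 z.2 + K); split; last first.
  by have := @ev_Cinfty R W r1 b1 cW dW tW V K s0 s00 hr3 (ltW hb3) cV dV tV.
have cVK : jcont (fun x t => V x t + K) by apply: jcontD => //; exact: jcont_cst.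
have := ae_eq_of_pairings hr0 r1h b1h hv cVK s00 hr3 s04 hb3.
rewrite /ae_eq_on /Q /cyl /= !sub0r add0r; apply.
move=> f psi tf tp; have := EK f psi tf tp; rewrite /E => /eqP; rewrite subr_eq => /eqP ->.
have cf := tst_cont tf; have cp := tst_cont tp.
by rewrite -(JJ_cstw r1 b1 K cf cp) addrC -(JJ_addw (ltW rr1) (ltW bb1) cV (@jcont_cst R K) cf cp).
Qed.
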